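(* Let $1<p<\infty$. One can choose a compact neighbourhood $U$ of the identity of $G$, a $U$-dense family of points $\{x_i\}_{i\in I}$ in $G$, and a partition of unity $\{\psi_i\}_{i\in I}$ on $G$ with $\mathrm{supp}(\psi_i)\subseteq x_iU$ for all $i$, such that each of the following operators is invertible with continuous inverse: (a) $S: L^p(G)*F_2\to L^p(G)*F_2$ defined by $Sf=\sum_i f(x_i)\,(\psi_i*F_2)$; (b) $T: L^p(G)*F_2\to L^p(G)*F_2$ defined by $Tf=\sum_i c_i f(x_i)\,\ell_{x_i}F_2$, where $c_i=\int_G\psi_i(x)\,dx$; (c) $R: L^p(G)*F_2\to L^p(G)*F_2$ defined by $Rf=\sum_i\Big(\int_G f(x)\psi_i(x)\,dx\Big)\,\ell_{x_i}F_2$.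
   Context: $G$ is the connected $(ax+b)$-group realized as the matrix group $G=\left\{\begin{pmatrix}a&b\\0&a^{-1}\end{pmatrix} : a>0,\ b\in\mathbb{R}\right\}$, whose elements are written $(a,b)$; thus $(a,b)(x,y)=(ax,\,ay+bx^{-1})$. The left Haar measure $dx$ on $G$ is $\frac{da\,db}{a^2}$, and $L^p(G)$ is taken with respect to it. Convolution is $(f*g)(x)=\int_G f(y)g(y^{-1}x)\,dy$, and left translation is $(\ell_xf)(y)=f(x^{-1}y)$. The function $F_2:G\to\mathbb{C}$ is $$F_2(a,b)=\frac12\,(a+a^{-1}-ib)^{-2}.$$ For $1<p<\infty$ the map $f\mapsto f*F_2$ is bounded on $L^p(G)$; $L^p(G)*F_2=\{f*F_2 : f\in L^p(G)\}$ carries the $L^p$ norm, and its elements are identified with their continuous representatives, so that point values make sense. For a compact neighbourhood $U$ of the identity, a family $\{x_i\}$ in $G$ is called $U$-dense if $G=\bigcup_i x_iU$. A partition of unity is a family of continuous functions $\psi_i:G\to[0,1]$ with $\sum_i\psi_i=1$. *)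

(* Defs.v *)
From HB Require Import structures.
From mathcomp Require Import all_boot all_order all_algebra finmap.
From mathcomp Require Import all_classical all_reals all_analysis.
From mathcomp Require Import measurable_realfun.
From mathcomp.analysis.showcase Require Import summability.
From mathcomp Require Import complex.
From mathcomp Require Import ring lra.

Set Implicit Arguments.
Unset Strict Implicit.
Unset Printing Implicit Defensive.
Import Order.TTheory GRing.Theory Num.Theory.
Import numFieldNormedType.Exports.

Local Open Scope classical_set_scope.
Local Open Scope ring_scope.
Local Open Scope complex_scope.

Record axb (R : realType) := AxB { axb_val : R * R; axb_gt0 : 0 < axb_val.1 }.

HB.instance Definition _ (R : realType) := [isSub for @axb_val R].
HB.instance Definition _ (R : realType) := [Choice of axb R by <:].

Section axb_group.
Context {R : realType}.
Local Notation G := (axb R).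

Definition axb_one : G := @AxB R (1, 0) ltr01.

Definition axb_mul (x y : G) : G :=
  let: AxB (a, b) a0 := x in let: AxB (c, d) c0 := y in
  @AxB R (a * c, a * d + b * c^-1) (mulr_gt0 a0 c0).

Definition axb_inv (x : G) : G :=
  let: AxB (a, b) a0 := x in
  @AxB R (a^-1, - b) (eq_ind_r is_true a0 (invr_gt0 a)).

Lemma axb_mulA : associative axb_mul.
Proof.
move=> [[a b] /= a0] [[c d] /= c0] [[e f] /= e0]; apply/val_inj => /=.
by congr pair; field; rewrite ?lt0r_neq0.
Qed.

Lemma axb_mul1g : left_id axb_one axb_mul.
Proof.
by move=> [[a b] /= a0]; apply/val_inj => /=; rewrite !mul1r mul0r addr0.
Qed.

Lemma axb_mulg1 : right_id axb_one axb_mul.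
Proof.
by move=> [[a b] /= a0]; apply/val_inj => /=; rewrite mulr0 invr1 !mulr1 add0r.
Qed.

Lemma axb_mulVg : left_inverse axb_one axb_inv axb_mul.
Proof.
move=> [[a b] /= a0]; apply/val_inj => /=.
by congr pair; field; rewrite ?lt0r_neq0.
Qed.

Lemma axb_mulgV : right_inverse axb_one axb_inv axb_mul.
Proof.
move=> [[a b] /= a0]; apply/val_inj => /=.
by congr pair; field; rewrite ?lt0r_neq0.
Qed.

HB.instance Definition _ := isGroup.Build G
  axb_mulA axb_mul1g axb_mulg1 axb_mulVg axb_mulgV.

HB.instance Definition _ := isPointed.Build G 1%g.

Definition axb_mx (x : G) : 'M[R]_2 :=
  let: (a, b) := axb_val x in
  \matrix_(i < 2, j < 2)
    (if i == 0 then if j == 0 then a else b else if j == 0 then 0 else a^-1).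

Lemma axb_mxM (x y : G) : axb_mx (x * y)%g = axb_mx x *m axb_mx y.
Proof.
case: x y => [[a b] /= a0] [[c d] /= c0].
apply/matrixP => i j; rewrite !mxE big_ord_recl big_ord1 !mxE /=.
case: i => [[|[|//]] ?]; case: j => [[|[|//]] ?] //=;
  by rewrite ?mulr0 ?mul0r ?addr0 ?add0r ?invfM.
Qed.

Lemma axb_mx_inj : injective axb_mx.
Proof.
move=> [[a b] /= a0] [[c d] /= c0] /matrixP e; apply/val_inj => /=.
by move: (e 0 0) (e 0 1); rewrite !mxE /= => -> ->.
Qed.

Lemma axb_mx_image : range axb_mx =
  [set M | 0 < M 0 0 /\ M 1 0 = 0 /\ M 1 1 = (M 0 0)^-1].
Proof.
apply/seteqP; split => [_ [[[a b] /= a0] _ <-]|M /= [a0 [M10 M11]]].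
  by rewrite !mxE.
exists (@AxB R (M 0 0, M 0 1) a0) => //; apply/matrixP => i j; rewrite mxE /=.
case: i => [[|[|//]] i2]; case: j => [[|[|//]] j2] //=.
- by congr (M _ _); apply/val_inj.
- by congr (M _ _); apply/val_inj.
- by rewrite -M10; congr (M _ _); apply/val_inj.
- by rewrite -M11; congr (M _ _); apply/val_inj.
Qed.

End axb_group.

HB.instance Definition _ (R : realType) :=
  Topological.copy (axb R) (initial_topology (@axb_val R)).

HB.instance Definition _ (R : realType) :=
  Measurable.copy (axb R) (g_sigma_algebra_preimageType (@axb_val R)).

Section haar.
Context {R : realType}.
Local Notation G := (axb R).
Local Open Scope ereal_scope.

Definition haar (A : set G) : \bar R :=
  \int[lebesgue_measure \x lebesgue_measure]_(z in @axb_val R @` A)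
    (z.1 ^- 2)%:E.

Lemma range_axb_val : range (@axb_val R) = [set z : R * R | (0 < z.1)%R].
Proof.
apply/seteqP; split=> [_ [x _ <-]|z z0]; first exact: axb_gt0.
by exists (AxB z0).
Qed.

Lemma measurable_axb_val_image (A : set G) :
  measurable A -> measurable (@axb_val R @` A).
Proof.
move=> [B mB <-]; rewrite setTI.
have -> : @axb_val R @` (@axb_val R @^-1` B) =
    B `&` (fst @^-1` [set x : R | (0 < x)%R]).
  apply/seteqP; split=> [_ [x Bx <-]|z [Bz z0]].
    by split=> //; exact: axb_gt0.
  by exists (AxB z0).
apply: measurableI => //; rewrite -[X in measurable X]setTI.
apply: measurable_fst => //.
have -> : [set x : R | (0 < x)%R] = `]0%R, +oo[%classic.
  by apply/seteqP; split=> x /=; rewrite in_itv/= andbT.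
exact: measurable_itv.
Qed.

Lemma measurable_axb_density :
  measurable_fun [set z : R * R | (0 < z.1)%R]
    (fun z : R * R => (z.1 ^- 2)%:E : \bar R).
Proof.
apply/measurable_EFinP.
apply: (eq_measurable_fun (fun z : R * R => z.1 `^ (- 2%:R))%R) => [z|].
  rewrite inE /= => z0; rewrite powRN powR_mulrn//; exact: ltW.
apply: measurable_funTS.
exact: (measurableT_comp (measurable_powR (- 2%:R)) (@measurable_fst _ _ R R)).
Qed.

Let haar0 : haar set0 = 0.
Proof. by rewrite /haar image_set0 integral_set0. Qed.

Let haar_ge0 A : 0 <= haar A.
Proof.
by apply: integral_ge0 => z _; rewrite lee_fin invr_ge0 exprn_even_ge0.
Qed.

Let haar_sigma_additive : semi_sigma_additive haar.
Proof.
move=> F mF tF mU.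
have mI i : measurable (@axb_val R @` F i) by exact: measurable_axb_val_image.
rewrite {2}/haar image_bigcup ge0_integral_bigcup//=.
- apply: is_cvg_ereal_nneg_natsum_cond => n _ _.
  exact: haar_ge0.
- apply: (measurable_funS _ _ measurable_axb_density).
    by rewrite -range_axb_val; exact: measurable_axb_val_image.
  by rewrite -image_bigcup -range_axb_val; exact: image_subset.
- by move=> z _; rewrite lee_fin invr_ge0 exprn_even_ge0.
- move=> i j _ _ [_ [[x Fx <-] [y Fy /val_inj yx]]].
  by apply: tF => //; exists x; split=> //; rewrite -yx.
Qed.

HB.instance Definition _ := isMeasure.Build _ G R haar
  haar0 haar_ge0 haar_sigma_additive.

End haar.

Section function_spaces.
Context {R : realType}.
Local Notation G := (axb R).
Local Notation C := R[i].
Implicit Types (f g : G -> C) (p : R).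

Definition cintegral f : C :=
  (\int[haar]_x complex.Re (f x)) +i* (\int[haar]_x complex.Im (f x)).

Definition convolution f g : G -> C :=
  fun x => cintegral (fun y => f y * g (y^-1 * x)%g).

Definition ltrans (x : G) f : G -> C := fun y => f (x^-1 * y)%g.

Definition Lp_norm p f : \bar R :=
  ('N[haar]_(p%:E)[EFin \o (fun x => Normc.normc (f x))])%E.

Definition Lp p : set (G -> C) := [set f |
  [/\ measurable_fun setT (fun x => complex.Re (f x)),
      measurable_fun setT (fun x => complex.Im (f x)) &
      (Lp_norm p f < +oo)%E]].

Definition F2 : G -> C := fun x =>
  let: (a, b) := axb_val x in 2^-1 * ((a + a^-1) -i* b) ^- 2.

(* Each class in L^p(G) * F2 is represented by its continuous member.  The
   regular algebra R[i]^o carries the norm topology of R[i]. *)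
Definition LpF2 p : set (G -> C) := [set h |
  continuous (h : G -> C^o) /\
  exists2 f, Lp p f & {ae haar, forall x, h x = convolution f F2 x}].

(* Unconditional convergence in L^p(G): the finite partial sums, directed by
   inclusion of the index sets, converge to s in norm. *)
Definition Lp_has_sum p (I : choiceType) (u : I -> G -> C) (s : G -> C) :=
  (fun J : {fset I} => Lp_norm p (fun z => \sum_(i <- J) u i z - s z)) @ totally
    --> 0%E.

Definition Lp_continuous p (A : LpF2 p -> LpF2 p) :=
  forall (f : LpF2 p) (e : R), 0 < e -> exists2 d : R, 0 < d &
  forall g : LpF2 p, (Lp_norm p (fun z => val g z - val f z)%R < d%:E)%E ->
    (Lp_norm p (fun z => val (A g) z - val (A f) z)%R < e%:E)%E.

Definition invertible_with_continuous_inverse p (A : LpF2 p -> LpF2 p) :=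
  exists B : LpF2 p -> LpF2 p, [/\ cancel A B, cancel B A & Lp_continuous B].

End function_spaces.

Section sampling.
Context {R : realType}.
Local Notation G := (axb R).

Definition lcoset_set (x : G) (U : set G) : set G := [set (x * u)%g | u in U].

Definition compact_nbhs_one (U : set G) := compact U /\ nbhs (1%g : G) U.

Definition U_dense (U : set G) (I : Type) (x : I -> G) :=
  \bigcup_i lcoset_set (x i) U = setT.

Definition partition_of_unity (I : choiceType) (psi : I -> G -> R) :=
  [/\ forall i, continuous (psi i),
      forall i z, 0 <= psi i z <= 1 &
      forall z, (\esum_(i in [set: I]) (psi i z)%:E = 1)%E].

Definition fsupp (f : G -> R) : set G := closure [set z | f z != 0].

End sampling.

(* Main.v *)
From HB Require Import structures.
Require Import Defs.
From mathcomp Require Import all_boot all_order all_algebra finmap.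
From mathcomp Require Import all_classical all_reals all_analysis.
From mathcomp Require Import measurable_realfun complex.
From mathcomp Require Import ring lra.

(* The kernel F2 satisfies F2 * F2 = (pi/4) F2, computed by explicit
   primitives in b and then in a, and Schur's test with the weight a^s bounds
   convolution with |F2| on L^p.  Hence L^p * F2 is the space of the h in L^p
   with h * F2 = (pi/4) h pointwise.  On it point evaluations are bounded, so
   it is complete in the pointwise and in the L^p sense at once.
   When y^-1 x_i is within d of the identity, F2(x_i^-1 z) differs from
   F2(y^-1 z) by at most O(d) |F2(y^-1 z)|, because the base a + 1/a - ib
   of the power F2 changes by a relative error O(d).  Since f = (4/pi) f * F2, the
   same gives |f(x_i) - f(y)| <= O(d) (|f| * |F2|)(y).  Writing
   f * F2 = int sum_i psi_i(y) f(y) F2(y^-1 z) dy and replacing f(y) by f(x_i),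
   or F2(y^-1 z) by F2(x_i^-1 z), or both, yields S, R and T: each of them is
   within O(d) of multiplication by pi/4 in operator norm, hence invertible. *)

Set Implicit Arguments.
Unset Strict Implicit.
Unset Printing Implicit Defensive.
Import Order.TTheory GRing.Theory Num.Theory.
Import numFieldNormedType.Exports.
Local Open Scope classical_set_scope.
Local Open Scope ring_scope.
Local Open Scope complex_scope.

(** * Haar measure *)

(** Young's inequality is out of reach because F2 is not integrable: integrating |F2| over b leaves
    a multiple of da / (a^2 (a + 1/a)), which behaves like da/a near 0. A weight a^s with 0 < s <= 1
    removes this logarithmic divergence. Since a -> a^s is a character of G, it is moreover an
    eigenfunction of the kernel |F2(y^-1 x)|, which is exactly what Schur's test asks of a weight.
    The Schur constant depends on p, and through it so do the mesh of the points x_i and the set U.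
    The basic estimate compares F2(g u) with F2(g), with a relative error uniform in g. Hence
    samples of f, which move the right end of F2(y^-1 x), are handled directly, while samples of the
    kernel, which move the left end, are first turned around by F2(x^-1) = conj F2(x). Elements of
    the range are treated as functions, not as classes: requiring h * F2 = (pi/4) h at every point
    fixes the representative, and a zero L^p distance then forces equality everywhere. *)

Section integral_density.
Local Open Scope ereal_scope.
Context d1 d2 (X : measurableType d1) (Y : measurableType d2) (R : realType).
Variables (m : {measure set X -> \bar R}) (n : {measure set Y -> \bar R}).
Variables (phi : X -> Y) (g : X -> R).
Hypothesis mphi : measurable_fun setT phi.
Hypothesis mg : measurable_fun setT g.
Hypothesis g0 : forall x, (0 <= g x)%R.
Hypothesis nE : forall A, measurable A -> n A = \int[m]_(x in phi @^-1` A) (g x)%:E.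

Import HBNNSimple.

(** [nE] says that n is the image under phi of the measure with density g. Level sets of simple
    functions are covered by [nE], and monotone convergence does the rest. *)
Lemma ge0_integral_density (f : Y -> \bar R) :
  measurable_fun setT f -> (forall y, 0 <= f y) ->
  \int[n]_y f y = \int[m]_x (f (phi x) * (g x)%:E).
Proof.
move=> mf f0; pose f_ := nnsfun_approx measurableT mf.
have mfphi k : measurable_fun setT (fun x => (f_ k (phi x))%:E * (g x)%:E).
  by apply: emeasurable_funM; apply/measurable_EFinP => //; exact: measurableT_comp.
transitivity (limn (fun k => \int[n]_x (f_ k x)%:E)).
  rewrite -monotone_convergence//.
  - by apply: eq_integral => y _; apply/esym/cvg_lim => //; exact: cvg_nnsfun_approx.
  - by move=> k; exact/measurable_EFinP/measurable_funP.
  - by move=> k y _; rewrite lee_fin.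
  - by move=> y _ a b ab; rewrite lee_fin; exact/lefP/nd_nnsfun_approx.
rewrite [X in limn X](_ : _ = (fun k => \int[m]_x ((f_ k (phi x))%:E * (g x)%:E))).
  rewrite -monotone_convergence//; last 2 first.
    - by move=> k x _; rewrite mule_ge0// lee_fin.
    - move=> x _ a b ab; apply: lee_wpmul2r; rewrite lee_fin//.
      by have /lefP := nd_nnsfun_approx measurableT mf ab; exact.
  apply: eq_integral => x _; apply/cvg_lim => //; apply: cvgeZr => //.
  exact: cvg_nnsfun_approx.
apply/funext => k.
have mA r : measurable (phi @^-1` (f_ k @^-1` [set r])).
  by rewrite -[X in measurable X]setTI; exact: mphi.
transitivity (\sum_(r \in range (f_ k))
    \int[m]_x ((r * \1_(phi @^-1` (f_ k @^-1` [set r])) x)%:E * (g x)%:E)).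
  under eq_integral do rewrite fimfunE -fsumEFin//.
  rewrite ge0_integral_fsum//; last 2 first.
  - by move=> y; exact/measurable_EFinP/measurable_funM.
  - by move=> y x _; rewrite nnfun_muleindic_ge0.
  apply: eq_fsbigr => r /set_mem [y0 _ <-{r}].
  rewrite integralZl_indic_nnsfun// integral_indic//= setIT nE//.
  under [RHS]eq_integral do rewrite EFinM -muleA.
  rewrite ge0_integralZl//.
  - congr (_ * _); rewrite integral_mkcond; apply: eq_integral => x _.
    by rewrite /= patchE indicE; case: ifPn => _; rewrite ?mul1e ?mul0e.
  - by apply: emeasurable_funM; apply/measurable_EFinP.
  - by move=> x _; rewrite mule_ge0 ?lee_fin// indicE.
  - by rewrite lee_fin.
rewrite -ge0_integral_fsum//.
- apply: eq_integral => x _; rewrite (fimfunE (f_ k)) -fsumEFin//.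
  by rewrite ge0_mule_fsuml// => r; exact: nnfun_muleindic_ge0.
- move=> r; apply: emeasurable_funM; apply/measurable_EFinP => //.
  exact: measurable_funM.
- move=> r x _; apply: mule_ge0; last by rewrite lee_fin.
  by rewrite EFinM; exact: (nnfun_muleindic_ge0 _ r (phi x)).
Qed.

End integral_density.

Section lebesgue_affine.
Context {R : realType}.
Local Notation mu := (@lebesgue_measure R).

(** By uniqueness of Lebesgue measure: a times the image of mu under x -> a x + c gives every
    half-open interval its length. *)
Lemma lebesgue_measure_affine (a c : R) (A : set (measurableTypeR R)) :
  0 < a -> measurable A ->
  mu ((fun x => a * x + c) @^-1` A) = (a^-1%:E * mu A)%E.
Proof.
move=> a0 mA.
have maff : measurable_fun setT (fun x : measurableTypeR R => a * x + c : measurableTypeR R).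
  by apply: measurable_funD => //; exact: measurable_funM.
have -> : mu A = pushforward (mscale (NngNum (ltW a0)) mu)
    (fun x : measurableTypeR R => a * x + c : measurableTypeR R) A.
  apply: lebesgue_measure_unique => // _ [[u v] _ <-].
  rewrite /= /pushforward /mscale /=.
  rewrite (_ : _ @^-1` _ = `](u - c) / a, (v - c) / a]%classic); last first.
    apply/seteqP; split => x /=; rewrite !in_itv /=.
      by rewrite ltr_pdivrMr// ler_pdivlMr// ltrBlDr lerBrDr mulrC.
    by rewrite ltr_pdivrMr// ler_pdivlMr// ltrBlDr lerBrDr mulrC.
  rewrite !lebesgue_measure_itv/= !lte_fin ltr_pM2r ?invr_gt0// ltrD2r.
  case: ifPn => _; last by rewrite mule0.
  by rewrite -!EFinD -EFinM; congr EFin; field; rewrite gt_eqF.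
by rewrite /= /pushforward /mscale /= muleA -EFinM mulVf ?gt_eqF// mul1e.
Qed.

Lemma ge0_integral_affine (a c : R) (f : R -> \bar R) : 0 < a ->
  measurable_fun setT f -> (forall x, 0 <= f x)%E ->
  (\int[mu]_x f (a * x + c)%R = a^-1%:E * \int[mu]_x f x)%E.
Proof.
move=> a0 mf f0.
have maff : measurable_fun setT (fun x : measurableTypeR R => a * x + c : measurableTypeR R).
  by apply: measurable_funD => //; exact: measurable_funM.
have ai : 0 <= a^-1 by rewrite invr_ge0 ltW.
have := ge0_integral_pushforward maff mu measurableT mf (fun y _ => f0 y).
rewrite preimage_setT => <-.
rewrite (_ : (a^-1%:E = (NngNum ai)%:num%:E)%E)// -ge0_integral_mscale//.
apply: eq_measure_integral => A mA _.
by rewrite /= /pushforward /mscale/= lebesgue_measure_affine.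
Qed.

End lebesgue_affine.

(** * Haar measure in the coordinates (a, b) *)

Section chart.
Context {R : realType}.
Local Notation G := (axb R).
Local Notation mu := (@lebesgue_measure R).

(** A total inverse of the chart: points outside the half plane a > 0 go to the identity, where the
    value is harmless because [axb_dens] vanishes at such points. *)
Definition axb_of (z : R * R) : G := insubd (1%g : G) z.

Lemma axb_ofK (z : R * R) : 0 < z.1 -> axb_val (axb_of z) = z.
Proof. by move=> z0; rewrite /axb_of val_insubd z0. Qed.

Lemma axb_valK (x : G) : axb_of (axb_val x) = x.
Proof. exact: valKd. Qed.

Lemma measurable_axb_val : measurable_fun setT (@axb_val R).
Proof. by move=> _ B mB; exists B. Qed.

Lemma measurable_fun_to_axb d (T : measurableType d) (D : set T) (f : T -> G) :
  measurable_fun D (fun t => axb_val (f t)) -> measurable_fun D f.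
Proof. by move=> mf mD _ [B mB <-]; rewrite setTI; exact: mf. Qed.

Lemma measurable_axb_fst : measurable_fun setT (fun x : G => (axb_val x).1).
Proof. exact: (measurableT_comp (@measurable_fst _ _ R R) measurable_axb_val). Qed.

Lemma measurable_axb_snd : measurable_fun setT (fun x : G => (axb_val x).2).
Proof. exact: (measurableT_comp (@measurable_snd _ _ R R) measurable_axb_val). Qed.

Lemma mem_pos_fst (z : R * R) : (z \in [set z : R * R | 0 < z.1]) = (0 < z.1).
Proof. by apply/idP/idP; rewrite inE. Qed.

Lemma measurable_pos_fst : measurable [set z : R * R | 0 < z.1].
Proof.
rewrite -range_axb_val; apply: measurable_axb_val_image; exact: measurableT.
Qed.

Lemma measurable_axb_of : measurable_fun setT axb_of.
Proof.
apply: measurable_fun_to_axb.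
rewrite (_ : (fun t => _) = fun z : R * R => if 0 < z.1 then z else (1, 0)).
  apply: measurable_fun_ifT => //.
  by apply: measurable_fun_ltr => //; exact: measurable_fst.
apply/funext => z; rewrite /axb_of val_insubd; by case: ifP.
Qed.

Definition axb_dens (z : R * R) : R := if 0 < z.1 then z.1 ^- 2 else 0.

Lemma axb_dens_ge0 z : 0 <= axb_dens z.
Proof. by rewrite /axb_dens; case: ifP => // _; rewrite invr_ge0 sqr_ge0. Qed.

Lemma measurable_axb_dens : measurable_fun setT axb_dens.
Proof.
rewrite (_ : axb_dens = (fun z : R * R => z.1 ^- 2) \_ [set z : R * R | 0 < z.1]).
  apply/(measurable_restrictT _ measurable_pos_fst).
  by apply/measurable_EFinP; exact: measurable_axb_density.
by apply/funext => z; rewrite /axb_dens patchE mem_pos_fst.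
Qed.

Lemma haarE (A : set G) : measurable A ->
  haar A = (\int[mu \x mu]_(z in axb_of @^-1` A) (axb_dens z)%:E)%E.
Proof.
move=> mA; rewrite /haar.
rewrite (_ : @axb_val R @` A = axb_of @^-1` A `&` [set z | 0 < z.1]); last first.
  apply/seteqP; split => [_ [x Ax <-]|z [Az z0]].
    by split; [rewrite /preimage/= axb_valK|exact: axb_gt0].
  by exists (axb_of z) => //; rewrite axb_ofK.
rewrite integral_mkcondr; apply: eq_integral => z _.
by rewrite patchE mem_pos_fst /axb_dens; case: ifP => //.
Qed.

Lemma ge0_integral_haar (f : G -> \bar R) :
  measurable_fun setT f -> (forall x, 0 <= f x)%E ->
  (\int[haar]_x f x =
   \int[mu]_a \int[mu]_b (f (axb_of (a, b)) * (axb_dens (a, b))%:E))%E.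
Proof.
move=> mf f0.
rewrite (ge0_integral_density (m := (mu \x mu)%E) (n := haar) measurable_axb_of measurable_axb_dens axb_dens_ge0 haarE)//.
rewrite fubini_tonelli1//.
  apply: emeasurable_funM; first exact: measurableT_comp measurable_axb_of.
  by apply/measurable_EFinP; exact: measurable_axb_dens.
by move=> z; rewrite mule_ge0// lee_fin axb_dens_ge0.
Qed.

(** Needed for Fubini and Tonelli on G x G. The coordinate rectangles [B n] stay away from a = 0, so
    the density is bounded on them. *)
Lemma haar_sigma_finite : sigma_finite setT (@haar R).
Proof.
pose B n : set (R * R) := `[n.+1%:R^-1, n.+1%:R]%classic `*` `[- n.+1%:R, n.+1%:R]%classic.
have mB n : measurable (B n) by apply: measurableX; exact: measurable_itv.
have mvB n : measurable (@axb_val R @^-1` B n).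
  by rewrite -[X in measurable X]setTI; exact: measurable_axb_val.
exists (fun n => @axb_val R @^-1` (B n)).
  apply/seteqP; split => // x _; have x0 := axb_gt0 x.
  pose m := `|(axb_val x).1^-1| + `|(axb_val x).1| + `|(axb_val x).2|.
  have m0 : 0 <= m by rewrite !addr_ge0.
  exists (Num.truncn m) => //=; have := truncnS_gt m.
  set N := (_.+1)%:R; rewrite /m => mN.
  have N0 : 0 < N by rewrite ltr0n.
  move: (normr_ge0 (axb_val x).1^-1) (normr_ge0 (axb_val x).1) (normr_ge0 (axb_val x).2).
  rewrite /B /= !in_itv /= => h1 h2 h3; split; apply/andP; split.
  - rewrite -[leRHS]invrK lef_pV2 ?posrE ?invr_gt0//.
    by apply: (le_trans (ler_norm _)); lra.
  - by apply: (le_trans (ler_norm _)); lra.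
  - by rewrite lerNl; apply: (le_trans (ler_norm _)); rewrite normrN; lra.
  - by apply: (le_trans (ler_norm _)); lra.
move=> n; split => //.
rewrite haarE//.
(* The preimage under [axb_of] also contains points with a <= 0, sent to the identity; the density
   is 0 there, so they do not spoil the bound by [B n]. *)
apply: (@le_lt_trans _ _ (\int[mu \x mu]_(z in B n) (n.+1%:R ^+ 2)%:E)%E).
  rewrite integral_mkcond [leRHS]integral_mkcond.
  have mres (D : set (R * R)) (f : R * R -> R) : measurable D -> measurable_fun setT f ->
      measurable_fun setT ((EFin \o f) \_ D).
    move=> mD mf; apply/(measurable_restrictT _ mD).
    by apply: measurable_funTS; exact/measurable_EFinP.
  apply: ge0_le_integral => //.
  - by move=> z _; rewrite patchE; case: ifPn => // _; rewrite lee_fin axb_dens_ge0.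
  - apply: (mres _ axb_dens); last exact: measurable_axb_dens.
    by rewrite -[X in measurable X]setTI; exact: measurable_axb_of.
  - by apply: (mres _ (cst _)).
  - move=> z _; rewrite !patchE; case: ifPn => [|_]; last first.
      by case: ifPn => // _; rewrite lee_fin sqr_ge0.
    rewrite inE /= => Bz.
    have [z0|z0] := ltP 0 z.1.
      rewrite axb_ofK// in Bz; rewrite mem_set// lee_fin /axb_dens z0.
      move: Bz => [/=]; rewrite in_itv/= => /andP[z1 _] _.
      rewrite -[leRHS]invrK lef_pV2 ?posrE ?exprn_gt0 ?invr_gt0//.
      by rewrite -exprVn lerXn2r// nnegrE ?invr_ge0// ltW.
    rewrite /axb_dens ltNge z0 /=; case: ifPn => // _; by rewrite lee_fin sqr_ge0.
rewrite integral_cst /=; last exact: mB.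
have -> : (mu \x mu)%E (B n) =
    (mu `[(n.+1%:R^-1)%R, n.+1%:R%R]%classic * mu `[(- n.+1%:R)%R, n.+1%:R%R]%classic)%E.
  by rewrite product_measure1E.
rewrite !lebesgue_measure_itv/=.
by case: ifPn => _; case: ifPn => _; rewrite -?EFinD ?mule0 ?mul0e ?mule0 ?ltry// -!EFinM ltry.
Qed.

HB.instance Definition _ := Measure_isSigmaFinite.Build _ _ _ (@haar R) haar_sigma_finite.

End chart.

(** * Measurability of the group operations and left invariance *)

Section group_measurability.
Context {R : realType}.
Local Notation G := (axb R).
Local Notation mu := (@lebesgue_measure R).
Local Notation fst_ x := (axb_val x).1.
Local Notation snd_ x := (axb_val x).2.

(** The formula 1/x = x (x^2)^-1 holds at 0 too, with 0^-1 = 0, and x^2 >= 0 lets the second factor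
    be written with [powR]. *)
Lemma measurable_funV d (T : measurableType d) (D : set T) (f : T -> R) :
  measurable_fun D f -> measurable_fun D (fun x => (f x)^-1).
Proof.
move=> mf.
rewrite (_ : (fun x => _) = (fun x => f x * (f x ^+ 2) `^ (- 1))).
  apply: measurable_funM => //; apply: (measurableT_comp (measurable_powR _)).
  exact: measurable_funX.
apply/funext => x; have [->|fx] := eqVneq (f x) 0; first by rewrite mul0r invr0.
by rewrite powR_inv1 ?sqr_ge0// expr2 invfM mulrA divff// mul1r.
Qed.

Lemma axb_valM (x y : G) : axb_val (x * y)%g =
  (fst_ x * fst_ y, fst_ x * snd_ y + snd_ x * (fst_ y)^-1).
Proof. by case: x => [[a b] a0]; case: y => [[c d] c0]. Qed.

Lemma axb_valV (x : G) : axb_val (x^-1)%g = ((fst_ x)^-1, - snd_ x).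
Proof. by case: x => [[a b] a0]. Qed.

Lemma axb_val1 : axb_val (1%g : G) = (1, 0).
Proof. by []. Qed.

Lemma measurable_axbM d (T : measurableType d) (f g : T -> G) :
  measurable_fun setT f -> measurable_fun setT g -> measurable_fun setT (fun t => f t * g t)%g.
Proof.
move=> mf mg; apply: measurable_fun_to_axb.
rewrite (_ : (fun t => _) = (fun t => (fst_ (f t) * fst_ (g t),
   fst_ (f t) * snd_ (g t) + snd_ (f t) * (fst_ (g t))^-1))); last first.
  by apply/funext => t; rewrite axb_valM.
have [f1 f2] := (measurableT_comp measurable_axb_fst mf, measurableT_comp measurable_axb_snd mf).
have [g1 g2] := (measurableT_comp measurable_axb_fst mg, measurableT_comp measurable_axb_snd mg).
apply: measurable_fun_pair; first exact: measurable_funM.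
by apply: measurable_funD; apply: measurable_funM => //; exact: measurable_funV.
Qed.

Lemma measurable_axbV d (T : measurableType d) (f : T -> G) :
  measurable_fun setT f -> measurable_fun setT (fun t => (f t)^-1)%g.
Proof.
move=> mf; apply: measurable_fun_to_axb.
rewrite (_ : (fun t => _) = (fun t => ((fst_ (f t))^-1, - snd_ (f t)))); last first.
  by apply/funext => t; rewrite axb_valV.
have [f1 f2] := (measurableT_comp measurable_axb_fst mf, measurableT_comp measurable_axb_snd mf).
apply: measurable_fun_pair; first exact: measurable_funV.
exact: measurableT_comp.
Qed.

(** Left translation by (a0, b0) sends (a, b) to (a0 a, a0 b + b0/a): for fixed a it is affine in b
    with slope a0, and it scales a by a0. Rewriting a^-2 as a0^2 (a0 a)^-2 yields a factor a0^2, and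
    each of the two substitutions removes one a0. *)
Lemma ge0_haar_left_invariant (g : G) (f : G -> \bar R) :
  measurable_fun setT f -> (forall x, 0 <= f x)%E ->
  (\int[haar]_x f (g * x)%g = \int[haar]_x f x)%E.
Proof.
move=> mf f0.
have mfg : measurable_fun setT (fun x => f (g * x)%g).
  by apply: measurableT_comp => //; exact: measurable_axbM.
rewrite (ge0_integral_haar mfg (fun x => f0 _)) (ge0_integral_haar mf f0).
set a0 := fst_ g; set b0 := snd_ g; have a0_gt0 : 0 < a0 := axb_gt0 g.
pose F z : \bar R := (f (axb_of z) * (axb_dens z)%:E)%E.
have mF : measurable_fun setT F.
  apply: emeasurable_funM; first exact: measurableT_comp measurable_axb_of.
  by apply/measurable_EFinP; exact: measurable_axb_dens.
have F0 z : (0 <= F z)%E by rewrite mule_ge0// lee_fin axb_dens_ge0.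
pose Fa a : \bar R := (\int[mu]_b F (a, b))%E.
have mFa : measurable_fun setT Fa by exact: measurable_fun_fubini_tonelli_F.
have Fa0 a : (0 <= Fa a)%E by exact: integral_ge0.
have FaE a : (\int[mu]_b (f (g * axb_of (a, b))%g * (axb_dens (a, b))%:E) =
    a0%:E * Fa (a0 * a + 0)%R)%E.
  rewrite addr0; have [a_gt0|a_le0] := ltP 0 a; last first.
    rewrite integral0_eq => [|b _]; last by rewrite /axb_dens /= ltNge a_le0 mule0.
    rewrite /Fa integral0_eq ?mule0// => b _.
    by rewrite /F /axb_dens/= pmulr_rgt0// ltNge a_le0 mule0.
  transitivity (\int[mu]_b ((a0 ^+ 2)%:E * F (a0 * a, a0 * b + b0 / a)%R))%E.
    apply: eq_integral => b _; rewrite /F.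
    have -> : (g * axb_of (a, b) = axb_of ((a0 * a)%R, (a0 * b + b0 / a)%R))%g.
      by apply/val_inj; rewrite /= axb_valM !axb_ofK//= mulr_gt0.
    rewrite muleCA; congr (_ * _)%E; rewrite -EFinM; congr EFin.
    rewrite /axb_dens/= a_gt0 mulr_gt0//; field.
    by rewrite !gt_eqF.
  have mFaa : measurable_fun setT (fun b => F (a0 * a, b)).
    by apply: measurableT_comp => //; exact: measurable_pair1.
  rewrite ge0_integralZl; last 4 first.
  - exact: measurableT.
  - apply: (measurableT_comp mFaa); exact: measurable_funD.
  - by move=> b _; exact: F0.
  - by rewrite lee_fin sqr_ge0.
  rewrite (@ge0_integral_affine _ a0 (b0 / a) (fun b => F (a0 * a, b)))//.
  by rewrite muleA -EFinM expr2 mulfK// gt_eqF.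
under eq_integral do rewrite FaE.
rewrite ge0_integralZl; last 4 first.
- exact: measurableT.
- apply: (measurableT_comp mFa); exact: measurable_funD.
- by move=> a _; exact: Fa0.
- by rewrite lee_fin ltW.
rewrite (@ge0_integral_affine _ a0 0 Fa)// muleA -EFinM mulfV ?gt_eqF// mul1e.
by [].
Qed.

Lemma haar_left_invariant (g : G) (f : G -> \bar R) : measurable_fun setT f ->
  (\int[haar]_x f (g * x)%g = \int[haar]_x f x)%E.
Proof.
move=> mf; rewrite integralE [RHS]integralE.
have mp : measurable_fun setT (f^\+)%E by exact: measurable_funepos.
have mn : measurable_fun setT (f^\-)%E by exact: measurable_funeneg.
rewrite -(ge0_haar_left_invariant g mp (fun x => funepos_ge0 f x)).
rewrite -(ge0_haar_left_invariant g mn (fun x => funeneg_ge0 f x)).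
by congr (_ - _)%E; apply: eq_integral => x _; rewrite ?funeposE ?funenegE.
Qed.

End group_measurability.

(** * The kernel F2 *)

Section complex_norm.
Context {R : realType}.
Local Notation C := R[i].
Local Notation cn := (@Normc.normc R).
Implicit Types z w : C.

Lemma normc_ge0 z : 0 <= cn z.
Proof. by case: z => a b; exact: sqrtr_ge0. Qed.

Lemma normcD z w : cn (z + w) <= cn z + cn w.
Proof. exact: (@le_normcD R z w). Qed.

Lemma normc_opp z : cn (- z) = cn z.
Proof. exact: (@normcN R z). Qed.

Lemma normcB z w : cn (z - w) <= cn z + cn w.
Proof. by rewrite -(normc_opp w); exact: normcD. Qed.

Lemma normcR (a : R) : cn a%:C = `|a|.
Proof. by rewrite /= expr0n addr0 sqrtr_sqr. Qed.

Lemma normcX z n : cn (z ^+ n) = cn z ^+ n.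
Proof.
elim: n => [|n ih]; first by rewrite !expr0 Normc.normc1.
by rewrite !exprS Normc.normcM ih.
Qed.

Lemma le_Re_normc z : `|complex.Re z| <= cn z.
Proof.
by case: z => a b /=; rewrite -[leLHS]sqrtr_sqr ler_sqrt ?addr_ge0 ?sqr_ge0// lerDl sqr_ge0.
Qed.

Lemma le_Im_normc z : `|complex.Im z| <= cn z.
Proof.
by case: z => a b /=; rewrite -[leLHS]sqrtr_sqr ler_sqrt ?addr_ge0 ?sqr_ge0// lerDr sqr_ge0.
Qed.

Lemma normc_le z : cn z <= `|complex.Re z| + `|complex.Im z|.
Proof.
case: z => a b /=; rewrite -[leRHS]ger0_norm ?addr_ge0// -[leRHS]sqrtr_sqr.
rewrite ler_sqrt ?sqr_ge0// sqrrD !real_normK ?num_real// lerD2r lerDl.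
by rewrite mulrn_wge0// mulr_ge0.
Qed.

Lemma normcE2 z : cn z ^+ 2 = complex.Re z ^+ 2 + complex.Im z ^+ 2.
Proof. by case: z => a b /=; rewrite sqr_sqrtr// addr_ge0 ?sqr_ge0. Qed.

Lemma normc_conj z : cn z^* = cn z.
Proof. by case: z => a b /=; rewrite sqrrN. Qed.

Lemma normc_eq0 z : (cn z == 0) = (z == 0).
Proof.
by apply/eqP/eqP => [/Normc.eq0_normc|->]; rewrite ?Normc.normc0.
Qed.

Lemma complex_normc_norm z : `|z| = (cn z)%:C.
Proof. by case: z. Qed.

Lemma ler_normc_sum (I : Type) (s : seq I) (P : pred I) (F : I -> C) :
  cn (\sum_(i <- s | P i) F i) <= \sum_(i <- s | P i) cn (F i).
Proof.
elim/big_ind2 : _ => [|x y z w hx hz|//]; first by rewrite Normc.normc0.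
by apply: (le_trans (normcD _ _)); exact: lerD.
Qed.

End complex_norm.

(** * Pointwise estimates of F2 *)

Section kernel_estimates.
Context {R : realType}.
Local Notation G := (axb R).
Local Notation C := R[i].
Local Notation cn := (@Normc.normc R).
Local Notation fst_ x := (axb_val x).1.
Local Notation snd_ x := (axb_val x).2.
Implicit Types x y g u : G.

Definition F2_denom x : C := (fst_ x + (fst_ x)^-1) -i* snd_ x.

Lemma F2E x : F2 x = 2^-1 * F2_denom x ^- 2.
Proof. by rewrite /F2 /F2_denom; case: (axb_val x). Qed.

Lemma fst_gt0 x : 0 < fst_ x. Proof. exact: axb_gt0. Qed.

Lemma le_fst_F2_denom x : fst_ x <= cn (F2_denom x).
Proof.
apply: le_trans (le_Re_normc _); apply: le_trans (ler_norm _) => /=.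
by rewrite lerDl invr_ge0 ltW// fst_gt0.
Qed.

Lemma F2_denom_neq0 x : F2_denom x != 0.
Proof. by rewrite -normc_eq0 gt_eqF// (lt_le_trans (fst_gt0 x))// le_fst_F2_denom. Qed.

Lemma normc_F2 x : cn (F2 x) =
  2^-1 * ((fst_ x + (fst_ x)^-1) ^+ 2 + snd_ x ^+ 2)^-1.
Proof.
rewrite F2E Normc.normcM; congr (_ * _).
  have -> : (2 : C)^-1 = (2^-1)%:C by rewrite fmorphV rmorph_nat.
  by rewrite normcR ger0_norm// invr_ge0.
by rewrite Normc.normcV normcX normcE2 /= sqrrN.
Qed.

Lemma normc_F2_gt0 x : 0 < cn (F2 x).
Proof.
rewrite normc_F2 mulr_gt0 ?invr_gt0// ltr_wpDr ?sqr_ge0// exprn_gt0//.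
by rewrite addr_gt0 ?invr_gt0// fst_gt0.
Qed.

Lemma F2V x : F2 (x^-1)%g = (F2 x)^*.
Proof.
rewrite !F2E rmorphM !fmorphV rmorphXn rmorph_nat; congr (_ * _ ^- 2).
by rewrite /F2_denom axb_valV/= invrK addrC opprK.
Qed.

Lemma normc_F2V x : cn (F2 (x^-1)%g) = cn (F2 x).
Proof. by rewrite F2V normc_conj. Qed.

(** A continuous measure of the distance of u from the identity, where alone it vanishes; it is
    shaped to fit the error term of the next lemma rather than to be a metric. *)
Definition axb_gap u : R := `|fst_ u ^+ 2 - 1| + `|fst_ u * snd_ u|.

(* c * F2_denom (g * u) = F2_denom g + a (c^2 - 1 - i c d) for g = (a, b) and
   u = (c, d), and a <= |F2_denom g|: the relative error is at most axb_gap u. *)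
Lemma F2_mulr_close g u : axb_gap u <= 2^-1 ->
  cn (F2 (g * u)%g - F2 g) <= 14 * axb_gap u * cn (F2 g).
Proof.
move=> u12; set e := axb_gap u in u12 *.
have e0 : 0 <= e by rewrite addr_ge0.
set a := fst_ g; set c := fst_ u; set d := snd_ u.
have [a0 c0] : 0 < a /\ 0 < c by rewrite !fst_gt0.
pose q : C := (c ^+ 2 - 1) -i* (c * d).
have qe : cn q <= e by apply: (le_trans (normc_le q)); rewrite /= normrN.
pose w := F2_denom g; pose eta := a%:C / w * q.
have w0 : w != 0 := F2_denom_neq0 g.
have cwE : c%:C * F2_denom (g * u)%g = w * (1 + eta).
  rewrite mulrDr mulr1 /eta mulrA (mulrC w) mulfVK//.
  rewrite /F2_denom axb_valM -/a -/c -/d /w /F2_denom /q; apply/eqP.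
  rewrite eq_complex /=; apply/andP; split; apply/eqP; field; by rewrite !gt_eqF.
have etae : cn eta <= e.
  apply: le_trans qe; rewrite /eta Normc.normcM ler_piMl ?normc_ge0//.
  rewrite Normc.normcM Normc.normcV normcR gtr0_norm//.
  by rewrite ler_pdivrMr ?mul1r ?le_fst_F2_denom// lt_def normc_ge0 normc_eq0 w0.
have eta1 : 2^-1 <= cn (1 + eta).
  have : cn 1 <= cn (1 + eta) + cn eta by rewrite -{1}(addrK eta 1); exact: normcB.
  by rewrite Normc.normc1; lra.
have eta10 : 1 + eta != 0 by rewrite -normc_eq0 gt_eqF// (lt_le_trans _ eta1).
have cC0 : c%:C != 0 by rewrite -normc_eq0 normcR normr_eq0 gt_eqF.
have -> : F2 (g * u)%g - F2 g = (c%:C ^+ 2 - (1 + eta) ^+ 2) * (1 + eta) ^- 2 * F2 g.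
  rewrite !F2E -/w.
  have -> : F2_denom (g * u)%g = c%:C^-1 * (w * (1 + eta)) by rewrite -cwE mulKf.
  by field; rewrite w0 eta10 cC0.
rewrite Normc.normcM ler_pM2r ?normc_F2_gt0// Normc.normcM Normc.normcV normcX.
rewrite ler_pdivrMr ?exprn_gt0 ?(lt_le_trans _ eta1)//.
(* Origin of 14: as |1 + eta|^2 >= 1/4, the quotient is at most 4 (3 e + e^2), and e <= 1/2 bounds
   this by 14 e. *)
have : cn (c%:C ^+ 2 - (1 + eta) ^+ 2) <= 3 * e + e ^+ 2.
  have -> : c%:C ^+ 2 - (1 + eta) ^+ 2 = (c ^+ 2 - 1)%:C - (2 * eta + eta ^+ 2).
    by rewrite rmorphB rmorphXn rmorph1; ring.
  apply: (le_trans (normcB _ _)); rewrite normcR.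
  have : cn (2 * eta + eta ^+ 2) <= 2 * e + e ^+ 2.
    apply: (le_trans (normcD _ _)); rewrite Normc.normcM normcX.
    have -> : cn 2 = 2 by rewrite -[2]/(2%:R) -(rmorph_nat (real_complex R)) normcR ger0_norm.
    by apply: lerD; [rewrite ler_pM2l|rewrite lerXn2r// nnegrE normc_ge0].
  have : `|c ^+ 2 - 1| <= e by rewrite lerDl.
  lra.
move=> h; apply: (le_trans h).
have : 4^-1 <= cn (1 + eta) ^+ 2.
  have -> : 4^-1 = 2^-1 ^+ 2 :> R by lra.
  by rewrite lerXn2r// nnegrE ?invr_ge0 ?normc_ge0.
nra.
Qed.

(* AM-GM type bound: (a + 1/a)^-2 <= a^s for 0 <= s <= 2. *)
Lemma normc_F2_le_powR x (s : R) : 0 <= s <= 2 -> cn (F2 x) <= fst_ x `^ s.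
Proof.
move=> /andP[s0 s2]; rewrite normc_F2; have a0 := fst_gt0 x; set a := fst_ x in a0 *.
have h : ((a + a^-1) ^+ 2)^-1 <= a `^ s.
  (* For a >= 1 the left side is at most 1 <= a^s; for a < 1 it is at most a^2 <= a^s. *)
  have [a1|a1] := leP 1 a.
    apply: (@le_trans _ _ 1); last by rewrite -(powRr0 a) ler_powR.
    rewrite invf_le1 ?exprn_gt0 ?addr_gt0 ?invr_gt0//.
    by rewrite exprn_ege1// (le_trans a1)// lerDl invr_ge0 ltW.
  apply: (@le_trans _ _ (a ^+ 2)).
    have h : (a + a^-1)^-1 <= a.
      rewrite -[leRHS]invrK lef_pV2 ?posrE ?addr_gt0 ?invr_gt0//.
      by rewrite lerDr ltW.
    rewrite -exprVn; apply: lerXn2r => //; rewrite nnegrE; last exact: ltW.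
    by rewrite invr_ge0 addr_ge0 ?invr_ge0 1?ltW.
  rewrite -(powR_mulrn 2 (ltW a0)).
  have a01 : 0 < a <= 1 by rewrite a0 ltW.
  exact: (ger_powR a01 s2).
apply: le_trans h; rewrite mulrC.
have A0 : 0 < (a + a^-1) ^+ 2 by rewrite exprn_gt0// addr_gt0 ?invr_gt0.
apply: (@le_trans _ _ ((a + a^-1) ^+ 2 + snd_ x ^+ 2)^-1).
  by rewrite ler_piMr ?invf_le1 ?ler1n// invr_ge0 addr_ge0 ?sqr_ge0.
by rewrite lef_pV2 ?posrE// ?lerDl ?sqr_ge0// ltr_wpDr ?sqr_ge0.
Qed.

Lemma measurable_normc_F2 : measurable_fun setT (fun x : G => cn (F2 x)).
Proof.
under eq_fun do rewrite normc_F2.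
have m1 := @measurable_axb_fst R; have m2 := @measurable_axb_snd R.
apply: measurable_funM => //; apply: measurable_funV; apply: measurable_funD.
  by apply: measurable_funX; apply: measurable_funD => //; exact: measurable_funV.
exact: measurable_funX.
Qed.

Lemma F2_ReIm x (A := fst_ x + (fst_ x)^-1) (D := A ^+ 2 + snd_ x ^+ 2) :
  F2 x = ((A ^+ 2 - snd_ x ^+ 2) / (2 * D ^+ 2)) +i* (A * snd_ x / D ^+ 2).
Proof.
have w0 := F2_denom_neq0 x.
have A0 : 0 < A by rewrite addr_gt0 ?invr_gt0 ?fst_gt0.
have D0 : 0 < D by rewrite ltr_wpDr ?sqr_ge0// exprn_gt0.
rewrite F2E; apply: (mulIf (expf_neq0 2 w0)); rewrite mulfVK ?expf_neq0//.
have -> : (2 : C)^-1 = (2^-1)%:C by rewrite fmorphV rmorph_nat.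
rewrite /F2_denom -/A expr2; apply/eqP; rewrite eq_complex /=.
by apply/andP; split; apply/eqP; rewrite /D; field; rewrite -/D gt_eqF.
Qed.

Lemma measurable_Re_F2 : measurable_fun setT (fun x : G => complex.Re (F2 x)).
Proof.
under eq_fun do rewrite F2_ReIm /=.
have m1 := @measurable_axb_fst R; have m2 := @measurable_axb_snd R.
have mA : measurable_fun setT (fun x : G => fst_ x + (fst_ x)^-1).
  by apply: measurable_funD => //; exact: measurable_funV.
apply: measurable_funM; first by apply: measurable_funB; exact: measurable_funX.
apply: measurable_funV; apply: measurable_funM => //; apply: measurable_funX.
by apply: measurable_funD; exact: measurable_funX.
Qed.

Lemma measurable_Im_F2 : measurable_fun setT (fun x : G => complex.Im (F2 x)).
Proof.
under eq_fun do rewrite F2_ReIm /=.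
have m1 := @measurable_axb_fst R; have m2 := @measurable_axb_snd R.
have mA : measurable_fun setT (fun x : G => fst_ x + (fst_ x)^-1).
  by apply: measurable_funD => //; exact: measurable_funV.
apply: measurable_funM; first exact: measurable_funM.
apply: measurable_funV; apply: measurable_funX.
by apply: measurable_funD; exact: measurable_funX.
Qed.

End kernel_estimates.

(** * Improper integrals on the line *)

Section improper_integrals.
Context {R : realType}.
Local Notation mu := (@lebesgue_measure R).
Implicit Types (F f : R -> R) (D : set R).

Lemma integral_is_derive F f (u v : R) : u < v ->
  (forall x, u <= x <= v -> is_derive x 1 F (f x)) ->
  (forall x, u <= x <= v -> {for x, continuous f}) ->
  (\int[mu]_(x in `[u, v]) (f x)%:E = (F v - F u)%:E)%E.
Proof.
move=> uv dF cf.
have cF x : u <= x <= v -> {for x, continuous F}.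
  by move=> /dF[dFx _]; exact/differentiable_continuous/derivable1_diffP.
have uE : u <= u <= v by rewrite lexx ltW.
have vE : u <= v <= v by rewrite lexx ltW.
rewrite (@continuous_FTC2 R f F u v uv)//.
- apply: continuous_in_subspaceT => x; rewrite inE/= in_itv/=; exact: cf.
- split.
  + move=> x; rewrite in_itv/= => /andP[ux xv].
    by have [] : is_derive x 1 F (f x) by apply: dF; rewrite !ltW.
  + by apply: cvg_at_right_filter; exact: cF.
  + by apply: cvg_at_left_filter; exact: cF.
- move=> x; rewrite in_itv/= => /andP[ux xv].
  rewrite derive1E; have [_ ->//] : is_derive x 1 F (f x).
  by apply: dF; rewrite !ltW.
Qed.

(** The truncations of f to [u n, v n] are dominated by |f| and converge pointwise on D, each of
    whose points is eventually inside; on each interval the fundamental theorem of calculus gives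
    the increment of F. *)
Lemma integral_exhaust D (u v : nat -> R) F f (l : R) : measurable D ->
  (forall n, u n < v n) -> (forall n, `[u n, v n]%classic `<=` D) ->
  (forall x, D x -> \forall n \near \oo, u n <= x <= v n) ->
  (forall x, D x -> is_derive x 1 F (f x)) ->
  (forall x, D x -> {for x, continuous f}) ->
  mu.-integrable D (EFin \o f) ->
  F (v n) - F (u n) @[n --> \oo] --> l ->
  (\int[mu]_(x in D) (f x)%:E = l%:E)%E.
Proof.
move=> mD uv uvD Duv dF cf intf Fl.
have mI n : measurable (`[u n, v n]%classic : set R) by exact: measurable_itv.
pose g n : R -> \bar R := (EFin \o f) \_ `[u n, v n].
have mf : measurable_fun D (EFin \o f) by case/integrableP : intf.
have [_ _ h] := @dominated_convergence _ _ R mu D mD g (EFin \o f)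
    (fun x => `|(f x)%:E|%E)
    (fun n => ltac:(apply/(measurable_restrict _ (mI n) mD); apply: (measurable_funS mD _ mf); exact: subIsetl))
    mf
    ltac:(apply/aeW => x Dx; apply: cvg_near_cst; have := Duv x Dx; apply: filterS => n xn;
         by rewrite /g patchE mem_set//= in_itv)
    (integrable_abse intf)
    ltac:(apply/aeW => x n Dx; rewrite /g patchE; case: ifPn => //; by rewrite abse0 abse_ge0).
suff : ((fun n => \int[mu]_(x in D) (g n x)) @ \oo --> l%:E)%E by exact: cvg_unique h.
have -> : (fun n => \int[mu]_(x in D) (g n x))%E = (fun n => (F (v n) - F (u n))%:E).
  apply/funext => n; transitivity (\int[mu]_(x in `[u n, v n]) (f x)%:E)%E.
    rewrite /g -integral_mkcondr; congr (integral _ _ _).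
    by apply/setIidPr; exact: uvD.
  apply: integral_is_derive => // x xn; [apply: dF|apply: cf];
    by apply: (uvD n); rewrite /= in_itv.
by apply: cvg_EFin => //; exact: nearW.
Qed.

Lemma integral_oneDsqrV_lty : (\int[mu]_x (1 + x ^+ 2)^-1%:E < +oo)%E.
Proof.
rewrite (@ge0_symfun_integralT R (fun x => (1 + x ^+ 2)^-1)).
- rewrite (_ : [set x | 0 <= x]%R = `[0, +oo[%classic).
    by rewrite integral0y_oneDsqr -EFinM ltry.
  by apply/seteqP; split => x /=; rewrite in_itv/= andbT.
- by move=> x; rewrite invr_ge0 addr_ge0// sqr_ge0.
- exact: continuous_oneDsqrV.
- by move=> x; rewrite /= sqrrN.
Qed.

Lemma integral_powR01_lty (s : R) : 0 < s ->
  (\int[mu]_(x in `]0%R, 1%R]) (x `^ (s - 1))%:E < +oo)%E.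
Proof.
move=> s0.
(* [n.+2] rather than [n.+1] keeps the left end strictly below 1. The primitive x^s / s bounds all
   these integrals by 1/s. *)
pose E (n : nat) : set R := `[n.+2%:R^-1, 1]%classic.
have mE n : measurable (E n) by exact: measurable_itv.
have m01 : (`]0, 1] : set R)%classic = \bigcup_n E n.
  apply/seteqP; split => x /=.
    rewrite in_itv/= => /andP[x0 x1]; exists (Num.truncn x^-1) => //=.
    rewrite /E /= in_itv /= x1 andbT -[leRHS]invrK lef_pV2 ?posrE ?invr_gt0//.
    by rewrite ltW// (lt_le_trans (truncnS_gt _))// ler_nat.
  by move=> [n _]; rewrite /E/= !in_itv/= => /andP[nx ->]; rewrite (lt_le_trans _ nx).
have mp D : measurable_fun D (fun x : R => (x `^ (s - 1))%:E).
  by apply: measurable_funTS; apply/measurable_EFinP; exact: measurable_powR.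
rewrite m01.
have nE : nondecreasing_seq E.
  move=> m n mn; apply/subsetPset => x; rewrite /E /= !in_itv/= => /andP[mx ->].
  by rewrite andbT (le_trans _ mx)// lef_pV2 ?posrE// ler_nat.
have E0 i x : E i x -> (0 <= (x `^ (s - 1))%:E)%E by rewrite lee_fin powR_ge0.
have cv := @ge0_nondecreasing_set_cvg_integral _ (measurableTypeR R) R E
  (fun x : R => (x `^ (s - 1))%:E) mu nE mE (fun n => mp _) E0.
rewrite -(cvg_lim _ cv)//; apply: (@le_lt_trans _ _ (s^-1)%:E); last exact: ltry.
apply: lime_le; first by apply/cvg_ex; eexists; exact: cv.
apply: nearW => n.
have -> : (\int[mu]_(x in E n) (x `^ (s - 1))%:E =
    (s^-1 * 1 `^ s - s^-1 * n.+2%:R^-1 `^ s)%:E)%E.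
  apply: (@integral_is_derive (fun x => s^-1 * x `^ s)).
  - by rewrite invf_lt1 ?ltr1n.
  - move=> x /andP[nx _]; have x0 : 0 < x by rewrite (lt_le_trans _ nx).
    have -> : x `^ (s - 1) = s^-1 * (s * x `^ (s - 1)) by rewrite mulKf// gt_eqF.
    by apply: is_deriveZ; exact: is_derive1_powR.
  - move=> x /andP[nx _]; have x0 : 0 < x by rewrite (lt_le_trans _ nx).
    have [dx _] := is_derive1_powR (s - 1) x0.
    exact/differentiable_continuous/derivable1_diffP.
rewrite lee_fin powR1 mulr1 lerBlDr lerDl.
by rewrite mulr_ge0 ?invr_ge0 ?powR_ge0 ?ltW.
Qed.

End improper_integrals.

(** * Integrability of a^s |F2| *)

Section kernel_weight.
Context {R : realType}.
Local Notation G := (axb R).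
Local Notation cn := (@Normc.normc R).
Local Notation mu := (@lebesgue_measure R).
Local Notation fst_ x := (axb_val x).1.
Local Notation snd_ x := (axb_val x).2.

(** Its value is pi; it enters bounds only, through its finiteness. *)
Definition oneDsqrV_mass : \bar R := (\int[mu]_x (1 + x ^+ 2)^-1%:E)%E.

Lemma measurable_oneDsqrV : measurable_fun setT (fun x : R => (1 + x ^+ 2)^-1).
Proof. exact: continuous_measurable_fun continuous_oneDsqrV. Qed.

Lemma integral_sqrDsqrV (A : R) : 0 < A ->
  (\int[mu]_b (A ^+ 2 + b ^+ 2)^-1%:E = A^-1%:E * oneDsqrV_mass)%E.
Proof.
move=> A0.
have mf : measurable_fun setT (fun b : R => ((A ^+ 2 + b ^+ 2)^-1)%:E : \bar R).
  by apply/measurable_EFinP; apply: measurable_funV; exact: measurable_funD.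
have f0 (b : R) : (0 <= ((A ^+ 2 + b ^+ 2)^-1)%:E :> \bar R)%E.
  by rewrite lee_fin invr_ge0 addr_ge0 ?sqr_ge0.
have := ge0_integral_affine 0 A0 mf f0.
rewrite (_ : (\int[mu]_x ((A ^+ 2 + (A * x + 0) ^+ 2)^-1)%:E =
    (A ^- 2)%:E * oneDsqrV_mass)%E); last first.
  rewrite -ge0_integralZl//.
  - apply: eq_integral => b _; rewrite -EFinM; congr EFin.
    rewrite addr0 exprMn -{1}(mulr1 (A ^+ 2)) -mulrDr invfM//.
  - by apply/measurable_EFinP; exact: measurable_oneDsqrV.
  - by move=> b _; rewrite lee_fin invr_ge0 addr_ge0 ?sqr_ge0.
  - by rewrite lee_fin invr_ge0 sqr_ge0.
move=> /(congr1 (fun t => A%:E * t)%E).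
rewrite !muleA -!EFinM mulfV ?gt_eqF// mul1e => <-; congr (_%:E * _)%E.
by rewrite expr2 invfM mulrA mulfV ?gt_eqF// mul1r.
Qed.

Lemma oneDsqrV_mass_ge0 : (0 <= oneDsqrV_mass)%E.
Proof.
by apply: integral_ge0 => x _; rewrite lee_fin invr_ge0 addr_ge0// sqr_ge0.
Qed.

(** The integral over b leaves a multiple of a^(s-1) / (1 + a^2). On ]0, 1] this is at most a^(s-1),
    integrable because s > 0; for a > 1 it is at most 1 / (1 + a^2) because s <= 1. The function [h]
    is the sum of these two bounds. *)
Lemma powR_F2_lty (s : R) : 0 < s <= 1 ->
  (\int[haar]_x (fst_ x `^ s * cn (F2 x))%:E < +oo)%E.
Proof.
move=> /andP[s0 s1].
have mw : measurable_fun setT (fun x : G => (fst_ x `^ s * cn (F2 x))%:E).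
  apply/measurable_EFinP; apply: measurable_funM; last exact: measurable_normc_F2.
  exact: measurableT_comp (measurable_powR s) measurable_axb_fst.
rewrite ge0_integral_haar//; last first.
  by move=> x; rewrite lee_fin mulr_ge0 ?powR_ge0 ?normc_ge0.
pose h (a : R) : R := 2^-1 * ((1 + a ^+ 2)^-1 + ((fun x => x `^ (s - 1)) \_ `]0, 1]%classic) a).
have h0 a : 0 <= h a.
  rewrite mulr_ge0// addr_ge0 ?invr_ge0 ?addr_ge0 ?sqr_ge0// patchE.
  by case: ifP => // _; exact: powR_ge0.
have mp : measurable_fun setT ((fun x : R => x `^ (s - 1)) \_ `]0, 1]%classic).
  have m01 : measurable (`]0, 1]%classic : set R) by exact: measurable_itv.
  apply/(measurable_restrictT _ m01); apply: measurable_funTS.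
  exact: measurable_powR.
have mh : measurable_fun setT h.
  apply: measurable_funM => //; apply: measurable_funD => //.
  exact: measurable_oneDsqrV.
apply: (@le_lt_trans _ _ (\int[mu]_a ((h a)%:E * oneDsqrV_mass))%E); last first.
  rewrite ge0_integralZr//; [|exact/measurable_EFinP|by move=> a _; rewrite lee_fin|exact: oneDsqrV_mass_ge0].
  apply: lte_mul_pinfty.
  - by apply: integral_ge0 => a _; rewrite lee_fin.
  - rewrite ge0_fin_numE; last by apply: integral_ge0 => a _; rewrite lee_fin.
    under eq_integral do rewrite EFinM.
    have mo : measurable_fun setT (fun a : R => ((1 + a ^+ 2)^-1)%:E).
      by apply/measurable_EFinP; exact: measurable_oneDsqrV.
    have o0 (a : R) : (0 <= ((1 + a ^+ 2)^-1)%:E)%E.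
      by rewrite lee_fin invr_ge0 addr_ge0// sqr_ge0.
    have p0 (a : R) : (0 <= (((fun x => x `^ (s - 1)) \_ `]0, 1]%classic) a)%:E)%E.
      by rewrite lee_fin patchE; case: ifP => // _; exact: powR_ge0.
    rewrite ge0_integralZl; last 4 first.
    + exact: measurableT.
    + by under eq_fun do rewrite EFinD; apply: emeasurable_funD => //; exact/measurable_EFinP.
    + by move=> a _; rewrite EFinD adde_ge0.
    + by rewrite lee_fin.
    apply: lte_mul_pinfty => //.
    under eq_integral do rewrite EFinD.
    rewrite ge0_integralD; last 5 first.
    + exact: measurableT.
    + by move=> a _; exact: o0.
    + exact: mo.
    + by move=> a _; exact: p0.
    + exact/measurable_EFinP.
    apply: lte_add_pinfty; first exact: integral_oneDsqrV_lty.
    have i01 := integral_powR01_lty s0; rewrite integral_mkcond in i01.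
    by rewrite restrict_EFin in i01.
  - exact: integral_oneDsqrV_lty.
apply: ge0_le_integral => //.
- move=> a _; apply: integral_ge0 => b _.
  by rewrite -EFinM lee_fin !mulr_ge0 ?powR_ge0 ?normc_ge0 ?axb_dens_ge0.
- apply: (@measurable_fun_fubini_tonelli_F _ _ _ _ _ mu
    (fun z => (fst_ (axb_of z) `^ s * cn (F2 (axb_of z)))%:E * (axb_dens z)%:E)%E).
    apply: emeasurable_funM; first exact: (measurableT_comp mw (@measurable_axb_of R)).
    by apply/measurable_EFinP; exact: measurable_axb_dens.
  by move=> z; rewrite -EFinM lee_fin !mulr_ge0 ?powR_ge0 ?normc_ge0 ?axb_dens_ge0.
- by apply: emeasurable_funM => //; exact/measurable_EFinP.
move=> a _; have [a0|a0] := leP a 0.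
  rewrite integral0_eq ?mule_ge0 ?lee_fin ?oneDsqrV_mass_ge0//.
  by move=> b _; rewrite /axb_dens/= ltNge a0 mule0.
set A := a + a^-1; have A0 : 0 < A by rewrite addr_gt0 ?invr_gt0.
rewrite (_ : (\int[mu]_b _ = (a `^ s * a ^- 2 * 2^-1)%:E * (A^-1%:E * oneDsqrV_mass))%E).
  rewrite muleA -EFinM; apply: lee_wpmul2r; first exact: oneDsqrV_mass_ge0.
  rewrite lee_fin /h.
  have -> : a `^ s * a ^- 2 * 2^-1 / A = 2^-1 * (a `^ (s - 1) * (1 + a ^+ 2)^-1).
    rewrite powRB; last by rewrite (@gt_eqF _ _ a)//; apply: implybT.
    rewrite powRr1 ?ltW// /A; field.
    by rewrite (gt_eqF a0) andbT gt_eqF// ltr_wpDr ?sqr_ge0.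
  rewrite ler_pM2l ?invr_gt0//.
  have o1 : (1 + a ^+ 2)^-1 <= 1 by rewrite invf_le1 ?lerDl ?sqr_ge0// ltr_wpDr// sqr_ge0.
  have o0 : 0 <= (1 + a ^+ 2)^-1 by rewrite invr_ge0 addr_ge0 ?sqr_ge0.
  have [a1|a1] := leP a 1.
    rewrite patchE mem_set; last by rewrite /= in_itv/= a0.
    by rewrite -[leLHS]add0r lerD// ler_piMr// powR_ge0.
  rewrite -[leLHS]addr0 lerD//; last by rewrite patchE; case: ifP => // _; exact: powR_ge0.
  have h1 : a `^ (s - 1) <= a `^ 0 by apply: ler_powR; [exact: ltW|rewrite subr_le0].
  by rewrite powRr0 in h1; exact: ler_piMl.
rewrite -integral_sqrDsqrV// -ge0_integralZl//.
- apply: eq_integral => b _.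
  rewrite -EFinM normc_F2 axb_ofK//= /axb_dens /= a0 -EFinM; congr EFin.
  by rewrite -/A; ring.
- by apply/measurable_EFinP; apply: measurable_funV; exact: measurable_funD.
- by move=> b _; rewrite lee_fin invr_ge0 addr_ge0 ?sqr_ge0.
- by rewrite lee_fin !mulr_ge0 ?powR_ge0 ?invr_ge0 ?sqr_ge0.
Qed.

End kernel_weight.

(** * Schur's test *)

Section schur_test.
Context {R : realType}.
Local Notation G := (axb R).
Local Notation cn := (@Normc.normc R).
Local Notation fst_ x := (axb_val x).1.
Implicit Types (g : G -> R) (x y : G).

Definition F2_weight (s : R) : \bar R := (\int[haar]_u (fst_ u `^ s * cn (F2 u))%:E)%E.

Definition absconv g x : \bar R := (\int[haar]_y (g y * cn (F2 (y^-1 * x)%g))%:E)%E.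

Lemma normc_F2_sym x y : cn (F2 (y^-1 * x)%g) = cn (F2 (x^-1 * y)%g).
Proof. by rewrite -normc_F2V invgM invgK. Qed.

Lemma measurable_normc_F2_2 :
  measurable_fun setT (fun z : G * G => cn (F2 (z.1^-1 * z.2)%g)).
Proof.
apply: (measurableT_comp measurable_normc_F2); apply: measurable_axbM => //.
exact: measurable_axbV.
Qed.

Lemma measurable_normc_F2_l x : measurable_fun setT (fun y => cn (F2 (y^-1 * x)%g)).
Proof.
apply: (measurableT_comp measurable_normc_F2); apply: measurable_axbM => //.
exact: measurable_axbV.
Qed.

Lemma measurable_fst_powR (s : R) : measurable_fun setT (fun x : G => fst_ x `^ s).
Proof. exact: measurableT_comp (measurable_powR s) measurable_axb_fst. Qed.

Lemma fst_powRK (s : R) x : fst_ x `^ (- s) * fst_ x `^ s = 1.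
Proof.
rewrite -powRD ?addNr ?powRr0//.
by apply/implyP => _; rewrite gt_eqF ?fst_gt0.
Qed.

(** The character a^s is an eigenfunction of the symmetric kernel |F2(y^-1 x)|, with eigenvalue
    [F2_weight s]: substitute x y for y and use that a is multiplicative. Schur's test rests on this
    identity. *)
Lemma F2_weight_shift (s : R) x :
  (\int[haar]_y (fst_ y `^ s * cn (F2 (y^-1 * x)%g))%:E = (fst_ x `^ s)%:E * F2_weight s)%E.
Proof.
have m : measurable_fun setT (fun y => (fst_ y `^ s * cn (F2 (y^-1 * x)%g))%:E).
  apply/measurable_EFinP; apply: measurable_funM; first exact: measurable_fst_powR.
  exact: measurable_normc_F2_l.
rewrite -(haar_left_invariant x m) -ge0_integralZl//.
- apply: eq_integral => y _; rewrite -EFinM; congr EFin.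
  rewrite normc_F2_sym mulgA mulVg mul1g axb_valM/= powRM ?mulrA//; exact/ltW/fst_gt0.
- apply/measurable_EFinP; apply: measurable_funM; first exact: measurable_fst_powR.
  exact: measurable_normc_F2.
- by move=> y _; rewrite lee_fin mulr_ge0 ?powR_ge0 ?normc_ge0.
- by rewrite lee_fin powR_ge0.
Qed.

Lemma F2_weight_ge0 s : (0 <= F2_weight s)%E.
Proof. by apply: integral_ge0 => x _; rewrite lee_fin mulr_ge0 ?powR_ge0 ?normc_ge0. Qed.

Lemma F2_weight_fin_num s : 0 < s <= 1 -> F2_weight s \is a fin_num.
Proof. by move=> s01; rewrite ge0_fin_numE ?F2_weight_ge0// powR_F2_lty. Qed.

Lemma absconv_ge0 g x : (forall y, 0 <= g y) -> (0 <= absconv g x)%E.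
Proof. by move=> g0; apply: integral_ge0 => y _; rewrite lee_fin mulr_ge0 ?normc_ge0. Qed.

Lemma measurable_absconv g : measurable_fun setT g -> (forall y, 0 <= g y) ->
  measurable_fun setT (absconv g).
Proof.
move=> mg g0.
apply: (@measurable_fun_fubini_tonelli_G _ _ _ _ R haar
  (fun z : G * G => (g z.1 * cn (F2 (z.1^-1 * z.2)%g))%:E)).
  apply/measurable_EFinP; apply: measurable_funM; first exact: measurableT_comp.
  exact: measurable_normc_F2_2.
by move=> z; rewrite lee_fin mulr_ge0 ?normc_ge0.
Qed.

Lemma Lnorm_ge0_fun (r : R) g : (forall y, 0 <= g y) ->
  (Lnorm haar r%:E (EFin \o g) = (\int[haar]_y (g y `^ r)%:E) `^ r^-1)%E.
Proof.
move=> g0; rewrite unlock; congr (_ `^ _)%E; apply: eq_integral => y _ /=.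
by rewrite ger0_norm.
Qed.

Section exponent.
Variable p : R.
Hypothesis p1 : 1 < p.
Let q := p / (p - 1).
(** Schur's test with weight a^t involves the powers a^(t p) and a^(t q); this t puts both exponents
    in ]0, 1], where the weighted integral of |F2| is finite. *)
Let t := (p + q)^-1.
Local Notation Np g := (Lnorm haar p%:E (EFin \o g)).

Let p0 : 0 < p. Proof. exact: lt_trans p1. Qed.
Let q0 : 0 < q. Proof. by rewrite divr_gt0// subr_gt0. Qed.
Let pq : p^-1 + q^-1 = 1.
Proof. by rewrite /q; field; rewrite !gt_eqF// subr_gt0. Qed.
Let t0 : 0 < t. Proof. by rewrite invr_gt0 addr_gt0. Qed.
Let tp : 0 < t * p <= 1.
Proof. by rewrite mulr_gt0//= mulrC ler_pdivrMr ?addr_gt0// mul1r lerDl ltW. Qed.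
Let tq : 0 < t * q <= 1.
Proof. by rewrite mulr_gt0//= mulrC ler_pdivrMr ?addr_gt0// mul1r lerDr ltW. Qed.

Let Cp := fine (F2_weight (t * p)).
Let Cq := fine (F2_weight (t * q)).
Let Cp0 : 0 <= Cp. Proof. by rewrite fine_ge0 ?F2_weight_ge0. Qed.
Let Cq0 : 0 <= Cq. Proof. by rewrite fine_ge0 ?F2_weight_ge0. Qed.
Let CpE : F2_weight (t * p) = Cp%:E. Proof. by rewrite fineK// F2_weight_fin_num. Qed.
Let CqE : F2_weight (t * q) = Cq%:E. Proof. by rewrite fineK// F2_weight_fin_num. Qed.

Let J g x : \bar R :=
  (\int[haar]_y (g y `^ p * fst_ y `^ (- (t * p)) * cn (F2 (y^-1 * x)%g))%:E)%E.

Let J0 g x : (0 <= J g x)%E.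
Proof.
by apply: integral_ge0 => y _; rewrite lee_fin !mulr_ge0 ?powR_ge0 ?normc_ge0.
Qed.

Lemma Lnorm_powR g : (forall y, 0 <= g y) -> (Np g `^ p = \int[haar]_y (g y `^ p)%:E)%E.
Proof.
move=> g0; rewrite Lnorm_ge0_fun// -poweRrM mulVf ?gt_eqF// poweRe1//.
by apply: integral_ge0 => y _; rewrite lee_fin powR_ge0.
Qed.

(** Hoelder's inequality for the splitting g k = (g a^-t k^(1/p)) (a^t k^(1/q)), where k is the
    kernel |F2(y^-1 x)|. The L^q norm of the second factor is evaluated exactly by
    [F2_weight_shift]. *)
Let absconv_hoelder g x : measurable_fun setT g -> (forall y, 0 <= g y) ->
  (absconv g x `^ p <= J g x * (fst_ x `^ (t * p) * Cq `^ (p / q))%:E)%E.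
Proof.
move=> mg g0; pose k y := cn (F2 (y^-1 * x)%g).
have k0 y : 0 <= k y by exact: normc_ge0.
have mk : measurable_fun setT k by exact: measurable_normc_F2_l.
pose f1 y := g y * fst_ y `^ (- t) * k y `^ p^-1.
pose f2 y := fst_ y `^ t * k y `^ q^-1.
have f10 y : 0 <= f1 y by rewrite !mulr_ge0 ?powR_ge0.
have f20 y : 0 <= f2 y by rewrite !mulr_ge0 ?powR_ge0.
have mf1 : measurable_fun setT f1.
  apply: measurable_funM; last exact: measurableT_comp (measurable_powR _) mk.
  by apply: measurable_funM => //; exact: measurable_fst_powR.
have mf2 : measurable_fun setT f2.
  apply: measurable_funM; last exact: measurableT_comp (measurable_powR _) mk.
  exact: measurable_fst_powR.
have f12 y : f1 y * f2 y = g y * k y.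
  rewrite /f1 /f2.
  have kE : k y = k y `^ p^-1 * k y `^ q^-1.
    by rewrite -powRD ?pq ?powRr1// oner_eq0.
  rewrite [in RHS]kE -[g y in RHS]mulr1 -(fst_powRK t y); ring.
have := hoelder haar mf1 mf2 p0 q0 pq.
rewrite Lnorm1.
have -> : (\int[haar]_y `|(EFin \o (f1 \* f2)%R) y| = absconv g x)%E.
  by apply: eq_integral => y _; rewrite /= f12 ger0_norm// mulr_ge0.
have -> : Lnorm haar p%:E (EFin \o f1) = (J g x `^ p^-1)%E.
  rewrite Lnorm_ge0_fun//; congr (_ `^ _)%E; apply: eq_integral => y _.
  rewrite /f1 !powRM ?mulr_ge0 ?powR_ge0//; congr EFin.
  by rewrite -!powRrM mulVf ?gt_eqF// powRr1// mulNr.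
have -> : Lnorm haar q%:E (EFin \o f2) = ((fst_ x `^ (t * q) * Cq)%:E `^ q^-1)%E.
  have -> : ((fst_ x `^ (t * q) * Cq)%:E =
      \int[haar]_y (fst_ y `^ (t * q) * cn (F2 (y^-1 * x)%g))%:E)%E.
    by rewrite F2_weight_shift CqE EFinM.
  rewrite Lnorm_ge0_fun//; congr (_ `^ _)%E; apply: eq_integral => y _.
  by rewrite /f2 powRM ?powR_ge0// -!powRrM mulVf ?gt_eqF// powRr1.
move=> h.
have inI (e : \bar R) : (0 <= e)%E -> e \in `[0%E, +oo%E].
  by move=> e0; rewrite in_itv/= e0 leey.
have := gt0_ler_poweR (ltW p0) (inI _ (absconv_ge0 x g0)) _ h.
move=> /(_ (inI _ _)); rewrite mule_ge0 ?poweR_ge0// => /(_ isT) {}h.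
apply: (le_trans h); rewrite poweRM ?poweR_ge0// -!poweRrM mulVf ?gt_eqF// poweRe1//.
rewrite poweR_EFin powRM ?powR_ge0// -powRrM.
have -> : t * q * (q^-1 * p) = t * p by rewrite -mulrA mulVKf ?gt_eqF.
by rewrite (mulrC q^-1).
Qed.

(** One constant for two bounds: in the sum 1 + Cp, the 1 serves the pointwise estimate and Cp the
    L^p estimate. *)
Definition schur_cst : R := (Cq `^ (p / q) * (1 + Cp)) `^ p^-1.

Lemma schur_cst_ge0 : 0 <= schur_cst. Proof. exact: powR_ge0. Qed.

Let le_root (a b : \bar R) : (0 <= a)%E -> (0 <= b)%E ->
  (a `^ p <= b -> a <= b `^ p^-1)%E.
Proof.
move=> a0 b0 ab; have inI (e : \bar R) : (0 <= e)%E -> e \in `[0%E, +oo%E].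
  by move=> e0; rewrite in_itv/= e0 leey.
have ip : 0 <= p^-1 by rewrite invr_ge0 ltW.
have := gt0_ler_poweR ip (inI _ (poweR_ge0 a p)) (inI _ b0) ab.
by rewrite -poweRrM mulfV ?gt_eqF// poweRe1.
Qed.

Let intgp0 g : (0 <= \int[haar]_y (g y `^ p)%:E)%E.
Proof. by apply: integral_ge0 => y _; rewrite lee_fin powR_ge0. Qed.

Let schur_root (a : \bar R) g : (0 <= a)%E -> (forall y, 0 <= g y) ->
  (a `^ p <= (Cq `^ (p / q) * (1 + Cp))%:E * \int[haar]_y (g y `^ p)%:E ->
   a <= schur_cst%:E * Np g)%E.
Proof.
move=> a0 g0 /(le_root a0) h.
have C0 : 0 <= Cq `^ (p / q) * (1 + Cp) by rewrite mulr_ge0 ?powR_ge0 ?addr_ge0.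
apply: (le_trans (h _)); first by rewrite mule_ge0// lee_fin.
by rewrite poweRM ?lee_fin// poweR_EFin Lnorm_ge0_fun.
Qed.

(** After Hoelder, the weights cancel against the kernel: |F2(x^-1 y)| <= (a_y / a_x)^(t p) by the
    AM-GM bound, so a_y^(- t p) |F2(y^-1 x)| a_x^(t p) <= 1. This L^p to sup bound is what makes
    point evaluations bounded on the range. *)
Lemma absconv_le_Lnorm g x : measurable_fun setT g -> (forall y, 0 <= g y) ->
  (absconv g x <= schur_cst%:E * Np g)%E.
Proof.
move=> mg g0; apply: schur_root => //; first exact: absconv_ge0.
apply: (le_trans (absconv_hoelder x mg g0)).
have mgp : measurable_fun setT (fun y => g y `^ p).
  exact: measurableT_comp (measurable_powR _) mg.
have mJ : measurable_fun setT (fun y =>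
    g y `^ p * fst_ y `^ (- (t * p)) * cn (F2 (y^-1 * x)%g)).
  apply: measurable_funM; last exact: measurable_normc_F2_l.
  by apply: measurable_funM => //; exact: measurable_fst_powR.
apply: (@le_trans _ _ ((\int[haar]_y (g y `^ p)%:E) * (Cq `^ (p / q))%:E)%E).
  rewrite EFinM muleA; apply: lee_wpmul2r; first by rewrite lee_fin powR_ge0.
  rewrite /J -ge0_integralZr//; [|exact/measurable_EFinP| |by rewrite lee_fin powR_ge0].
    apply: ge0_le_integral => //.
    - by move=> y _; rewrite -EFinM lee_fin !mulr_ge0 ?powR_ge0 ?normc_ge0.
    - by apply: emeasurable_funM => //; exact/measurable_EFinP.
    - exact/measurable_EFinP.
    move=> y _; rewrite -EFinM lee_fin -!mulrA ler_piMr ?powR_ge0//.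
    rewrite normc_F2_sym.
    have := @normc_F2_le_powR R (x^-1 * y)%g (t * p).
    rewrite (ltW (proj1 (andP tp))) (le_trans (proj2 (andP tp))) ?ler1n//= => /(_ isT) h.
    apply: (@le_trans _ _ (fst_ y `^ (- (t * p)) * ((fst_ (x^-1 * y)%g `^ (t * p)) * fst_ x `^ (t * p)))).
      by rewrite ler_wpM2l ?powR_ge0// ler_wpM2r ?powR_ge0.
    have fx := fst_gt0 x; have fy := fst_gt0 y.
    have fV : 0 <= (fst_ x)^-1 * fst_ y by rewrite mulr_ge0 ?invr_ge0 ?(ltW fx) ?(ltW fy).
    rewrite axb_valM axb_valV /= -(powRM _ fV (ltW fx)).
    by rewrite mulrAC mulVf ?gt_eqF// mul1r fst_powRK.
  by move=> y _; rewrite lee_fin !mulr_ge0 ?powR_ge0 ?normc_ge0.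
rewrite muleC; apply: lee_wpmul2r; first exact: intgp0.
by rewrite lee_fin ler_peMr ?powR_ge0// lerDl.
Qed.

(** Schur's test proper: integrate the Hoelder bound over x and exchange the integrals. The integral
    over x is again an eigenfunction identity, whose a_y^(t p) cancels the weight a_y^(- t p). A
    real-valued h below [absconv g] keeps both norms on real functions. *)
Lemma Lnorm_absconv_le g (h : G -> R) : measurable_fun setT g -> measurable_fun setT h ->
  (forall y, 0 <= g y) ->
  (forall x, 0 <= h x) -> (forall x, (h x)%:E <= absconv g x)%E ->
  (Np h <= schur_cst%:E * Np g)%E.
Proof.
move=> mg mh g0 h0 hg; apply: schur_root => //; first exact: Lnorm_ge0.
have inI (e : \bar R) : (0 <= e)%E -> e \in `[0%E, +oo%E].
  by move=> e0; rewrite in_itv/= e0 leey.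
rewrite Lnorm_powR//.
have mgp : measurable_fun setT (fun y => g y `^ p).
  exact: measurableT_comp (measurable_powR _) mg.
pose T (z : G * G) := (g z.1 `^ p * fst_ z.1 `^ (- (t * p)) * cn (F2 (z.1^-1 * z.2)%g) *
   (fst_ z.2 `^ (t * p) * Cq `^ (p / q)))%:E.
have T0 z : (0 <= T z)%E by rewrite lee_fin !mulr_ge0 ?powR_ge0 ?normc_ge0.
have mT : measurable_fun setT T.
  apply/measurable_EFinP; apply: measurable_funM; last first.
    by apply: measurable_funM => //; apply: (measurableT_comp (measurable_fst_powR _)).
  apply: measurable_funM; last exact: measurable_normc_F2_2.
  apply: measurable_funM; first exact: (measurableT_comp mgp).
  exact: (measurableT_comp (measurable_fst_powR _)).
apply: (@le_trans _ _ (\int[haar]_x \int[haar]_y T (y, x)))%E.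
  apply: ge0_le_integral => //.
  - by move=> x _; rewrite lee_fin powR_ge0.
  - by apply/measurable_EFinP; exact: measurableT_comp (measurable_powR _) mh.
  - exact: (measurable_fun_fubini_tonelli_G T).
  move=> x _; rewrite -poweR_EFin.
  have hx := gt0_ler_poweR (ltW p0) (inI _ _) (inI _ (absconv_ge0 x g0)) (hg x).
  apply: le_trans (hx _) _; first by rewrite lee_fin.
  apply: (le_trans (absconv_hoelder x mg g0)).
  rewrite /J -ge0_integralZr//.
  - apply/measurable_EFinP; apply: measurable_funM; last exact: measurable_normc_F2_l.
    by apply: measurable_funM => //; exact: measurable_fst_powR.
  - by move=> y _; rewrite lee_fin !mulr_ge0 ?powR_ge0 ?normc_ge0.
  - by rewrite lee_fin mulr_ge0 ?powR_ge0.
rewrite -(fubini_tonelli T mT T0).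
rewrite -ge0_integralZl//; last 3 first.
- by apply/measurable_EFinP.
- by move=> y _; rewrite lee_fin powR_ge0.
- by rewrite lee_fin mulr_ge0 ?powR_ge0 ?addr_ge0.
apply: ge0_le_integral => //.
- by move=> y _; exact: integral_ge0.
- exact: (measurable_fun_fubini_tonelli_F T).
- by apply: emeasurable_funM => //; exact/measurable_EFinP.
move=> y _.
have -> : (\int[haar]_x T (y, x) = (g y `^ p * fst_ y `^ (- (t * p)) * Cq `^ (p / q))%:E *
    \int[haar]_x (fst_ x `^ (t * p) * cn (F2 (x^-1 * y)%g))%:E)%E.
  rewrite -ge0_integralZl//.
  - apply: eq_integral => x _; rewrite /T/= -EFinM normc_F2_sym; congr EFin; ring.
  - apply/measurable_EFinP; apply: measurable_funM; last exact: measurable_normc_F2_l.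
    exact: measurable_fst_powR.
  - by move=> x _; rewrite lee_fin !mulr_ge0 ?powR_ge0 ?normc_ge0.
  - by rewrite lee_fin !mulr_ge0 ?powR_ge0.
rewrite F2_weight_shift CpE -!EFinM lee_fin.
rewrite [X in X <= _](_ : _ = (fst_ y `^ (- (t * p)) * fst_ y `^ (t * p)) *
    (Cq `^ (p / q) * Cp * g y `^ p)); last by ring.
rewrite fst_powRK mul1r ler_wpM2r ?powR_ge0// ler_wpM2l ?powR_ge0//.
by rewrite lerDr.
Qed.

End exponent.
End schur_test.

(** * Integration of complex functions *)

Section complex_measurable.
Context d (T : measurableType d) {R : realType}.
Local Notation C := R[i].
Local Notation cn := (@Normc.normc R).
Implicit Types f g : T -> C.

Definition cmeasurable f := measurable_fun setT (fun x => complex.Re (f x)) /\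
  measurable_fun setT (fun x => complex.Im (f x)).

Lemma ReM (z w : C) : complex.Re (z * w) =
  complex.Re z * complex.Re w - complex.Im z * complex.Im w.
Proof. by case: z; case: w. Qed.

Lemma ImM (z w : C) : complex.Im (z * w) =
  complex.Re z * complex.Im w + complex.Im z * complex.Re w.
Proof. by case: z; case: w. Qed.

Lemma ReD (z w : C) : complex.Re (z + w) = complex.Re z + complex.Re w.
Proof. by case: z; case: w. Qed.

Lemma ImD (z w : C) : complex.Im (z + w) = complex.Im z + complex.Im w.
Proof. by case: z; case: w. Qed.

Lemma ReN (z : C) : complex.Re (- z) = - complex.Re z. Proof. by case: z. Qed.

Lemma ImN (z : C) : complex.Im (- z) = - complex.Im z. Proof. by case: z. Qed.

Lemma cmeasurable_cst (c : C) : cmeasurable (fun=> c).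
Proof. by split; exact: measurable_cst. Qed.

Lemma cmeasurableD f g : cmeasurable f -> cmeasurable g -> cmeasurable (fun x => f x + g x).
Proof.
move=> [f1 f2] [g1 g2]; split; [under eq_fun do rewrite ReD|under eq_fun do rewrite ImD];
  exact: measurable_funD.
Qed.

Lemma cmeasurableN f : cmeasurable f -> cmeasurable (fun x => - f x).
Proof.
move=> [f1 f2]; split; [under eq_fun do rewrite ReN|under eq_fun do rewrite ImN];
  exact: measurableT_comp.
Qed.

Lemma cmeasurableB f g : cmeasurable f -> cmeasurable g -> cmeasurable (fun x => f x - g x).
Proof. by move=> mf mg; apply: cmeasurableD => //; exact: cmeasurableN. Qed.

Lemma cmeasurableM f g : cmeasurable f -> cmeasurable g -> cmeasurable (fun x => f x * g x).
Proof.
move=> [f1 f2] [g1 g2]; split.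
  by under eq_fun do rewrite ReM; apply: measurable_funB; exact: measurable_funM.
by under eq_fun do rewrite ImM; apply: measurable_funD; exact: measurable_funM.
Qed.

Lemma cmeasurableR (f : T -> R) : measurable_fun setT f -> cmeasurable (fun x => (f x)%:C).
Proof. by move=> mf; split => //; exact: measurable_cst. Qed.

Lemma cmeasurable_sum (I : Type) (s : seq I) (F : I -> T -> C) :
  (forall i, cmeasurable (F i)) -> cmeasurable (fun x => \sum_(i <- s) F i x).
Proof.
move=> mF; elim: s => [|i s ih].
  by under eq_fun do rewrite big_nil; exact: cmeasurable_cst.
by under eq_fun do rewrite big_cons; exact: cmeasurableD.
Qed.

Lemma measurable_normc f : cmeasurable f -> measurable_fun setT (fun x => cn (f x)).
Proof.
move=> [f1 f2].
rewrite (_ : (fun x => _) = (fun x => Num.sqrt (complex.Re (f x) ^+ 2 + complex.Im (f x) ^+ 2))).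
  have ms : measurable_fun setT (@Num.sqrt R).
    by apply: continuous_measurable_fun; exact: sqrt_continuous.
  apply: (measurableT_comp ms); apply: measurable_funD; exact: measurable_funX.
by apply/funext => x; case: (f x).
Qed.

Lemma cmeasurable_cvg (F : nat -> T -> C) f : (forall n, cmeasurable (F n)) ->
  (forall x, \forall n \near \oo, F n x = f x) -> cmeasurable f.
Proof.
move=> mF Ff.
have h (k : C -> R) : (forall n, measurable_fun setT (fun x => k (F n x))) ->
    measurable_fun setT (fun x => k (f x)).
  move=> mk; apply: (@measurable_fun_cvg _ _ _ setT (fun n x => k (F n x))) => // x _.
  by apply: cvg_near_cst; apply: filterS (Ff x) => n ->.
by split; apply: h => n; have [] := mF n.
Qed.

End complex_measurable.

Lemma cmeasurable_comp d1 d2 (T1 : measurableType d1) (T2 : measurableType d2) (R : realType)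
    (f : T2 -> R[i]) (h : T1 -> T2) :
  cmeasurable f -> measurable_fun setT h -> cmeasurable (fun x => f (h x)).
Proof.
by move=> [f1 f2] mh; split; [exact: (measurableT_comp f1)|exact: (measurableT_comp f2)].
Qed.

Section complex_integral.
Context {R : realType}.
Local Notation G := (axb R).
Local Notation C := R[i].
Local Notation cn := (@Normc.normc R).
Implicit Types f g : G -> C.

Definition cintegrable f := cmeasurable f /\ (\int[haar]_x (cn (f x))%:E < +oo)%E.

Lemma cintegrable_ReIm f : cintegrable f ->
  haar.-integrable setT (EFin \o (fun x => complex.Re (f x))) /\
  haar.-integrable setT (EFin \o (fun x => complex.Im (f x))).
Proof.
move=> [[f1 f2] fi].
have mn := measurable_normc (conj f1 f2).
have dom (h : G -> R) : measurable_fun setT h -> (forall x, `|h x| <= cn (f x)) ->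
    haar.-integrable setT (EFin \o h).
  move=> mh hf; apply/integrableP; split; first exact/measurable_EFinP.
  apply: le_lt_trans fi; apply: ge0_le_integral => //.
  - by apply/measurable_EFinP; exact: measurableT_comp.
  - exact/measurable_EFinP.
  - by move=> x _; rewrite lee_fin.
by split; apply: dom => // x; [exact: le_Re_normc|exact: le_Im_normc].
Qed.

Lemma ReIm_cintegrable f :
  haar.-integrable setT (EFin \o (fun x => complex.Re (f x))) ->
  haar.-integrable setT (EFin \o (fun x => complex.Im (f x))) -> cintegrable f.
Proof.
move=> /integrableP[/measurable_EFinP m1 i1] /integrableP[/measurable_EFinP m2 i2].
have mf : cmeasurable f by [].
split => //.
apply: (@le_lt_trans _ _ (\int[haar]_x (`|complex.Re (f x)|%:E + `|complex.Im (f x)|%:E))%E).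
  apply: ge0_le_integral => //.
  - by move=> x _; rewrite lee_fin normc_ge0.
  - by apply/measurable_EFinP; exact: measurable_normc.
  - by apply: emeasurable_funD; apply/measurable_EFinP; exact: measurableT_comp.
  - by move=> x _; rewrite -EFinD lee_fin normc_le.
rewrite ge0_integralD//.
- exact: lte_add_pinfty.
- by apply/measurable_EFinP; exact: measurableT_comp.
- by apply/measurable_EFinP; exact: measurableT_comp.
Qed.

Lemma le_cintegrable f (h : G -> R) : cmeasurable f -> measurable_fun setT h ->
  (forall x, cn (f x) <= h x) -> (\int[haar]_x (h x)%:E < +oo)%E -> cintegrable f.
Proof.
move=> mf mh fh hi; split => //; apply: le_lt_trans hi; apply: ge0_le_integral => //.
- by move=> x _; rewrite lee_fin normc_ge0.
- by apply/measurable_EFinP; exact: measurable_normc.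
- exact/measurable_EFinP.
- by move=> x _; rewrite lee_fin.
Qed.

Lemma eq_cintegral f g : f =1 g -> cintegral f = cintegral g.
Proof. by move=> /funext ->. Qed.

Lemma cintegrableD f g : cintegrable f -> cintegrable g -> cintegrable (fun x => f x + g x).
Proof.
move=> /cintegrable_ReIm[f1 f2] /cintegrable_ReIm[g1 g2].
apply: ReIm_cintegrable.
  rewrite (_ : _ \o _ = (EFin \o (fun x => complex.Re (f x))) \+ (EFin \o (fun x => complex.Re (g x))))%E.
    exact: integrableD.
  by apply/funext => x /=; rewrite ReD EFinD.
rewrite (_ : _ \o _ = (EFin \o (fun x => complex.Im (f x))) \+ (EFin \o (fun x => complex.Im (g x))))%E.
  exact: integrableD.
by apply/funext => x /=; rewrite ImD EFinD.
Qed.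

Lemma cintegralD f g : cintegrable f -> cintegrable g ->
  cintegral (fun x => f x + g x) = cintegral f + cintegral g.
Proof.
move=> /cintegrable_ReIm[f1 f2] /cintegrable_ReIm[g1 g2].
apply/eqP; rewrite eq_complex /=; apply/andP; split; apply/eqP.
  by rewrite -RintegralD//; apply: eq_Rintegral => x _; rewrite ReD.
by rewrite -RintegralD//; apply: eq_Rintegral => x _; rewrite ImD.
Qed.

Lemma cintegrableZ (c : C) f : cintegrable f -> cintegrable (fun x => c * f x).
Proof.
move=> [mf fi]; split; first by apply: cmeasurableM => //; exact: cmeasurable_cst.
under eq_integral do rewrite Normc.normcM EFinM.
rewrite ge0_integralZl//.
- apply: lte_mul_pinfty => //; rewrite ?lee_fin ?normc_ge0//.
- by apply/measurable_EFinP; exact: measurable_normc.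
- by move=> x _; rewrite lee_fin normc_ge0.
- by rewrite lee_fin normc_ge0.
Qed.

Lemma cintegralZ (c : C) f : cintegrable f ->
  cintegral (fun x => c * f x) = c * cintegral f.
Proof.
move=> /cintegrable_ReIm[f1 f2].
have iZ (k : R) (h : G -> R) : haar.-integrable setT (EFin \o h) ->
    haar.-integrable setT (EFin \o (fun x => k * h x)).
  move=> ih; rewrite (_ : _ \o _ = (fun x => k%:E * (EFin \o h) x)%E).
    exact: integrableZl.
  by apply/funext => x /=; rewrite EFinM.
apply/eqP; rewrite eq_complex; apply/andP; split; apply/eqP.
  rewrite ReM /= -!RintegralZl// -RintegralB//; try exact: iZ.
  by apply: eq_Rintegral => x _; rewrite ReM.
rewrite ImM /= -!RintegralZl// -RintegralD//; try exact: iZ.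
by apply: eq_Rintegral => x _; rewrite ImM.
Qed.

(** For c <> 0, dividing by c makes f integrable; for c = 0 both sides vanish, whatever value the
    integral of f takes by convention. *)
Lemma cintegralZ_weak (c : C) f : cintegrable (fun x => c * f x) ->
  cintegral (fun x => c * f x) = c * cintegral f.
Proof.
move=> icf; have [->|c0] := eqVneq c 0.
  rewrite mul0r; under eq_cintegral do rewrite mul0r.
  by rewrite /cintegral; congr (_ +i* _); rewrite /Rintegral integral0.
apply: cintegralZ; have := cintegrableZ c^-1 icf.
by under eq_fun do rewrite mulKf//.
Qed.

Lemma cintegralB f g : cintegrable f -> cintegrable g ->
  cintegral (fun x => f x - g x) = cintegral f - cintegral g.
Proof.
move=> fi gi; rewrite -mulN1r -(cintegralZ _ gi) -cintegralD//; last exact: cintegrableZ.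
by apply: eq_cintegral => x; rewrite mulN1r.
Qed.

Lemma cintegral0 : cintegral (fun=> 0 : C) = 0 :> C.
Proof. by rewrite /cintegral; congr (_ +i* _); rewrite /Rintegral integral0. Qed.

Lemma cintegrable0 : cintegrable (fun=> 0 : C).
Proof.
split; first exact: cmeasurable_cst.
by under eq_integral do rewrite Normc.normc0; rewrite integral0 ltry.
Qed.

Lemma cintegral_sum (I : Type) (s : seq I) (F : I -> G -> C) :
  (forall i, cintegrable (F i)) ->
  cintegrable (fun x => \sum_(i <- s) F i x) /\
  cintegral (fun x => \sum_(i <- s) F i x) = \sum_(i <- s) cintegral (F i).
Proof.
move=> iF; elim: s => [|i s [ih1 ih2]].
  rewrite big_nil (_ : (fun x => _) = fun=> 0); last by apply/funext => x; rewrite big_nil.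
  by rewrite cintegral0; split => //; exact: cintegrable0.
rewrite (_ : (fun x => _) = fun x => F i x + \sum_(j <- s) F j x).
  by rewrite cintegralD// ih2 big_cons; split => //; exact: cintegrableD.
by apply/funext => x; rewrite big_cons.
Qed.

(** Real and imaginary parts are bounded separately, which costs the factor 2 that all later
    operator bounds carry. *)
Lemma normc_cintegral f : cmeasurable f ->
  ((cn (cintegral f))%:E <= 2%:E * \int[haar]_x (cn (f x))%:E)%E.
Proof.
move=> mf; have [fi|] := ltP (\int[haar]_x (cn (f x))%:E)%E +oo%E; last first.
  by rewrite leye_eq => /eqP ->; rewrite gt0_muley ?lte_fin// leey.
have [i1 i2] := cintegrable_ReIm (conj mf fi).
pose I : \bar R := (\int[haar]_x (cn (f x))%:E)%E.
rewrite -/I.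
have I0 : (0 <= I)%E by apply: integral_ge0 => x _; rewrite lee_fin normc_ge0.
have If : I \is a fin_num by rewrite ge0_fin_numE.
have h (k : G -> R) : haar.-integrable setT (EFin \o k) -> (forall x, `|k x| <= cn (f x)) ->
    `|\int[haar]_x k x| <= fine I.
  move=> ik kf; apply: (le_trans (le_normr_Rintegral _ ik)) => //.
  rewrite /Rintegral; apply: fine_le => //.
    rewrite ge0_fin_numE; last by apply: integral_ge0 => x _; rewrite lee_fin.
    by case/integrableP : ik.
  apply: ge0_le_integral => //.
  - case/integrableP : ik => /measurable_EFinP mk _.
    by apply/measurable_EFinP; exact: measurableT_comp.
  - by apply/measurable_EFinP; exact: measurable_normc.
  - by move=> x _; rewrite lee_fin.
rewrite -(fineK If) -EFinM lee_fin; apply: (le_trans (normc_le _)) => /=.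
by rewrite mulr2n mulrDl mul1r lerD// h// => x; [exact: le_Re_normc|exact: le_Im_normc].
Qed.

Lemma cintegral_shift (g : G) f : cmeasurable f ->
  cintegral (fun x => f (g * x)%g) = cintegral f.
Proof.
move=> [f1 f2]; rewrite /cintegral /Rintegral; congr (fine _ +i* fine _).
  by apply: (@haar_left_invariant _ g (fun x => (complex.Re (f x))%:E)); exact/measurable_EFinP.
by apply: (@haar_left_invariant _ g (fun x => (complex.Im (f x))%:E)); exact/measurable_EFinP.
Qed.

(** The inner integrals pass through [fine]; integrability of every slice, not just of almost every
    one, ensures that [fine] never replaces an infinite value. *)
Lemma Rintegral_fubini (k : G * G -> R) : measurable_fun setT k ->
  (haar \x haar)%E.-integrable setT (EFin \o k) ->
  (forall x, haar.-integrable setT (fun y => (k (x, y))%:E)) ->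
  (forall y, haar.-integrable setT (fun x => (k (x, y))%:E)) ->
  \int[haar]_x \int[haar]_y k (x, y) = \int[haar]_y \int[haar]_x k (x, y).
Proof.
move=> mk ik k1 k2; rewrite /Rintegral.
have -> : (\int[haar]_x (fine (\int[haar]_y (k (x, y))%:E))%:E =
    \int[haar]_x \int[haar]_y (k (x, y))%:E)%E.
  by apply: eq_integral => x _; rewrite fineK// integrable_fin_num.
have -> : (\int[haar]_y (fine (\int[haar]_x (k (x, y))%:E))%:E =
    \int[haar]_y \int[haar]_x (k (x, y))%:E)%E.
  by apply: eq_integral => y _; rewrite fineK// integrable_fin_num.
by congr fine; exact: (@Fubini _ _ _ _ _ haar haar (EFin \o k)).
Qed.

Lemma cintegral_fubini (k : G * G -> C) : cmeasurable k ->
  (\int[haar]_x \int[haar]_y (cn (k (x, y)))%:E < +oo)%E ->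
  (forall x, \int[haar]_y (cn (k (x, y)))%:E < +oo)%E ->
  (forall y, \int[haar]_x (cn (k (x, y)))%:E < +oo)%E ->
  cintegral (fun x => cintegral (fun y => k (x, y))) =
  cintegral (fun y => cintegral (fun x => k (x, y))).
Proof.
move=> mk ik k1 k2.
have c1 x : cintegrable (fun y => k (x, y)).
  by split => //; apply: cmeasurable_comp mk _; exact: measurable_pair1.
have c2 y : cintegrable (fun x => k (x, y)).
  by split => //; apply: cmeasurable_comp mk _; exact: measurable_pair2.
have mn := measurable_normc mk.
have dom (h : G * G -> R) : measurable_fun setT h -> (forall z, `|h z| <= cn (k z)) ->
    (haar \x haar)%E.-integrable setT (EFin \o h).
  move=> mh hk; apply/integrable12ltyP; first exact/measurable_EFinP.
  apply: le_lt_trans ik; apply: ge0_le_integral => //.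
  - by move=> x _; apply: integral_ge0.
  - apply: (measurable_fun_fubini_tonelli_F (fun z : G * G => `|(h z)%:E|%E)) => //.
    by apply/measurable_EFinP; exact: measurableT_comp.
  - apply: (measurable_fun_fubini_tonelli_F (fun z : G * G => (cn (k z))%:E)) => //.
      exact/measurable_EFinP.
    by move=> z; rewrite lee_fin normc_ge0.
  - move=> x _; apply: ge0_le_integral => //.
    + apply/measurable_EFinP; apply: measurableT_comp => //.
      by apply: measurableT_comp mh _; exact: measurable_pair1.
    + by apply/measurable_EFinP; apply: measurableT_comp mn _; exact: measurable_pair1.
    + by move=> y _; rewrite lee_fin.
rewrite /cintegral; congr (_ +i* _).
  apply: (@Rintegral_fubini (fun z => complex.Re (k z))); first by case: mk.
  - by apply: dom; [case: mk|move=> z; exact: le_Re_normc].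
  - by move=> x; have [] := cintegrable_ReIm (c1 x).
  - by move=> x; have [] := cintegrable_ReIm (c2 x).
apply: (@Rintegral_fubini (fun z => complex.Im (k z))); first by case: mk.
- by apply: dom; [case: mk|move=> z; exact: le_Im_normc].
- by move=> x; have [] := cintegrable_ReIm (c1 x).
- by move=> x; have [] := cintegrable_ReIm (c2 x).
Qed.

Lemma cmeasurable_cintegral (k : G * G -> C) : cmeasurable k ->
  cmeasurable (fun y => cintegral (fun x => k (x, y))).
Proof.
have h (f : G * G -> R) : measurable_fun setT f ->
    measurable_fun setT (fun y => \int[haar]_x f (x, y)).
  move=> mf; apply: (measurableT_comp (f := fine)) => //.
  rewrite (_ : (fun y => _) = (fun y => (\int[haar]_x ((EFin \o f)^\+ (x, y)))%E -
      \int[haar]_x ((EFin \o f)^\- (x, y)))%E); last first.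
    apply/funext => y; rewrite integralE; congr (_ - _)%E; apply: eq_integral => x _.
      by rewrite !funeposE.
    by rewrite !funenegE.
  apply: emeasurable_funB.
    apply: (measurable_fun_fubini_tonelli_G (EFin \o f)^\+%E) => //.
    by apply: measurable_funepos; exact/measurable_EFinP.
  apply: (measurable_fun_fubini_tonelli_G (EFin \o f)^\-%E) => //.
  by apply: measurable_funeneg; exact/measurable_EFinP.
by move=> [k1 k2]; split; [exact: (h (fun z => complex.Re (k z)))|
                           exact: (h (fun z => complex.Im (k z)))].
Qed.

End complex_integral.

(** * The convolution square of F2 *)

Section complex_derivative.
Context {R : realType}.
Local Notation C := R[i].
Local Notation cn := (@Normc.normc R).
Local Notation mu := (@lebesgue_measure R).
Implicit Types (f g h : R -> C) (t : R) (z w : C).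

Definition cderiv f z t := is_derive t 1 (fun s => complex.Re (f s)) (complex.Re z) /\
  is_derive t 1 (fun s => complex.Im (f s)) (complex.Im z).

Lemma is_derive_ext (f g : R -> R) t (a b : R) :
  f =1 g -> a = b -> is_derive t 1 f a -> is_derive t 1 g b.
Proof. by move=> /funext -> ->. Qed.

Lemma cderiv_cst z t : cderiv (fun=> z) 0 t.
Proof. by split; exact: is_derive_cst. Qed.

Lemma cderiv_id t : cderiv (fun s => s%:C) 1 t.
Proof. by split; [exact: is_derive_id|exact: is_derive_cst]. Qed.

Lemma cderivD f g z w t : cderiv f z t -> cderiv g w t ->
  cderiv (fun s => f s + g s) (z + w) t.
Proof.
move=> [f1 f2] [g1 g2]; split.
  apply: (is_derive_ext _ _ (is_deriveD f1 g1)) => [s|]; by rewrite ReD.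
by apply: (is_derive_ext _ _ (is_deriveD f2 g2)) => [s|]; rewrite ImD.
Qed.

Lemma cderivM f g z w t : cderiv f z t -> cderiv g w t ->
  cderiv (fun s => f s * g s) (z * g t + f t * w) t.
Proof.
move=> [f1 f2] [g1 g2]; split.
  apply: (is_derive_ext _ _ (is_deriveB (is_deriveM f1 g1) (is_deriveM f2 g2))) => [s|].
    by rewrite ReM.
  by rewrite ReD !ReM /GRing.scale /=; ring.
apply: (is_derive_ext _ _ (is_deriveD (is_deriveM f1 g2) (is_deriveM f2 g1))) => [s|].
  by rewrite ImM.
by rewrite ImD !ImM /GRing.scale /=; ring.
Qed.

Lemma ReJ z : complex.Re z^* = complex.Re z. Proof. by case: z. Qed.

Lemma ImJ z : complex.Im z^* = - complex.Im z. Proof. by case: z. Qed.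

Lemma cderiv_conj f z t : cderiv f z t -> cderiv (fun s => (f s)^*) z^* t.
Proof.
move=> [f1 f2]; split; first by apply: (is_derive_ext _ _ f1) => [s|]; rewrite ReJ.
by apply: (is_derive_ext _ _ (is_deriveN f2)) => [s|]; rewrite ImJ.
Qed.

Lemma ReV z : complex.Re z^-1 = complex.Re z / (complex.Re z ^+ 2 + complex.Im z ^+ 2).
Proof. by case: z. Qed.

Lemma ImV z : complex.Im z^-1 = - (complex.Im z / (complex.Re z ^+ 2 + complex.Im z ^+ 2)).
Proof. by case: z. Qed.

Lemma sqr_ReIm_gt0 z : z != 0 -> 0 < complex.Re z ^+ 2 + complex.Im z ^+ 2.
Proof. by move=> z0; rewrite -normcE2 exprn_gt0// lt_def normc_ge0 normc_eq0 z0. Qed.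

(** The right-hand side is what the real product and inverse rules produce for the derivative of 1/f
    at a point where f = w and f' = z. *)
Lemma NVX2E z w (u := complex.Re w) (v := complex.Im w)
    (a := complex.Re z) (b := complex.Im z) : w != 0 ->
  - z * w ^- 2 =
  (u * (- (u * u + v * v) ^- 2 * (u * a + u * a + (v * b + v * b))) +
   (u * u + v * v)^-1 * a) +i*
  (- (v * (- (u * u + v * v) ^- 2 * (u * a + u * a + (v * b + v * b))) +
   (u * u + v * v)^-1 * b)).
Proof.
move=> w0; have n0 := sqr_ReIm_gt0 w0.
apply: (mulIf (expf_neq0 2 w0)); rewrite mulfVK ?expf_neq0//.
rewrite -/u -/v in n0; have nz : u * u + v * v != 0 by rewrite gt_eqF// -!expr2.
have -> : w = u +i* v by rewrite /u /v; case: (w).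
have -> : z = a +i* b by rewrite /a /b; case: (z).
apply/eqP; rewrite expr2 eq_complex /=; apply/andP; split; apply/eqP; field; exact: nz.
Qed.

Lemma ReNVX2 z w (u := complex.Re w) (v := complex.Im w)
    (a := complex.Re z) (b := complex.Im z) : w != 0 ->
  complex.Re (- z * w ^- 2) =
  u * (- (u * u + v * v) ^- 2 * (u * a + u * a + (v * b + v * b))) +
   (u * u + v * v)^-1 * a.
Proof. by move=> w0; rewrite NVX2E. Qed.

Lemma ImNVX2 z w (u := complex.Re w) (v := complex.Im w)
    (a := complex.Re z) (b := complex.Im z) : w != 0 ->
  complex.Im (- z * w ^- 2) =
  - (v * (- (u * u + v * v) ^- 2 * (u * a + u * a + (v * b + v * b))) +
   (u * u + v * v)^-1 * b).
Proof. by move=> w0; rewrite NVX2E. Qed.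

Lemma cderivV f z t : f t != 0 -> cderiv f z t ->
  cderiv (fun s => (f s)^-1) (- z * (f t) ^- 2) t.
Proof.
move=> ft0 [f1 f2]; have n0 := sqr_ReIm_gt0 ft0.
have dn := is_deriveD (is_deriveM f1 f1) (is_deriveM f2 f2).
have n0' : ((fun s => complex.Re (f s)) * (fun s => complex.Re (f s)) +
    (fun s => complex.Im (f s)) * (fun s => complex.Im (f s)) : R -> R) t != 0.
  by rewrite gt_eqF//; move: n0; rewrite !expr2.
have dV := is_deriveV n0' dn.
have nz : complex.Re (f t) ^+ 2 + complex.Im (f t) ^+ 2 != 0 by rewrite gt_eqF.
split.
  apply: (is_derive_ext _ _ (is_deriveM f1 dV)) => [s|].
    by rewrite ReV !expr2.
  by rewrite (ReNVX2 z ft0).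
apply: (is_derive_ext _ _ (is_deriveN (is_deriveM f2 dV))) => [s|].
  by rewrite ImV !expr2.
by rewrite (ImNVX2 z ft0).
Qed.

Lemma cderiv_continuous f z t : cderiv f z t ->
  {for t, continuous (fun s => complex.Re (f s))} /\
  {for t, continuous (fun s => complex.Im (f s))}.
Proof.
move=> [[f1 _] [f2 _]].
by split; exact/differentiable_continuous/derivable1_diffP.
Qed.

(* A primitive of (A - i (b - c))^-1. *)
Definition clog (A c b : R) : C :=
  atan ((b - c) / A) +i* (2^-1 * ln (A ^+ 2 + (b - c) ^+ 2)).

Lemma cderiv_clog (A c b : R) : 0 < A -> cderiv (clog A c) (A -i* (b - c))^-1 b.
Proof.
move=> A0.
have db : is_derive b 1 (fun s : R => s - c) 1.
  apply: (is_derive_ext _ _ (is_deriveB (is_derive_id b 1) (is_derive_cst c b 1))) => //.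
  by rewrite subr0.
have n0 : 0 < A ^+ 2 + (b - c) ^+ 2 by rewrite ltr_wpDr ?sqr_ge0// exprn_gt0.
have nz : A ^+ 2 + (b - c) ^+ 2 != 0 by rewrite gt_eqF.
split.
  have d1 := is_deriveZ A^-1 db.
  apply: (is_derive_ext _ _ (is_derive1_comp (is_derive1_atan _) d1)) => [s|].
    by rewrite /= /GRing.scale_fun /GRing.scale /= mulrC.
  rewrite ReV /= /GRing.scale_fun /GRing.scale /= sqrrN.
  have nA : A != 0 by rewrite gt_eqF.
  have -> : 1 + (A^-1 * (b - c)) ^+ 2 = (A ^+ 2 + (b - c) ^+ 2) / A ^+ 2 by field.
  rewrite invfM invrK mulr1 -mulrA expr2 mulfK//; exact: mulrC.
have d2 := is_deriveD (is_derive_cst (A ^+ 2) b 1) (is_deriveM db db).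
have n0' : 0 < (cst (A ^+ 2) + (fun s : R => s - c) * (fun s : R => s - c)) b.
  by move: n0; rewrite !expr2.
have d3 := is_deriveZ 2^-1 (is_derive1_comp (is_derive1_ln n0') d2).
apply: (is_derive_ext _ _ d3) => [s|].
  by rewrite /= /GRing.scale_fun /GRing.scale /= !expr2.
rewrite ImV /= /GRing.scale /= sqrrN /GRing.add_fun /GRing.mul_fun /= -!expr2.
have -> : (cst (A ^+ 2) + (fun s : R => s - c) ^+ 2) b = A ^+ 2 + (b - c) ^+ 2 by [].
by field.
Qed.

Lemma cintegral_exhaust (D : set R) (u v : nat -> R) (F h : R -> C) (l : C) :
  measurable D ->
  (forall n, u n < v n) -> (forall n, `[u n, v n]%classic `<=` D) ->
  (forall x, D x -> \forall n \near \oo, u n <= x <= v n) ->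
  (forall x, D x -> cderiv F (h x) x) ->
  (forall x, D x -> exists z, cderiv h z x) ->
  mu.-integrable D (fun x => (complex.Re (h x))%:E) ->
  mu.-integrable D (fun x => (complex.Im (h x))%:E) ->
  (fun n => cn (F (v n) - F (u n) - l)) @ \oo --> (0 : R) ->
  ((\int[mu]_(x in D) (complex.Re (h x))%:E)%E = (complex.Re l)%:E) /\
  ((\int[mu]_(x in D) (complex.Im (h x))%:E)%E = (complex.Im l)%:E).
Proof.
move=> mD uv uvD Duv dF ch i1 i2 Fl.
have Flim (k : C -> R) : (forall z w, k (z - w) = k z - k w) -> (forall z, `|k z| <= cn z) ->
    (fun n => k (F (v n)) - k (F (u n))) @ \oo --> k l.
  move=> kB kn; apply/cvgrPdist_le => e e0.
  move/cvgrPdist_le : Fl => /(_ e e0); apply: filterS => n.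
  rewrite sub0r normrN ger0_norm ?normc_ge0//; apply: le_trans.
  by rewrite distrC -!kB kn.
split.
  apply: (@integral_exhaust _ D u v (fun x => complex.Re (F x)) (fun x => complex.Re (h x))) => //.
  - by move=> x /dF[].
  - by move=> x /ch[z /cderiv_continuous[]].
  - by apply: (Flim (@complex.Re R)) => [z w|z]; [rewrite ReD ReN|exact: le_Re_normc].
apply: (@integral_exhaust _ D u v (fun x => complex.Im (F x)) (fun x => complex.Im (h x))) => //.
- by move=> x /dF[].
- by move=> x /ch[z /cderiv_continuous[]].
- by apply: (Flim (@complex.Im R)) => [z w|z]; [rewrite ImD ImN|exact: le_Im_normc].
Qed.

End complex_derivative.

Section complex_limits.
Context {R : realType}.
Local Notation C := R[i].
Local Notation cn := (@Normc.normc R).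
Implicit Types (u v : nat -> C).

Definition cvg0 u := (fun n => cn (u n)) @ \oo --> (0 : R).

Lemma cvg0_le u (r : nat -> R) : (forall n, cn (u n) <= r n) -> r @ \oo --> 0 -> cvg0 u.
Proof.
move=> ur r0; apply: (squeeze_cvgr _ (cvg_cst 0) r0); apply: nearW => n.
by rewrite normc_ge0 ur.
Qed.

Lemma cvg0D u v : cvg0 u -> cvg0 v -> cvg0 (fun n => u n + v n).
Proof.
move=> u0 v0; apply: (cvg0_le (fun n => normcD (u n) (v n))).
by rewrite -[X in _ --> X]addr0; exact: cvgD.
Qed.

Lemma cvg0Z (c : C) u : cvg0 u -> cvg0 (fun n => c * u n).
Proof.
move=> u0; rewrite /cvg0; under eq_fun do rewrite Normc.normcM.
by have := cvgM (@cvg_cst _ (cn c) _ _ _) u0; rewrite mulr0; exact.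
Qed.

Lemma cvg0_ReIm u : (fun n => complex.Re (u n)) @ \oo --> (0 : R) ->
  (fun n => complex.Im (u n)) @ \oo --> (0 : R) -> cvg0 u.
Proof.
move=> u1 u2; apply: (cvg0_le (fun n => normc_le (u n))).
by rewrite -[X in _ --> X]addr0 -(normr0 R); apply: cvgD; exact: cvg_norm.
Qed.

Lemma cvg0V u (r : nat -> R) : r @ \oo --> +oo -> (forall n, r n <= cn (u n)) ->
  cvg0 (fun n => (u n)^-1).
Proof.
move=> ry ru; rewrite /cvg0; under eq_fun do rewrite Normc.normcV.
have nuy : (fun n => cn (u n)) @ \oo --> +oo.
  by apply: ger_cvgy ry; exact: nearW.
apply/gtr0_cvgV0 => //.
by move/cvgryPgt : nuy => /(_ 0).
Qed.

Lemma cvgy_natS_affine (k m : R) : 0 < k -> (fun n : nat => k * n.+1%:R + m) @ \oo --> +oo.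
Proof.
move=> k0; apply/cvgryPge => M.
near=> n.
rewrite -lerBlDr -ler_pdivrMl//.
apply: (@le_trans _ _ n%:R); last by rewrite ler_nat.
by near: n; exact: nbhs_infty_ger.
Unshelve. all: by end_near. Qed.

Lemma cvg_ln_ratio (b c : R) :
  (fun n : nat => ln (b ^+ 2 * n.+1%:R^-1 ^+ 2 + (1 - c * n.+1%:R^-1) ^+ 2)) @ \oo --> (0 : R).
Proof.
have e0 : (fun n : nat => n.+1%:R^-1 : R) @ \oo --> (0 : R) by exact: cvg_harmonic.
rewrite -(@ln1 R); apply: continuous_cvg; first exact: continuous_ln ltr01.
have cst (a : R) : (fun=> a : R) @ \oo --> a by exact: cvg_cst.
have h : (fun n : nat => 1 - c * n.+1%:R^-1) @ \oo --> (1 : R).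
  by have := cvgB (cst 1) (cvgM (cst c) e0); rewrite mulr0 subr0; apply.
have e2 : (fun n : nat => b ^+ 2 * (n.+1%:R^-1 * n.+1%:R^-1)) @ \oo --> (0 : R).
  by have := cvgM (cst (b ^+ 2)) (cvgM e0 e0); rewrite !mulr0; apply.
have := cvgD e2 (cvgM h h); rewrite add0r mulr1 => {}h.
by under eq_fun do rewrite !expr2; apply: h.
Qed.

End complex_limits.

(** * Signed iterated integrals in the chart *)

Section haar_fubini.
Context {R : realType}.
Local Notation G := (axb R).
Local Notation mu := (@lebesgue_measure R).

(** H is the inner integral in closed form. Its integrability comes out along with the formula,
    since the improper integral in a is evaluated under that hypothesis. *)
Lemma integral_haar_iterated (f : G -> R) (H : R -> R) :
  haar.-integrable setT (EFin \o f) ->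
  (forall a, 0 < a ->
    (\int[mu]_b (f (axb_of (a, b)) * a ^- 2)%:E)%E = (H a)%:E) ->
  mu.-integrable `]0, +oo[ (fun a => (H a)%:E) /\
  (\int[haar]_x (f x)%:E = \int[mu]_(a in `]0%R, +oo[) (H a)%:E)%E.
Proof.
move=> /integrableP[/measurable_EFinP mf fi] fH.
pose g (z : R * R) : R := f (axb_of z) * axb_dens z.
have mg : measurable_fun setT g.
  apply: measurable_funM; last exact: measurable_axb_dens.
  exact: measurableT_comp (@measurable_axb_of R).
have ge0 (h : G -> R) : measurable_fun setT h -> (forall x, 0 <= h x) ->
    (\int[haar]_x (h x)%:E = \int[mu \x mu]_z (h (axb_of z) * axb_dens z)%:E)%E.
  move=> mh h0.
  have := ge0_integral_density (m := (mu \x mu)%E) (n := haar) (@measurable_axb_of R)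
    (@measurable_axb_dens R) (@axb_dens_ge0 R) (@haarE R) (f := EFin \o h).
  by apply => [|x]; [exact/measurable_EFinP|rewrite lee_fin].
have ig : (mu \x mu)%E.-integrable setT (EFin \o g).
  apply/integrableP; split; first exact/measurable_EFinP.
  apply: le_lt_trans fi; rewrite (ge0 (fun x => `|f x|))//; last exact: measurableT_comp.
  apply: ge0_le_integral => //.
  - by apply/measurable_EFinP; exact: measurableT_comp.
  - apply/measurable_EFinP; apply: measurable_funM; last exact: measurable_axb_dens.
    by apply: measurableT_comp => //; exact: measurableT_comp (@measurable_axb_of R).
  - by move=> z _; rewrite lee_fin normrM (ger0_norm (axb_dens_ge0 z)).
have D0 : measurable (`]0, +oo[%classic : set R) by exact: measurable_itv.
have HE : ((fun a => (H a)%:E) \_ `]0, +oo[%classic =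
    (fun a => \int[mu]_b (EFin \o g) (a, b))%E).
  apply/funext => a; rewrite patchE; case: ifPn => [|].
    rewrite inE /= in_itv/= andbT => a0; rewrite -fH//.
    by apply: eq_integral => b _; rewrite /g /axb_dens /= a0.
  rewrite notin_setE /= in_itv/= andbT => /negP; rewrite -leNgt => a0.
  by rewrite integral0_eq// => b _; rewrite /g /axb_dens/= ltNge a0 mulr0.
split.
  apply/integrable_mkcond => //; rewrite HE.
  exact: integrable_fubini_F ig.
rewrite [RHS]integral_mkcond HE.
have -> : (\int[mu]_a \int[mu]_b (EFin \o g) (a, b) = \int[mu \x mu]_z (EFin \o g) z)%E.
  exact: (integral12_prod_meas1 ig).
(* The change of variables is known for nonnegative functions; the density, being nonnegative,
   passes through the maximum with 0, so positive and negative parts match on both sides. *)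
have pos (h : G -> R) : measurable_fun setT h ->
    (\int[haar]_x maxe (h x)%:E 0 =
     \int[mu \x mu]_z maxe (h (axb_of z) * axb_dens z)%:E 0)%E.
  move=> mh; transitivity (\int[haar]_x (Num.max (h x) 0)%:E)%E.
    by apply: eq_integral => x _; rewrite EFin_max.
  rewrite (ge0 (fun x => Num.max (h x) 0)).
  - apply: eq_integral => z _; rewrite -EFin_max; congr EFin.
    by rewrite maxr_pMl ?axb_dens_ge0// mul0r.
  - exact: measurable_maxr.
  - by move=> x; rewrite le_max lexx orbT.
rewrite integralE [RHS]integralE; congr (_ - _)%E.
  under eq_integral do rewrite funeposE; under [RHS]eq_integral do rewrite funeposE.
  exact: pos.
under eq_integral do rewrite funenegE -EFinN.
under [RHS]eq_integral do rewrite funenegE /= /g -mulNr.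
by apply: (pos (fun x => - f x)); exact: measurableT_comp.
Qed.

End haar_fubini.

Section reproducing.
Context {R : realType}.
Local Notation G := (axb R).
Local Notation C := R[i].
Local Notation cn := (@Normc.normc R).
Local Notation mu := (@lebesgue_measure R).
Local Notation fst_ x := (axb_val x).1.
Local Notation snd_ x := (axb_val x).2.

(** * The integral in b *)

Section inner.
Variables (A b c : R).
Hypotheses (A0 : 0 < A) (b0 : 0 < b).
Let w1 (s : R) : C := A -i* s.
Let w2 (s : R) : C := b +i* (s - c).
Let S : C := (A + b) -i* c.

Let S0 : S != 0.
Proof. by rewrite eq_complex /= negb_and (gt_eqF (addr_gt0 A0 b0)). Qed.
Let w10 s : w1 s != 0. Proof. by rewrite eq_complex /= negb_and (gt_eqF A0). Qed.
Let w20 s : w2 s != 0. Proof. by rewrite eq_complex /= negb_and (gt_eqF b0). Qed.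
Let SE s : S = w1 s + w2 s.
Proof. by apply/eqP; rewrite eq_complex /= eqxx/= addKr. Qed.

Let dw1 s : cderiv w1 (- 'i%C) s.
Proof.
split; first by rewrite /= oppr0; exact: is_derive_cst.
exact: (is_deriveN (is_derive_id s 1)).
Qed.
Let dw2 s : cderiv w2 'i%C s.
Proof.
split; first exact: is_derive_cst.
apply: (is_derive_ext _ _ (is_deriveB (is_derive_id s 1) (is_derive_cst c s 1))) => //.
by rewrite subr0.
Qed.

Let h s : C := (w1 s)^-1 * (w1 s)^-1 * ((w2 s)^-1 * (w2 s)^-1).
(** Because w1 + w2 = S is independent of s, 1/(w1 w2) = (1/w1 + 1/w2)/S. Squaring gives the partial
    fractions S^-2 (w1^-2 + w2^-2) + 2 S^-3 (w1^-1 + w2^-1), and F integrates them termwise. *)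
Let F s : C := S ^- 2 * (- 'i%C * (w1 s)^-1 + 'i%C * (w2 s)^-1) +
  2 * S ^- 3 * (clog A 0 s + (clog b c s)^*).

Let dF s : cderiv F (h s) s.
Proof.
have d1 := cderivV (w10 s) (dw1 s).
have d2 := cderivV (w20 s) (dw2 s).
have l1 := cderiv_clog 0 s A0.
have l2 := cderiv_conj (cderiv_clog c s b0).
have e2 : ((b -i* (s - c))^-1)^* = (w2 s)^-1.
  by rewrite fmorphV /w2; congr (_^-1); rewrite /= opprK.
rewrite e2 in l2.
have D1 := cderivD (cderivM (cderiv_cst (- 'i%C) s) d1) (cderivM (cderiv_cst 'i%C s) d2).
have D2 := cderivD l1 l2.
have := cderivD (cderivM (cderiv_cst (S ^- 2) s) D1) (cderivM (cderiv_cst (2 * S ^- 3) s) D2).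
rewrite subr0.
rewrite -/(w1 s) !mul0r !add0r.
have iE : 'i%C * 'i%C = -1 :> C by rewrite -expr2 sqr_i.
have e1 X : - 'i%C * (- - 'i%C * X) = X :> C.
  by rewrite opprK mulNr mulrA iE mulN1r opprK.
have e2' X : 'i%C * (- 'i%C * X) = X :> C.
  by rewrite mulNr mulrN mulrA iE mulN1r opprK.
rewrite e1 e2'.
have S0' : w1 s + w2 s != 0 by rewrite -SE.
have -> : S ^- 2 * (w1 s ^- 2 + w2 s ^- 2) + 2 * S ^- 3 * ((w1 s)^-1 + (w2 s)^-1) = h s.
  by rewrite (SE s) /h; field; rewrite S0' w10 w20.
exact.
Qed.

Let ch s : exists z, cderiv h z s.
Proof.
have d1 := cderivV (w10 s) (dw1 s).
have d2 := cderivV (w20 s) (dw2 s).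
by eexists; exact: (cderivM (cderivM d1 d1) (cderivM d2 d2)).
Qed.

Let normh s : cn (h s) <= b ^- 2 * (A ^+ 2 + s ^+ 2)^-1.
Proof.
rewrite /h !Normc.normcM !Normc.normcV -!invfM -!expr2 !normcE2 /= sqrrN mulrC !invfM.
have A2 : 0 < A ^+ 2 + s ^+ 2 by rewrite ltr_wpDr ?sqr_ge0// exprn_gt0.
apply: ler_pM; rewrite ?invr_ge0 ?addr_ge0 ?sqr_ge0//.
by rewrite -invfM -expr2 lef_pV2 ?posrE ?exprn_gt0 ?ltr_wpDr ?sqr_ge0 ?exprn_gt0// lerDl sqr_ge0.
Qed.

Let inth (k : C -> R) : (forall z, `|k z| <= cn z) -> continuous (fun s => k (h s)) ->
  mu.-integrable setT (fun s => (k (h s))%:E).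
Proof.
move=> kn kh; apply/integrableP; split.
  by apply/measurable_EFinP; exact: continuous_measurable_fun.
apply: (@le_lt_trans _ _ (\int[mu]_s ((b ^- 2)%:E * (A ^+ 2 + s ^+ 2)^-1%:E))%E).
  have mA : measurable_fun setT (fun s : R => (A ^+ 2 + s ^+ 2)^-1).
    by apply: measurable_funV; exact: measurable_funD.
  apply: ge0_le_integral => //.
  - apply/measurable_EFinP; apply: measurableT_comp => //.
    exact: continuous_measurable_fun.
  - by apply: emeasurable_funM => //; exact/measurable_EFinP.
  - by move=> s _; rewrite -EFinM lee_fin (le_trans (kn _)).
rewrite ge0_integralZl//.
- rewrite integral_sqrDsqrV//; apply: lte_mul_pinfty; rewrite ?lee_fin ?invr_ge0 ?sqr_ge0//.
  apply: lte_mul_pinfty; rewrite ?lee_fin ?invr_ge0 ?(ltW A0)//.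
  exact: integral_oneDsqrV_lty.
- apply/measurable_EFinP; by apply: measurable_funV; exact: measurable_funD.
- by move=> s _; rewrite lee_fin invr_ge0 addr_ge0 ?sqr_ge0.
- by rewrite lee_fin invr_ge0 sqr_ge0.
Qed.

Let cvg_atan (k m : R) : 0 < k ->
  (fun n : nat => atan (k * n.+1%:R + m)) @ \oo --> (pi / 2 : R).
Proof.
move=> k0; exact: (cvg_comp _ _ (cvgy_natS_affine m k0) (@cvgy_atan R)).
Qed.

Let ln_factor (e : R) (n : nat) : ln (b ^+ 2 + (n.+1%:R - e) ^+ 2) =
  ln (n.+1%:R ^+ 2) + ln (b ^+ 2 * n.+1%:R^-1 ^+ 2 + (1 - e * n.+1%:R^-1) ^+ 2).
Proof.
have N0 : (0 : R) < n.+1%:R by rewrite ltr0n.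
have p0 : 0 < b ^+ 2 * n.+1%:R^-1 ^+ 2 + (1 - e * n.+1%:R^-1) ^+ 2.
  by rewrite ltr_wpDr ?sqr_ge0// mulr_gt0 ?exprn_gt0 ?invr_gt0.
rewrite -lnM ?posrE ?exprn_gt0//; congr ln.
by field; rewrite gt_eqF.
Qed.

(** Each arctangent gains pi across the line. The logarithms of the first [clog] cancel exactly at N
    and -N, those of the second in the limit, once ln N^2 is factored out. The terms 1/w1 and 1/w2
    of F vanish at infinity, so 2 S^-3 times this 2 pi is the whole integral. *)
Let cvg_clog : cvg0 (fun n => clog A 0 n.+1%:R - clog A 0 (- n.+1%:R) +
  ((clog b c n.+1%:R)^* - (clog b c (- n.+1%:R))^*) - (2 * pi)%:C).
Proof.
have Ai : 0 < A^-1 by rewrite invr_gt0.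
have bi : 0 < b^-1 by rewrite invr_gt0.
apply: cvg0_ReIm.
  have hl : (fun n : nat => atan (A^-1 * n.+1%:R + 0) + atan (A^-1 * n.+1%:R + 0) +
      (atan (b^-1 * n.+1%:R - b^-1 * c) + atan (b^-1 * n.+1%:R + b^-1 * c)) - 2 * pi)
      @ \oo --> (pi / 2 + pi / 2 + (pi / 2 + pi / 2) - 2 * pi : R).
    apply: cvgB; last exact: cvg_cst.
    by apply: cvgD; apply: cvgD; exact: cvg_atan.
  rewrite (_ : _ - 2 * pi = 0) in hl; last by field.
  apply: cvg_trans hl; apply: near_eq_cvg; apply: nearW => n /=.
  rewrite !subr0 addr0 !(mulrC _^-1) -!mulrBl -mulrDl mulNr atanN opprK.
  by rewrite -opprD mulNr atanN opprK.
have hl : (fun n : nat =>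
    2^-1 * (ln (b ^+ 2 * n.+1%:R^-1 ^+ 2 + (1 - (- c) * n.+1%:R^-1) ^+ 2) -
            ln (b ^+ 2 * n.+1%:R^-1 ^+ 2 + (1 - c * n.+1%:R^-1) ^+ 2)))
    @ \oo --> (2^-1 * (0 - 0) : R).
  by apply: cvgM; [exact: cvg_cst|apply: cvgB; exact: cvg_ln_ratio].
rewrite subrr mulr0 in hl.
apply: cvg_trans hl; apply: near_eq_cvg; apply: nearW => n /=.
rewrite !subr0 sqrrN subrr add0r opprK -[- n.+1%:R - c]opprD sqrrN.
have e2 := ln_factor (- c) n; rewrite opprK in e2.
by rewrite e2 ln_factor; ring.
Qed.

Let cvg_inv1 (e : R) : (e = 1 \/ e = -1) -> cvg0 (fun n => (w1 (e * n.+1%:R))^-1).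
Proof.
move=> e1; apply: (cvg0V (r := fun n => 1 * n.+1%:R + 0)); first exact: cvgy_natS_affine.
move=> n; apply: le_trans (le_Im_normc _); rewrite /= normrN.
by case: e1 => ->; rewrite ?mulN1r ?normrN mul1r ger0_norm// ?addr0.
Qed.

Let cvg_inv2 (e : R) : (e = 1 \/ e = -1) -> cvg0 (fun n => (w2 (e * n.+1%:R))^-1).
Proof.
move=> e1; apply: (cvg0V (r := fun n => 1 * n.+1%:R + (- `|c|))); first exact: cvgy_natS_affine.
move=> n; apply: le_trans (le_Im_normc _); rewrite /= mul1r.
have -> : n.+1%:R - `|c| = `|e * n.+1%:R| - `|c|.
  by case: e1 => ->; rewrite ?mulN1r ?normrN ?mul1r normr_nat.
exact: lerB_dist.
Qed.

Let cvgF : cvg0 (fun n => F n.+1%:R - F (- n.+1%:R) - (4 * pi)%:C * S ^- 3).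
Proof.
have i1 := cvg_inv1 (or_introl erefl).
have i1' := cvg_inv1 (or_intror erefl).
have i2 := cvg_inv2 (or_introl erefl).
have i2' := cvg_inv2 (or_intror erefl).
have := cvg0D (cvg0D (cvg0D (cvg0Z (- (S ^- 2 * 'i%C)) i1) (cvg0Z (S ^- 2 * 'i%C) i2))
   (cvg0D (cvg0Z (S ^- 2 * 'i%C) i1') (cvg0Z (- (S ^- 2 * 'i%C)) i2')))
   (cvg0Z (2 * S ^- 3) cvg_clog).
congr cvg0; apply/funext => n.
rewrite !mul1r !mulN1r /F !rmorphM !rmorph_nat.
set a1 := (w1 _)^-1; set a2 := (w1 _)^-1; set a3 := (w2 _)^-1; set a4 := (w2 _)^-1.
set T := S ^- 2; set T3 := S ^- 3.
by ring.
Qed.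

(** The factor z stands under the integral because real and imaginary parts are integrated
    separately and multiplication by z mixes them. *)
Lemma integral_F2_inner (z : C) :
  ((\int[mu]_s (complex.Re (z * ((A -i* s) ^- 2 * (b +i* (s - c)) ^- 2)))%:E)%E =
     (complex.Re (z * ((4 * pi)%:C * S ^- 3)))%:E) /\
  ((\int[mu]_s (complex.Im (z * ((A -i* s) ^- 2 * (b +i* (s - c)) ^- 2)))%:E)%E =
     (complex.Im (z * ((4 * pi)%:C * S ^- 3)))%:E).
Proof.
have hE s : (A -i* s) ^- 2 * (b +i* (s - c)) ^- 2 = h s by rewrite /h -!invfM -!expr2.
under eq_integral do rewrite hE.
under [X in _ /\ X = _]eq_integral do rewrite hE.
have dz s : exists w, cderiv (fun s => z * h s) w s.
  by have [w hw] := ch s; eexists; exact: (cderivM (cderiv_cst z s) hw).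
have [cR cI] : continuous (fun s => complex.Re (h s)) /\ continuous (fun s => complex.Im (h s)).
  by split => s; have [w /cderiv_continuous[]] := ch s.
have iR := inth (@le_Re_normc R) cR; have iI := inth (@le_Im_normc R) cI.
have iZ (k : R) (f : R -> R) : mu.-integrable setT (fun s => (f s)%:E) ->
    mu.-integrable setT (fun s => (k * f s)%:E).
  by move=> fi; under eq_fun do rewrite EFinM; exact: integrableZl.
apply: (@cintegral_exhaust _ setT (fun n => - n.+1%:R) (fun n => n.+1%:R)
    (fun s => z * F s) (fun s => z * h s) (z * ((4 * pi)%:C * S ^- 3))) => //.
- by move=> n; apply: (@lt_trans _ _ 0); rewrite ?oppr_lt0.
- move=> x _; near=> n; rewrite -ler_norml.
  apply: (@le_trans _ _ n%:R); last by rewrite ler_nat.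
  by near: n; exact: nbhs_infty_ger.
- move=> s _; have := cderivM (cderiv_cst z s) (dF s); by rewrite mul0r add0r.
- under eq_fun do rewrite ReM EFinB; apply: integrableB => //; exact: iZ.
- under eq_fun do rewrite ImM EFinD; apply: integrableD => //; exact: iZ.
- have := cvg0Z z cvgF; rewrite /cvg0 => hz.
  by under eq_fun do rewrite -!mulrBr; exact: hz.
Unshelve. all: by end_near. Qed.

End inner.
End reproducing.

Section reproducing_kernel.
Context {R : realType}.
Local Notation G := (axb R).
Local Notation C := R[i].
Local Notation cn := (@Normc.normc R).
Local Notation mu := (@lebesgue_measure R).
Local Notation fst_ x := (axb_val x).1.
Local Notation snd_ x := (axb_val x).2.

(** * The integral in a *)

Section outer.
Variables (c d : R).
Let D : C := (1 + c ^+ 2) -i* (c * d).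
Let W (a : R) : C := (2 * a ^+ 2)%:C + D.

Let ReW a : complex.Re (W a) = 2 * a ^+ 2 + (1 + c ^+ 2). Proof. by []. Qed.

Let W_ge1 a : 1 <= cn (W a).
Proof.
apply: le_trans (le_Re_normc _); apply: le_trans (ler_norm _); rewrite ReW.
by have := sqr_ge0 a; have := sqr_ge0 c; lra.
Qed.

Let W0 a : W a != 0.
Proof. by rewrite -normc_eq0 gt_eqF// (lt_le_trans _ (W_ge1 a)). Qed.

Let normWV a : cn (W a)^-1 <= 1.
Proof. by rewrite Normc.normcV invf_le1// (lt_le_trans _ (W_ge1 a)). Qed.

Let WD : D = W 0.
Proof. by rewrite /W expr0n mulr0 add0r. Qed.

Let K : R := pi * c ^+ 2.
(** The integral in b leaves K a W^-3 with W = 2 a^2 + D. As W' = 4 a, this has the primitive -(K/8)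
    W^-2, which vanishes at infinity and tends to -(K/8) D^-2 at 0. *)
Let F (a : R) : C := - (K / 8)%:C * ((W a)^-1 * (W a)^-1).
Let h (a : R) : C := K%:C * (a%:C * ((W a)^-1 * (W a)^-1 * (W a)^-1)).

Let dW a : cderiv W (4 * a)%:C a.
Proof.
have := cderivD (cderivM (cderiv_cst 2 a) (cderivM (cderiv_id a) (cderiv_id a))) (cderiv_cst D a).
rewrite mul0r add0r addr0 mul1r mulr1.
have -> : 2 * (a%:C + a%:C) = (4 * a)%:C :> C by rewrite rmorphM rmorph_nat; ring.
congr cderiv; apply/funext => s; rewrite /W rmorphM rmorphXn rmorph_nat.
by rewrite expr2.
Qed.

Let dF a : cderiv F (h a) a.
Proof.
have d1 := cderivV (W0 a) (dW a).
have := cderivM (cderiv_cst (- (K / 8)%:C) a) (cderivM d1 d1).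
congr cderiv; rewrite /h mul0r add0r.
have -> : (K / 8)%:C = K%:C / 8 by rewrite rmorphM fmorphV rmorph_nat.
have -> : (4 * a)%:C = 4 * a%:C :> C by rewrite rmorphM rmorph_nat.
field; exact: W0.
Qed.

Let ch a : exists z, cderiv h z a.
Proof.
have d1 := cderivV (W0 a) (dW a).
by eexists; apply: (cderivM (cderiv_cst K%:C a) (cderivM (cderiv_id a) (cderivM (cderivM d1 d1) d1))).
Qed.

Let cvg0M1 (u v : nat -> C) (M : R) : cvg0 u -> (forall n, cn (v n) <= M) ->
  cvg0 (fun n => u n * v n).
Proof.
move=> u0 v1.
have uM : (fun n => cn (u n) * M) @ \oo --> (0 * M : R) by apply: cvgM => //; exact: cvg_cst.
rewrite mul0r in uM; apply: (cvg0_le _ uM) => n.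
by rewrite Normc.normcM ler_wpM2l// normc_ge0.
Qed.

Let cvgF : cvg0 (fun n => F n.+2%:R - F n.+2%:R^-1 - (K / 8)%:C * D ^- 2).
Proof.
have h1 : cvg0 (fun n => (W n.+2%:R)^-1).
  apply: (cvg0V (r := fun n => 1 * n.+1%:R + 0)); first exact: cvgy_natS_affine.
  move=> n; apply: le_trans (le_Re_normc _); apply: le_trans (ler_norm _); rewrite ReW.
  rewrite mul1r addr0 -[n.+2%:R]natr1.
  have := sqr_ge0 c; have := ler0n R n.+1; have := sqr_ge0 (n.+1%:R : R).
  set N := (n.+1%:R : R); rewrite sqrrD1 => h2 h1 h0. nra.
have h2 : cvg0 (fun n => (W n.+2%:R^-1)^-1 - D^-1).
  have e0 : (fun n : nat => 2 * n.+1%:R^-1 : R) @ \oo --> (2 * 0 : R).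
    by apply: cvgM; [exact: cvg_cst|exact: cvg_harmonic].
  rewrite mulr0 in e0; apply: (cvg0_le _ e0) => n.
  set e := n.+2%:R^-1 : R.
  have -> : (W e)^-1 - D^-1 = - ((2 * e ^+ 2)%:C * ((W e)^-1 * (W 0)^-1)).
    have DW0 : D != 0 by rewrite WD.
    rewrite -WD; have -> : (2 * e ^+ 2)%:C = W e - D by rewrite /W addrK.
    by field; rewrite W0 DW0.
  rewrite normc_opp !Normc.normcM normcR.
  have e0' : 0 < e by rewrite invr_gt0.
  have en : e <= n.+1%:R^-1 by rewrite lef_pV2 ?posrE// ler_nat.
  have e1 : e <= 1 by rewrite invf_le1// ler1n.
  have e2 : 0 <= 2 * e ^+ 2 by apply: mulr_ge0 => //; exact: sqr_ge0.
  rewrite ger0_norm//.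
  apply: (@le_trans _ _ (2 * e ^+ 2)); last first.
    by rewrite ler_pM2l// expr2 (le_trans _ en)// ler_piMl// ltW.
  rewrite ler_piMr//.
  by rewrite mulr_ile1 ?normc_ge0.
(* At the lower end W^-2 - D^-2 is factored as (W^-1 - D^-1) (W^-1 + D^-1), whose second factor has
   modulus at most 2. *)
have := cvg0D (cvg0Z (- (K / 8)%:C) (cvg0M1 h1 (fun n => normWV n.+2%:R)))
  (cvg0Z (K / 8)%:C (@cvg0M1 _ (fun n => (W n.+2%:R^-1)^-1 + D^-1) 2 h2 _)).
have b2 n : cn ((W n.+2%:R^-1)^-1 + D^-1) <= 2.
  by apply: (le_trans (normcD _ _)); rewrite WD (natrD _ 1 1) lerD.
move=> /(_ b2); congr cvg0; apply/funext => n.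
by rewrite /F -exprVn; ring.
Qed.

Lemma integral_F2_outer (iR : mu.-integrable `]0, +oo[ (fun a => (complex.Re (h a))%:E))
   (iI : mu.-integrable `]0, +oo[ (fun a => (complex.Im (h a))%:E)) :
  (\int[mu]_(a in `]0%R, +oo[) (complex.Re (h a))%:E = (complex.Re ((K / 8)%:C * D ^- 2))%:E)%E /\
  (\int[mu]_(a in `]0%R, +oo[) (complex.Im (h a))%:E = (complex.Im ((K / 8)%:C * D ^- 2))%:E)%E.
Proof.
apply: (@cintegral_exhaust _ `]0, +oo[%classic (fun n => n.+2%:R^-1) (fun n => n.+2%:R) F h) => //.
- by move=> n; apply: (@lt_trans _ _ 1); rewrite ?invf_lt1 ?ltr1n.
- move=> n x /=; rewrite !in_itv/= andbT => /andP[+ _]; apply: lt_le_trans.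
  by rewrite invr_gt0.
- move=> x /=; rewrite in_itv/= andbT => x0; near=> n; apply/andP; split.
    rewrite -[leRHS]invrK lef_pV2 ?posrE ?invr_gt0//.
    apply: (@le_trans _ _ n%:R); last by rewrite ler_nat ltnW.
    by near: n; exact: nbhs_infty_ger.
  apply: (@le_trans _ _ n%:R); last by rewrite ler_nat ltnW.
  by near: n; exact: nbhs_infty_ger.
Unshelve. all: by end_near. Qed.

End outer.

(** For y = (a, s) the base of F2 at y^-1 x is 1/c times (c^2/a + a) + i (s - c d/a). This brings
    the integrand to the form of [integral_F2_inner], with a + 1/a, c^2/a + a and c d/a as
    parameters. *)
Lemma F2_prod_chart (x : G) (a s : R) (c := fst_ x) (d := snd_ x) : 0 < a ->
  F2 (axb_of (a, s)) * F2 ((axb_of (a, s))^-1 * x)%g =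
  (c ^+ 2 / 4)%:C *
  (((a + a^-1) -i* s) ^- 2 * ((c ^+ 2 / a + a) +i* (s - c * d / a)) ^- 2).
Proof.
move=> a0; have c0 : 0 < c := fst_gt0 x.
rewrite !F2E.
have -> : F2_denom (axb_of (a, s)) = (a + a^-1) -i* s by rewrite /F2_denom axb_ofK.
have -> : F2_denom ((axb_of (a, s))^-1 * x)%g =
    c%:C^-1 * ((c ^+ 2 / a + a) +i* (s - c * d / a)).
  apply: (mulfI (x := c%:C)); first by rewrite eq_complex /= (gt_eqF c0).
  rewrite mulrA divff ?mul1r; last by rewrite eq_complex /= (gt_eqF c0).
  rewrite /F2_denom axb_valM axb_valV axb_ofK//= -/c -/d.
  apply/eqP; rewrite eq_complex /=; apply/andP; split; apply/eqP; field; by rewrite !gt_eqF.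
set w1 := _ -i* s; set w2 := _ +i* _.
have -> : (c%:C^-1 * w2) ^- 2 = c%:C ^+ 2 * w2 ^- 2.
  by rewrite exprMn invfM -exprVn invrK.
have -> : (c ^+ 2 / 4)%:C = c%:C ^+ 2 / 4.
  by rewrite rmorphM fmorphV rmorphXn rmorph_nat.
have -> : (4 : C)^-1 = 2^-1 * 2^-1 by rewrite -invfM -natrM.
by ring.
Qed.

(** The AM-GM bound with exponent 1 gives |F2(y^-1 x)| <= a_y / a_x, which leaves the weighted
    integral with s = 1. *)
Lemma cintegrable_F2_F2 (x : G) : cintegrable (fun y => F2 y * F2 (y^-1 * x)%g).
Proof.
have mF2 : cmeasurable (@F2 R) by split; [exact: measurable_Re_F2|exact: measurable_Im_F2].
have fx := fst_gt0 x.
apply: (@le_cintegrable _ _ (fun y => (fst_ x)^-1 * (fst_ y `^ 1 * cn (F2 y)))).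
- apply: cmeasurableM => //; apply: cmeasurable_comp mF2 _.
  by apply: measurable_axbM => //; exact: measurable_axbV.
- apply: measurable_funM => //; apply: measurable_funM; last exact: measurable_normc_F2.
  exact: measurable_fst_powR.
- move=> y; rewrite Normc.normcM mulrC mulrA ler_wpM2r ?normc_ge0// normc_F2_sym.
  have := @normc_F2_le_powR R (x^-1 * y)%g 1; rewrite ler01 ler1n => /(_ isT).
  rewrite !powRr1 ?(ltW (fst_gt0 _))//.
  by rewrite axb_valM axb_valV.
- under eq_integral do rewrite EFinM.
  rewrite ge0_integralZl//.
  + by apply: lte_mul_pinfty; rewrite ?lee_fin ?invr_ge0 ?(ltW fx)// powR_F2_lty// ltr01 lexx.
  + apply/measurable_EFinP; apply: measurable_funM; last exact: measurable_normc_F2.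
    exact: measurable_fst_powR.
  + by move=> y _; rewrite lee_fin mulr_ge0 ?powR_ge0 ?normc_ge0.
  + by rewrite lee_fin invr_ge0 ltW.
Qed.

(** For x = (c, d), the integral in b is pi c^2 a W(a)^-3 and the one in a then gives (pi c^2 / 8)
    D^-2, where D = (1 + c^2) - i c d is c times the base of F2 at x. So c cancels and (pi / 8)
    times the base to the power -2 remains, that is (pi / 4) F2. *)
Theorem convolution_F2_F2 (x : G) : convolution F2 F2 x = (pi / 4)%:C * F2 x.
Proof.
set c := fst_ x; set d := snd_ x; have c0 : 0 < c := fst_gt0 x.
pose K : R := pi * c ^+ 2; pose W (a : R) : C := (2 * a ^+ 2)%:C + ((1 + c ^+ 2) -i* (c * d)).
pose h (a : R) : C := K%:C * (a%:C * ((W a)^-1 * (W a)^-1 * (W a)^-1)).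
pose k y : C := F2 y * F2 (y^-1 * x)%g.
have [kR kI] := cintegrable_ReIm (cintegrable_F2_F2 x).
have inner (a : R) : 0 < a ->
  (\int[mu]_s (complex.Re (k (axb_of (a, s))) * a ^- 2)%:E = (complex.Re (h a))%:E)%E /\
  (\int[mu]_s (complex.Im (k (axb_of (a, s))) * a ^- 2)%:E = (complex.Im (h a))%:E)%E.
  move=> a0; have ai : 0 < a^-1 by rewrite invr_gt0.
  have A0 : 0 < a + a^-1 by rewrite addr_gt0.
  have B0 : 0 < c ^+ 2 / a + a by rewrite addr_gt0 ?divr_gt0 ?exprn_gt0.
  have hE : h a = (c ^+ 2 / 4 / a ^+ 2)%:C *
      ((4 * pi)%:C * (((a + a^-1) + (c ^+ 2 / a + a)) -i* (c * d / a)) ^- 3).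
    have -> : ((a + a^-1) + (c ^+ 2 / a + a)) -i* (c * d / a) = a%:C^-1 * W a.
      have aC : a%:C != 0 :> C by rewrite eq_complex /= (gt_eqF a0).
      apply: (mulfI aC); rewrite mulrA divff// mul1r.
      by apply/eqP; rewrite eq_complex /=; apply/andP; split; apply/eqP; field; rewrite gt_eqF.
    have -> : (a%:C^-1 * W a) ^- 3 = a%:C ^+ 3 * (W a)^-1 ^+ 3.
      by rewrite exprMn invfM -exprVn invrK exprVn.
    have -> : (c ^+ 2 / 4 / a ^+ 2)%:C = c%:C ^+ 2 / 4 / a%:C ^+ 2.
      by rewrite !rmorphM !fmorphV !rmorphXn rmorph_nat.
    have -> : (4 * pi)%:C = 4 * pi%:C :> C by rewrite rmorphM rmorph_nat.
    rewrite /h; have -> : K%:C = pi%:C * c%:C ^+ 2 by rewrite rmorphM rmorphXn.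
    have aC : a%:C != 0 :> C by rewrite eq_complex /= (gt_eqF a0).
    by set w := (W a)^-1; field.
  rewrite hE.
  have [<- <-] := integral_F2_inner (c * d / a) A0 B0 (c ^+ 2 / 4 / a ^+ 2)%:C.
  have e s : (c ^+ 2 / 4 / a ^+ 2)%:C * (((a + a^-1) -i* s) ^- 2 *
      ((c ^+ 2 / a + a) +i* (s - c * d / a)) ^- 2) = (a ^- 2)%:C * k (axb_of (a, s)).
    rewrite /k F2_prod_chart// -/c -/d mulrA; congr (_ * _).
    by rewrite -rmorphM; congr (_%:C); rewrite mulrC.
  split; apply: eq_integral => s _; rewrite e.
    by rewrite ReM /= mul0r subr0 mulrC.
  by rewrite ImM /= mul0r addr0 mulrC.
have [iR eR] := integral_haar_iterated kR (fun a a0 => proj1 (inner a a0)).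
have [iI eI] := integral_haar_iterated kI (fun a a0 => proj2 (inner a a0)).
have [oR oI] := integral_F2_outer iR iI.
have -> : (pi / 4)%:C * F2 x = (K / 8)%:C * ((1 + c ^+ 2) -i* (c * d)) ^- 2.
  rewrite F2E.
  have cC : c%:C != 0 :> C by rewrite eq_complex /= (gt_eqF c0).
  have -> : (1 + c ^+ 2) -i* (c * d) = c%:C * F2_denom x.
    rewrite /F2_denom -/c -/d; apply/eqP; rewrite eq_complex /=; apply/andP.
    by split; apply/eqP; field; rewrite gt_eqF.
  have -> : (pi / 4)%:C = pi%:C / 4 :> C by rewrite rmorphM fmorphV rmorph_nat.
  have -> : (K / 8)%:C = pi%:C * c%:C ^+ 2 / 8 :> C.
    by rewrite rmorphM fmorphV rmorph_nat rmorphM rmorphXn.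
  field.
  by rewrite cC F2_denom_neq0.
apply/eqP; rewrite eq_complex; apply/andP; split; apply/eqP.
  by rewrite /convolution /cintegral /= /Rintegral eR oR.
by rewrite /convolution /cintegral /= /Rintegral eI oI.
Qed.

End reproducing_kernel.

(** * The range of convolution by F2 *)

Section Lp_range.
Context {R : realType}.
Local Notation G := (axb R).
Local Notation C := R[i].
Local Notation cn := (@Normc.normc R).
Variable p : R.
Hypothesis p1 : 1 < p.
Local Notation Np g := (Lnorm haar p%:E (EFin \o g)).
Local Notation k := (pi / 4 : R).
Implicit Types (f h : G -> C) (g : G -> R).

Let p0 : 0 < p. Proof. exact: lt_trans p1. Qed.

Lemma Lnorm_ler g1 g2 : measurable_fun setT g1 -> measurable_fun setT g2 ->
  (forall x, 0 <= g1 x) -> (forall x, g1 x <= g2 x) -> (Np g1 <= Np g2)%E.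
Proof.
move=> m1 m2 g10 g12; have g20 x : 0 <= g2 x by exact: le_trans (g12 x).
rewrite !Lnorm_ge0_fun//.
have inI (g : G -> R) : (\int[haar]_y (g y `^ p)%:E)%E \in `[0%E, +oo%E].
  rewrite in_itv/= leey andbT.
  by apply: integral_ge0 => y _; rewrite lee_fin powR_ge0.
apply: gt0_ler_poweR; rewrite ?invr_ge0 ?(ltW p0)//.
apply: ge0_le_integral => //.
- by move=> y _; rewrite lee_fin powR_ge0.
- by apply/measurable_EFinP; exact: measurableT_comp (measurable_powR _) m1.
- by apply/measurable_EFinP; exact: measurableT_comp (measurable_powR _) m2.
- by move=> y _; rewrite lee_fin ge0_ler_powR ?(ltW p0)// nnegrE.
Qed.

Lemma Lnorm_scale (c : R) g : 0 <= c -> measurable_fun setT g -> (forall x, 0 <= g x) ->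
  (Np (fun x => (c * g x)%R) = c%:E * Np g)%E.
Proof.
move=> c0 mg g0; rewrite !Lnorm_ge0_fun//; last by move=> x; rewrite mulr_ge0.
have -> : (\int[haar]_y ((c * g y) `^ p)%:E = (c `^ p)%:E * \int[haar]_y (g y `^ p)%:E)%E.
  rewrite -ge0_integralZl//.
  - by apply: eq_integral => y _; rewrite powRM.
  - by apply/measurable_EFinP; exact: measurableT_comp (measurable_powR _) mg.
  - by move=> y _; rewrite lee_fin powR_ge0.
  - by rewrite lee_fin powR_ge0.
rewrite poweRM ?lee_fin ?powR_ge0//; last first.
  by apply: integral_ge0 => y _; rewrite lee_fin powR_ge0.
by rewrite poweR_EFin -powRrM mulfV ?gt_eqF// powRr1.
Qed.

Lemma Lnorm_triangle g1 g2 : measurable_fun setT g1 -> measurable_fun setT g2 ->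
  (Np (fun x => (g1 x + g2 x)%R) <= Np g1 + Np g2)%E.
Proof. by move=> m1 m2; exact: (minkowski_EFin haar m1 m2 (ltW p1)). Qed.

Lemma LpP f : Lp p f <-> cmeasurable f /\ (Np (fun x => cn (f x)) < +oo)%E.
Proof. by split => [[]|[[]]]. Qed.

Lemma absconv_fin g x : measurable_fun setT g -> (forall y, 0 <= g y) ->
  (Np g < +oo)%E -> (absconv g x < +oo)%E.
Proof.
move=> mg g0 ng; apply: (le_lt_trans (absconv_le_Lnorm p1 x mg g0)).
by apply: lte_mul_pinfty => //; rewrite lee_fin schur_cst_ge0.
Qed.

Definition rabsconv g x : R := fine (absconv g x).

Lemma rabsconvE g x : measurable_fun setT g -> (forall y, 0 <= g y) ->
  (Np g < +oo)%E -> (rabsconv g x)%:E = absconv g x.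
Proof.
move=> mg g0 ng; rewrite fineK// ge0_fin_numE ?absconv_ge0//; exact: absconv_fin.
Qed.

Lemma rabsconv_ge0 g x : (forall y, 0 <= g y) -> 0 <= rabsconv g x.
Proof. by move=> g0; rewrite fine_ge0// absconv_ge0. Qed.

Lemma measurable_rabsconv g : measurable_fun setT g -> (forall y, 0 <= g y) ->
  measurable_fun setT (rabsconv g).
Proof.
by move=> mg g0; apply: (measurableT_comp (f := fine)) => //; exact: measurable_absconv.
Qed.

Lemma Lnorm_rabsconv g : measurable_fun setT g -> (forall y, 0 <= g y) ->
  (Np g < +oo)%E -> (Np (rabsconv g) <= (schur_cst p)%:E * Np g)%E.
Proof.
move=> mg g0 ng; apply: Lnorm_absconv_le => //.
- exact: measurable_rabsconv.
- by move=> x; exact: rabsconv_ge0.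
- by move=> x; rewrite rabsconvE.
Qed.

Lemma Lnorm_rabsconv_fin g : measurable_fun setT g -> (forall y, 0 <= g y) ->
  (Np g < +oo)%E -> (Np (rabsconv g) < +oo)%E.
Proof.
move=> mg g0 ng; apply: (le_lt_trans (Lnorm_rabsconv mg g0 ng)).
by apply: lte_mul_pinfty => //; rewrite lee_fin schur_cst_ge0.
Qed.

Lemma cmeasurable_F2 : cmeasurable (@F2 R).
Proof. by split; [exact: measurable_Re_F2|exact: measurable_Im_F2]. Qed.

Lemma cmeasurable_F2_l x : cmeasurable (fun y : G => F2 (y^-1 * x)%g).
Proof.
apply: cmeasurable_comp cmeasurable_F2 _.
by apply: measurable_axbM => //; exact: measurable_axbV.
Qed.

Lemma cmeasurable_F2_r y : cmeasurable (fun x : G => F2 (y^-1 * x)%g).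
Proof. by apply: cmeasurable_comp cmeasurable_F2 _; exact: measurable_axbM. Qed.

Lemma cmeasurable_F2_2 : cmeasurable (fun z : G * G => F2 (z.1^-1 * z.2)%g).
Proof.
apply: cmeasurable_comp cmeasurable_F2 _.
by apply: measurable_axbM => //; exact: measurable_axbV.
Qed.

(** The identity at every point, not almost every one, selects a single representative;
    [LpF2_in_range] shows that it is the continuous one. *)
Definition in_range h := Lp p h /\ forall x, convolution h F2 x = k%:C * h x.

Lemma convolution_ltrans_F2 z x :
  convolution (fun y => F2 (z^-1 * y)%g) F2 x = k%:C * F2 (z^-1 * x)%g :> C.
Proof.
rewrite -convolution_F2_F2 /convolution.
rewrite -(@cintegral_shift _ z).
  by apply: eq_cintegral => y; rewrite invgM !mulgA mulVg mul1g.
by apply: cmeasurableM; [exact: cmeasurable_F2_r|exact: cmeasurable_F2_l].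
Qed.

Lemma cintegrable_ltrans_F2_F2 z x :
  cintegrable (fun y : G => F2 (z^-1 * y)%g * F2 (y^-1 * x)%g).
Proof.
split.
  by apply: cmeasurableM; [exact: cmeasurable_F2_r|exact: cmeasurable_F2_l].
have [mc] := cintegrable_F2_F2 (z^-1 * x)%g.
have m : measurable_fun setT (fun y => (cn (F2 y * F2 (y^-1 * (z^-1 * x))%g))%:E).
  by apply/measurable_EFinP; exact: measurable_normc.
rewrite -(ge0_haar_left_invariant z^-1%g m); last by move=> y; rewrite lee_fin normc_ge0.
by under eq_integral do rewrite invgM invgK !mulgA mulgK.
Qed.

Lemma dominated_cintegrable (H : G -> R) f x : measurable_fun setT H ->
  (forall y, 0 <= H y) -> (Np H < +oo)%E -> cmeasurable f ->
  (forall y, cn (f y) <= H y * cn (F2 (y^-1 * x)%g)) ->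
  cintegrable f /\ cn (cintegral f) <= 2 * rabsconv H x.
Proof.
move=> mH H0 nH mf fH.
have le : (\int[haar]_y (cn (f y))%:E <= absconv H x)%E.
  apply: ge0_le_integral => //.
  - by move=> y _; rewrite lee_fin normc_ge0.
  - by apply/measurable_EFinP; exact: measurable_normc.
  - by apply/measurable_EFinP; apply: measurable_funM => //; exact: measurable_normc_F2_l.
  - by move=> y _; rewrite lee_fin.
split; first by split => //; apply: (le_lt_trans le); exact: absconv_fin.
rewrite -lee_fin; apply: (le_trans (normc_cintegral mf)).
by rewrite EFinM rabsconvE// lee_wpmul2l.
Qed.

(** * Integral operators dominated by |F2| *)

Section kernel_operator.
Variables (H : G -> R) (K : G * G -> C).
Hypotheses (mH : measurable_fun setT H) (H0 : forall y, 0 <= H y) (nH : (Np H < +oo)%E).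
Hypothesis mK : cmeasurable K.
Hypothesis KH : forall z x, cn (K (z, x)) <= H z * cn (F2 (z^-1 * x)%g).

Let s x := cintegral (fun z => K (z, x)).

Let mKx x : cmeasurable (fun z => K (z, x)).
Proof. by apply: cmeasurable_comp mK _; exact: measurable_pair2. Qed.

Lemma kernel_cintegrable x : cintegrable (fun z => K (z, x)).
Proof. by have [] := dominated_cintegrable mH H0 nH (mKx x) (KH ^~ x). Qed.

Lemma normc_kernel x : cn (s x) <= 2 * rabsconv H x.
Proof. by have [] := dominated_cintegrable mH H0 nH (mKx x) (KH ^~ x). Qed.

Lemma cmeasurable_kernel : cmeasurable s.
Proof. exact: cmeasurable_cintegral. Qed.

Lemma Lp_norm_kernel : (Lp_norm p s <= (2 * schur_cst p)%:E * Np H)%E.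
Proof.
have mr := measurable_rabsconv mH H0.
apply: (@le_trans _ _ (Np (fun x => 2 * rabsconv H x)%R)).
  apply: Lnorm_ler.
  - exact: measurable_normc cmeasurable_kernel.
  - exact: measurable_funM.
  - by move=> x; exact: normc_ge0.
  - exact: normc_kernel.
rewrite Lnorm_scale//; last by move=> x; exact: rabsconv_ge0.
by rewrite EFinM -muleA lee_wpmul2l// Lnorm_rabsconv.
Qed.

Lemma Lp_kernel : Lp p s.
Proof.
apply/LpP; split; first exact: cmeasurable_kernel.
apply: (le_lt_trans Lp_norm_kernel); apply: lte_mul_pinfty => //.
by rewrite lee_fin mulr_ge0// schur_cst_ge0.
Qed.

(** Every slice K(z, .) is an eigenfunction of convolution by F2, and Fubini transfers this to the
    superposition. Absolute convergence holds because the inner integral over z is at most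
    [rabsconv H], which is again in L^p and can be convolved with |F2| once more. *)
Lemma in_range_kernel :
  (forall z x, convolution (fun y => K (z, y)) F2 x = k%:C * K (z, x)) -> in_range s.
Proof.
move=> Krep; split; first exact: Lp_kernel.
move=> x; rewrite /convolution /s.
have mF := measurable_normc_F2_l x.
have mT : cmeasurable (fun yz : G * G => F2 (yz.1^-1 * x)%g * K (yz.2, yz.1)).
  apply: cmeasurableM; first exact: (cmeasurable_comp (cmeasurable_F2_l x)).
  apply: (@cmeasurable_comp _ _ _ _ _ K (fun z : G * G => (z.2, z.1)) mK).
  exact: measurable_fun_pair.
have mH1 := measurable_rabsconv mH H0.
have H10 y : 0 <= rabsconv H y by exact: rabsconv_ge0.
have nH1 := Lnorm_rabsconv_fin mH H0 nH.
have inner y : (\int[haar]_z (cn (F2 (y^-1 * x)%g * K (z, y)))%:E <=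
    (rabsconv H y * cn (F2 (y^-1 * x)%g))%:E)%E.
  under eq_integral do rewrite Normc.normcM EFinM.
  rewrite ge0_integralZl//; last 3 first.
  - by apply/measurable_EFinP; exact: measurable_normc.
  - by move=> z _; rewrite lee_fin normc_ge0.
  - by rewrite lee_fin normc_ge0.
  rewrite mulrC EFinM lee_wpmul2l ?lee_fin ?normc_ge0// rabsconvE//.
  apply: ge0_le_integral => //.
  - by move=> z _; rewrite lee_fin normc_ge0.
  - by apply/measurable_EFinP; exact: measurable_normc.
  - by apply/measurable_EFinP; apply: measurable_funM => //; exact: measurable_normc_F2_l.
  - by move=> z _; rewrite lee_fin.
have swap : cintegral (fun y => cintegral (fun z => F2 (y^-1 * x)%g * K (z, y))) =
    cintegral (fun z => cintegral (fun y => F2 (y^-1 * x)%g * K (z, y))).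
  apply: (@cintegral_fubini _ (fun yz : G * G => F2 (yz.1^-1 * x)%g * K (yz.2, yz.1))) => //.
  - apply: (@le_lt_trans _ _ (absconv (rabsconv H) x)); last exact: absconv_fin.
    apply: ge0_le_integral => //.
    + by move=> y _; apply: integral_ge0 => z _; rewrite lee_fin normc_ge0.
    + apply: (measurable_fun_fubini_tonelli_F
        (fun yz : G * G => (cn (F2 (yz.1^-1 * x)%g * K (yz.2, yz.1)))%:E)).
        by apply/measurable_EFinP; exact: measurable_normc.
      by move=> z; rewrite lee_fin normc_ge0.
    + by apply/measurable_EFinP; exact: measurable_funM.
    + by move=> y _; exact: inner.
  - by move=> y; apply: le_lt_trans (inner y) _; rewrite ltry.
  - move=> z; apply: (@le_lt_trans _ _ ((H z)%:E * \int[haar]_y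
        (cn (F2 (z^-1 * y)%g * F2 (y^-1 * x)%g))%:E)%E).
      have mFF : cmeasurable (fun y => F2 (z^-1 * y)%g * F2 (y^-1 * x)%g).
        by apply: cmeasurableM; [exact: cmeasurable_F2_r|exact: cmeasurable_F2_l].
      rewrite -ge0_integralZl//; last 3 first.
      + by apply/measurable_EFinP; exact: measurable_normc.
      + by move=> y _; rewrite lee_fin normc_ge0.
      + by rewrite lee_fin.
      apply: ge0_le_integral => //.
      + by move=> y _; rewrite lee_fin normc_ge0.
      + apply/measurable_EFinP; apply: measurable_normc.
        apply: cmeasurableM; first exact: cmeasurable_F2_l.
        by apply: cmeasurable_comp mK _; exact: measurable_pair1.
      + apply: emeasurable_funM => //.
        by apply/measurable_EFinP; exact: measurable_normc.
      + move=> y _; rewrite -EFinM lee_fin !Normc.normcM mulrC mulrA.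
        by rewrite ler_wpM2r ?normc_ge0.
    by apply: lte_mul_pinfty; rewrite ?lee_fin//; case: (cintegrable_ltrans_F2_F2 z x).
transitivity (cintegral (fun y => cintegral (fun z => F2 (y^-1 * x)%g * K (z, y)))).
  apply: eq_cintegral => y; rewrite mulrC cintegralZ//; exact: kernel_cintegrable.
rewrite swap -cintegralZ; last exact: kernel_cintegrable.
apply: eq_cintegral => z; rewrite -Krep; apply: eq_cintegral => y; exact: mulrC.
Qed.

End kernel_operator.

Lemma cmeasurable_conv_kernel f : cmeasurable f ->
  cmeasurable (fun z : G * G => f z.1 * F2 (z.1^-1 * z.2)%g).
Proof.
by move=> mf; apply: cmeasurableM; [exact: cmeasurable_comp mf _|exact: cmeasurable_F2_2].
Qed.

Lemma convolution_cintegrable f x : Lp p f -> cintegrable (fun y => f y * F2 (y^-1 * x)%g).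
Proof.
move=> /LpP[mf nf].
apply: (kernel_cintegrable (measurable_normc mf) (fun y => normc_ge0 _) nf
  (cmeasurable_conv_kernel mf)) => y z.
by rewrite Normc.normcM.
Qed.

Lemma normc_convolution f x : Lp p f ->
  cn (convolution f F2 x) <= 2 * rabsconv (fun y => cn (f y)) x.
Proof.
move=> /LpP[mf nf].
apply: (normc_kernel (measurable_normc mf) (fun y => normc_ge0 _) nf
  (cmeasurable_conv_kernel mf)) => y z.
by rewrite Normc.normcM.
Qed.

Lemma in_range_convolution f : Lp p f -> in_range (convolution f F2).
Proof.
move=> /LpP[mf nf].
apply: (in_range_kernel (measurable_normc mf) (fun y => normc_ge0 _) nf
  (cmeasurable_conv_kernel mf)) => [y z|z x].
  by rewrite Normc.normcM.
rewrite /= mulrCA -convolution_ltrans_F2 /convolution -cintegralZ.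
  by apply: eq_cintegral => y; rewrite mulrA.
exact: cintegrable_ltrans_F2_F2.
Qed.

End Lp_range.

(** * Topology of G and positivity of Haar measure *)

Section axb_topology.
Context {R : realType}.
Local Notation G := (axb R).
Local Notation C := R[i].
Local Notation cn := (@Normc.normc R).
Local Notation mu := (@lebesgue_measure R).
Local Notation fst_ x := (axb_val x).1.
Local Notation snd_ x := (axb_val x).2.

Lemma continuous_axb_val : continuous (@axb_val R : G -> R * R).
Proof. exact: (@initial_continuous G (R * R)%type (@axb_val R)). Qed.

Lemma nbhs_axbP (x : G) (A : set G) :
  nbhs x A <-> exists2 B, nbhs (axb_val x) B & @axb_val R @^-1` B `<=` A.
Proof.
split=> [|[B Bx BA]]; last by apply: filterS BA _; exact: continuous_axb_val.
rewrite nbhsE => -[U [[V oV VU] Ux] UA]; exists V; last by rewrite VU.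
by apply: open_nbhs_nbhs; split => //; move: Ux; rewrite -VU.
Qed.

Lemma continuous_complexP (T : topologicalType) (h : T -> C) :
  continuous (h : T -> C^o) <->
  (forall x (e : R), 0 < e -> \forall y \near x, cn (h x - h y) < e).
Proof.
split=> [ch x e e0|ch x].
  have eC : 0 < e%:C :> C by rewrite ltcR.
  have /cvgrPdist_lt /(_ _ eC) := ch x.
  by apply: filterS => y; rewrite complex_normc_norm ltcR.
apply/cvgrPdist_lt => e e0.
have [eI eR] : complex.Im e = 0 /\ 0 < complex.Re e.
  by move: e0; rewrite ltcE /= => /andP[/eqP].
apply: filterS (ch x _ eR) => y hy; rewrite complex_normc_norm.
by rewrite ltcE /= eI eqxx.
Qed.

Lemma near_axb_gap (x : G) (e : R) : 0 < e -> \forall y \near x, axb_gap (x^-1 * y)%g < e.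
Proof.
move=> e0; have x0 := fst_gt0 x.
pose P (z : R * R) : R := `|(z.1 * (fst_ x)^-1) ^+ 2 - 1| +
  `|z.1 * z.2 * (fst_ x) ^- 2 - snd_ x / fst_ x|.
have cP : P z @[z --> axb_val x] --> P (axb_val x).
  have c1 : (fun z : R * R => z.1) z @[z --> axb_val x] --> fst_ x by exact: cvg_fst.
  have c2 : (fun z : R * R => z.2) z @[z --> axb_val x] --> snd_ x by exact: cvg_snd.
  have ck (a : R) : (fun z : R * R => a) z @[z --> axb_val x] --> a by exact: cvg_cst.
  apply: cvgD; apply: cvg_norm; apply: cvgB => //.
    by rewrite !expr2; under eq_fun do rewrite expr2; apply: cvgM; apply: cvgM.
  by apply: cvgM => //; exact: cvgM.
have P0 : P (axb_val x) = 0.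
  rewrite /P mulfV ?gt_eqF// expr1n subrr normr0 add0r; apply/eqP; rewrite normr_eq0.
  by apply/eqP; field; rewrite gt_eqF.
have gapE y : axb_gap (x^-1 * y)%g = P (axb_val y).
  rewrite /axb_gap axb_valM axb_valV /P /= (mulrC _^-1); congr (_ + `|_|).
  by field; rewrite !gt_eqF ?fst_gt0.
apply/nbhs_axbP; exists [set z | P z < e].
  have /cvgrPdist_lt /(_ _ e0) := cP; apply: filterS => z.
  by rewrite P0 sub0r normrN; apply: le_lt_trans; exact: ler_norm.
by move=> y /=; rewrite gapE.
Qed.

Lemma haar_nbhs_gt0 (x : G) (A : set G) : measurable A -> nbhs x A -> (0 < haar A)%E.
Proof.
move=> mA /nbhs_axbP[B [[B1 B2] [/= /nbhs_ballP[e1 /= e10 B1e] /nbhs_ballP[e2 /= e20 B2e]] BB] BA].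
have x0 := fst_gt0 x.
pose r := fst_ x + e1; have r0 : 0 < r by rewrite addr_gt0.
(* Only the upper right quarter of the neighbourhood is used: there a stays positive and the density
   is at least r^-2. *)
pose Q : set (R * R) := `]fst_ x, r[%classic `*` `]snd_ x, snd_ x + e2[%classic.
have mQ : measurable Q by apply: measurableX; exact: measurable_itv.
have QA : Q `<=` @axb_of R @^-1` A.
  move=> [a b] [/=]; rewrite !in_itv/= => /andP[xa ar] /andP[xb br].
  have a0 : 0 < a by exact: lt_trans xa.
  apply: BA; rewrite /preimage /= axb_ofK//; apply: BB; split => /=.
    by apply: B1e; rewrite /ball /= ltr_distlC; apply/andP; split; [lra|exact: ar].
  by apply: B2e; rewrite /ball /= ltr_distlC; apply/andP; split; [lra|exact: br].
rewrite haarE//.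
apply: (@lt_le_trans _ _ (\int[mu \x mu]_(z in Q) (r ^- 2)%:E)%E).
  rewrite integral_cst /=; last exact: mQ.
  have -> : (mu \x mu)%E Q =
      (mu `](fst_ x), r[%classic * mu `](snd_ x), (snd_ x + e2)%R[%classic)%E.
    by rewrite product_measure1E.
  rewrite !lebesgue_measure_itv/= !lte_fin /r !ltrDl e10 e20 -!EFinD -!EFinM lte_fin.
  have -> : fst_ x + e1 - fst_ x = e1 by ring.
  have -> : snd_ x + e2 - snd_ x = e2 by ring.
  by rewrite !mulr_gt0// invr_gt0 exprn_gt0.
have mO : measurable (@axb_of R @^-1` A).
  by rewrite -[X in measurable X]setTI; exact: measurable_axb_of.
apply: (@le_trans _ _ (\int[mu \x mu]_(z in Q) (axb_dens z)%:E)%E).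
  apply: ge0_le_integral => //.
  - by move=> z _; rewrite lee_fin invr_ge0 sqr_ge0.
  - by apply: measurable_funTS; apply/measurable_EFinP; exact: measurable_axb_dens.
  - move=> [a b] [/=]; rewrite !in_itv/= => /andP[xa ar] _.
    have a0 : 0 < a by exact: lt_trans xa.
    rewrite lee_fin /axb_dens /= a0 lef_pV2 ?posrE ?exprn_gt0//.
    by rewrite lerXn2r ?nnegrE ?(ltW a0) ?(ltW r0)// ltW.
apply: ge0_subset_integral => //.
- by apply: measurable_funTS; apply/measurable_EFinP; exact: measurable_axb_dens.
- by move=> z _; rewrite lee_fin axb_dens_ge0.
Qed.

Lemma continuous_ae_eq (f g : G -> C) : continuous (f : G -> C^o) ->
  continuous (g : G -> C^o) -> {ae haar, forall x, f x = g x} -> f = g.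
Proof.
move=> cf cg [N [mN N0 fgN]]; apply/funext => x; apply/eqP/negPn/negP => fgx.
have e0 : 0 < cn (f x - g x) / 2.
  by rewrite divr_gt0// lt_def normc_ge0 normc_eq0 subr_eq0 fgx.
suff Nx : nbhs x N by have := haar_nbhs_gt0 mN Nx; rewrite N0 ltxx.
apply: filterS fgN _.
move/continuous_complexP : cf => /(_ x _ e0) cf.
move/continuous_complexP : cg => /(_ x _ e0) cg.
apply: filterS2 cf cg => y hf hg /= fgy.
have : cn (f x - g x) <= cn (f x - f y) + cn (g x - g y).
  apply: le_trans (normcB _ _); rewrite fgy.
  by rewrite opprB addrA subrK.
by lra.
Qed.

End axb_topology.

Section LpF2_characterization.
Context {R : realType}.
Local Notation G := (axb R).
Local Notation C := R[i].
Local Notation cn := (@Normc.normc R).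
Variable p : R.
Hypothesis p1 : 1 < p.
Local Notation k := (pi / 4 : R).
Implicit Types f h : G -> C.

(** The relative error of F2 passes under the integral; 28 is 14 times the factor 2 lost in the
    modulus of a complex integral. *)
Lemma convolution_mulr_close f x u : Lp p f -> axb_gap u <= 2^-1 ->
  cn (convolution f F2 (x * u)%g - convolution f F2 x) <=
  28 * axb_gap u * rabsconv (fun y => cn (f y)) x.
Proof.
move=> Lf gu; have [mf nf] := (LpP p f).1 Lf.
rewrite -cintegralB; [|exact: (convolution_cintegrable p1 _ Lf)|exact: (convolution_cintegrable p1 _ Lf)].
have g0 : 0 <= axb_gap u by rewrite addr_ge0.
pose H y := 14 * axb_gap u * cn (f y).
have mn := measurable_normc mf.
have mH : measurable_fun setT H by apply: measurable_funM.
have g14 : 0 <= 14 * axb_gap u by rewrite mulr_ge0.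
have H0 y : 0 <= H y by rewrite mulr_ge0 ?normc_ge0.
have nH : (Lnorm haar p%:E (EFin \o H) < +oo)%E.
  rewrite (@Lnorm_scale _ p p1 (14 * axb_gap u) (fun y => cn (f y)) g14 mn (fun y => normc_ge0 _)).
  by apply: lte_mul_pinfty => //; rewrite lee_fin.
have mm : cmeasurable (fun y => f y * F2 (y^-1 * (x * u))%g - f y * F2 (y^-1 * x)%g).
  by apply: cmeasurableB; apply: cmeasurableM => //; exact: cmeasurable_F2_l.
have [//|_] := @dominated_cintegrable _ p p1 H _ x mH H0 nH mm.
  move=> y; rewrite -mulrBr Normc.normcM /H mulgA [leRHS]mulrAC [leRHS]mulrC.
  by rewrite ler_wpM2l ?normc_ge0// F2_mulr_close.
move=> h; apply: (le_trans h).
have -> : rabsconv H x = 14 * axb_gap u * rabsconv (fun y => cn (f y)) x.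
  rewrite /rabsconv /absconv /H.
  have -> : (\int[haar]_y (14 * axb_gap u * cn (f y) * cn (F2 (y^-1 * x)%g))%:E =
      (14 * axb_gap u)%:E * \int[haar]_y (cn (f y) * cn (F2 (y^-1 * x)%g))%:E)%E.
    rewrite -ge0_integralZl//.
    - by apply: eq_integral => y _; rewrite -EFinM mulrA.
    - by apply/measurable_EFinP; apply: measurable_funM => //; exact: measurable_normc_F2_l.
    - by move=> y _; rewrite lee_fin mulr_ge0 ?normc_ge0.
  have := rabsconvE p1 x mn (fun y => normc_ge0 (f y)) nf.
  by rewrite /absconv => <-.
by rewrite !mulrA; lra.
Qed.

Lemma continuous_convolution f : Lp p f -> continuous (convolution f F2 : G -> C^o).
Proof.
move=> Lf; apply/continuous_complexP => x e e0.
set M := rabsconv (fun y => cn (f y)) x.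
have M0 : 0 <= M by apply: rabsconv_ge0 => y; exact: normc_ge0.
have d0 : 0 < Num.min 2^-1 (e / (28 * (M + 1))).
  by rewrite lt_min invr_gt0 ltr0n /= divr_gt0// mulr_gt0// ltr_wpDl.
apply: filterS (near_axb_gap x d0) => y; rewrite lt_min => /andP[/ltW g1 g2].
have -> : y = (x * (x^-1 * y))%g by rewrite mulgA mulgV mul1g.
rewrite -normc_opp opprB; apply: (le_lt_trans (convolution_mulr_close x Lf g1)).
have g0 : 0 <= axb_gap (x^-1 * y)%g by rewrite addr_ge0.
rewrite -/M; move: g2; rewrite ltr_pdivlMr ?mulr_gt0 ?ltr_wpDl//.
nra.
Qed.

(** Two continuous functions equal almost everywhere agree, so h is f * F2 at every point and
    inherits F2 * F2 = k F2. Conversely h = (h/k) * F2, which is continuous. *)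
Lemma LpF2_in_range h : LpF2 p h <-> in_range p h.
Proof.
split=> [[ch [f Lf hf]]|[Lh hk]].
  have -> : h = convolution f F2.
    by apply: continuous_ae_eq => //; exact: continuous_convolution.
  exact: (in_range_convolution p1 Lf).
have k0 : k%:C != 0 :> C by rewrite eq_complex /= gt_eqF// divr_gt0// pi_gt0.
have [mh nh] := (LpP p h).1 Lh.
have Lf : Lp p (fun x => k%:C^-1 * h x).
  apply/LpP; split; first by apply: cmeasurableM => //; exact: cmeasurable_cst.
  under [X in Lnorm _ _ X]eq_fun do rewrite /= Normc.normcM.
  rewrite (@Lnorm_scale _ p p1 (cn k%:C^-1) (fun y => cn (h y))) ?normc_ge0//.
  - by apply: lte_mul_pinfty => //; rewrite lee_fin normc_ge0.
  - exact: measurable_normc.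
  - by move=> y; exact: normc_ge0.
have hE : h = convolution (fun x => k%:C^-1 * h x) F2.
  apply/funext => x; rewrite /convolution; under eq_cintegral do rewrite -mulrA.
  rewrite cintegralZ; last exact: (convolution_cintegrable p1 _ Lh).
  by rewrite -/(convolution h F2 x) hk mulKf.
split; first by rewrite hE; exact: continuous_convolution.
by exists (fun x => k%:C^-1 * h x) => //; rewrite -hE; exact: aeW.
Qed.

End LpF2_characterization.

(** * Completeness and perturbation *)

Section contraction.
Context {R : realType}.
Local Notation G := (axb R).
Local Notation C := R[i].
Local Notation cn := (@Normc.normc R).
Variable p : R.
Hypothesis p1 : 1 < p.
Local Notation Np g := (Lnorm haar p%:E (EFin \o g)).
Local Notation k := (pi / 4 : R).
Implicit Types f g h : G -> C.

Let p0 : 0 < p. Proof. exact: lt_trans p1. Qed.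
Let k0 : 0 < k. Proof. by rewrite divr_gt0// pi_gt0. Qed.

Definition Lp_dist f g : R := fine (Lp_norm p (fun x => f x - g x)).

Lemma Lp_norm_triangle f g h : Lp p f -> Lp p g -> cmeasurable h ->
  (forall x, cn (h x) <= cn (f x) + cn (g x)) ->
  Lp p h /\ (Lp_norm p h <= Lp_norm p f + Lp_norm p g)%E.
Proof.
move=> /LpP[mf nf] /LpP[mg ng] mh hfg.
have le : (Lp_norm p h <= Lp_norm p f + Lp_norm p g)%E.
  apply: le_trans (Lnorm_triangle p1 (measurable_normc mf) (measurable_normc mg)).
  apply: Lnorm_ler => //; first exact: measurable_normc.
    by apply: measurable_funD; exact: measurable_normc.
  by move=> x; exact: normc_ge0.
by split => //; apply/LpP; split => //; apply: (le_lt_trans le); rewrite lte_add_pinfty.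
Qed.

Lemma LpB f g : Lp p f -> Lp p g -> Lp p (fun x => f x - g x).
Proof.
move=> Lf Lg; case: (@Lp_norm_triangle f g (fun x => f x - g x)) => //.
  by case/LpP : Lf => mf _; case/LpP : Lg => mg _; exact: cmeasurableB.
by move=> x; exact: normcB.
Qed.

Lemma LpZ (c : C) f : Lp p f -> Lp p (fun x => c * f x).
Proof.
move=> /LpP[mf nf]; apply/LpP; split.
  by apply: cmeasurableM => //; exact: cmeasurable_cst.
under [X in Lnorm _ _ X]eq_fun do rewrite /= Normc.normcM.
rewrite (@Lnorm_scale _ p p1 (cn c) (fun y => cn (f y))) ?normc_ge0//.
- by apply: lte_mul_pinfty => //; rewrite lee_fin normc_ge0.
- exact: measurable_normc.
- by move=> y; exact: normc_ge0.
Qed.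

Lemma Lp_normZ (c : C) f : Lp p f ->
  Lp_norm p (fun x => c * f x) = ((cn c)%:E * Lp_norm p f)%E.
Proof.
move=> /LpP[mf nf]; rewrite /Lp_norm.
under [X in Lnorm _ _ X]eq_fun do rewrite /= Normc.normcM.
rewrite (@Lnorm_scale _ p p1 (cn c) (fun y => cn (f y))) ?normc_ge0//.
- exact: measurable_normc.
- by move=> y; exact: normc_ge0.
Qed.

Lemma Lp_distE f g : Lp p f -> Lp p g ->
  Lp_norm p (fun x => f x - g x) = (Lp_dist f g)%:E.
Proof.
move=> Lf Lg; rewrite fineK// ge0_fin_numE ?Lnorm_ge0//.
by case/LpP : (LpB Lf Lg).
Qed.

Lemma Lp_dist_ge0 f g : 0 <= Lp_dist f g.
Proof. by rewrite fine_ge0// Lnorm_ge0. Qed.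

Lemma Lp_dist_triangle f g h : Lp p f -> Lp p g -> Lp p h ->
  Lp_dist f h <= Lp_dist f g + Lp_dist g h.
Proof.
move=> Lf Lg Lh; rewrite -lee_fin EFinD -!Lp_distE//.
have /LpP[mf _] := LpB Lf Lh.
case: (Lp_norm_triangle (LpB Lf Lg) (LpB Lg Lh) mf) => // x.
by apply: le_trans (normcD _ _); rewrite addrA subrK.
Qed.

Lemma Lp_distC f g : Lp_dist f g = Lp_dist g f.
Proof.
rewrite /Lp_dist /Lp_norm; congr (fine (Lnorm _ _ _)); apply/funext => x /=.
by rewrite -[in LHS]opprB normc_opp.
Qed.

Lemma in_rangeB f g : in_range p f -> in_range p g -> in_range p (fun x => f x - g x).
Proof.
move=> [Lf ef] [Lg eg]; split; first exact: LpB.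
move=> x; rewrite /convolution.
under eq_cintegral do rewrite mulrBl.
rewrite cintegralB; [|exact: (convolution_cintegrable p1)|exact: (convolution_cintegrable p1)].
by rewrite -/(convolution f F2 x) -/(convolution g F2 x) ef eg mulrBr.
Qed.

Lemma in_rangeZ c f : in_range p f -> in_range p (fun x => c * f x).
Proof.
move=> [Lf ef]; split; first exact: LpZ.
move=> x; rewrite /convolution.
under eq_cintegral do rewrite -mulrA.
rewrite cintegralZ; last exact: (convolution_cintegrable p1).
by rewrite -/(convolution f F2 x) ef mulrCA.
Qed.

Lemma convolution_le_Lp_norm f x : Lp p f ->
  ((cn (convolution f F2 x))%:E <= (2 * schur_cst p)%:E * Lp_norm p f)%E.
Proof.
move=> Lf; have /LpP[mf nf] := Lf.
apply: (@le_trans _ _ (2 * rabsconv (fun y => cn (f y)) x)%:E).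
  by rewrite lee_fin; exact: (normc_convolution p1).
rewrite 2!EFinM -muleA; apply: lee_wpmul2l => //.
rewrite (rabsconvE p1)//; [|exact: measurable_normc|by move=> y; exact: normc_ge0].
by apply: absconv_le_Lnorm => //; [exact: measurable_normc|move=> y; exact: normc_ge0].
Qed.

Definition eval_cst : R := k^-1 * (2 * schur_cst p).

Lemma eval_cst_ge0 : 0 <= eval_cst.
Proof. by rewrite mulr_ge0 ?invr_ge0 ?(ltW k0)// mulr_ge0// schur_cst_ge0. Qed.

(** The difference is 1/k times its own convolution with F2, which is bounded at each point by the
    L^p norm. *)
Lemma in_range_eval f g x : in_range p f -> in_range p g ->
  cn (f x - g x) <= eval_cst * Lp_dist f g.
Proof.
move=> rf rg; have [Lfg efg] := in_rangeB rf rg.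
have := convolution_le_Lp_norm x Lfg.
rewrite efg (Lp_distE (proj1 rf) (proj1 rg)) -EFinM lee_fin Normc.normcM normcR.
rewrite ger0_norm ?(ltW k0)// => le.
by rewrite /eval_cst -mulrA ler_pdivlMl.
Qed.

Lemma in_range_eq f g : in_range p f -> in_range p g -> Lp_dist f g = 0 -> f = g.
Proof.
move=> rf rg fg0; apply/funext => x; apply/eqP; rewrite -subr_eq0 -normc_eq0 eq_le normc_ge0 andbT.
by have := in_range_eval x rf rg; rewrite fg0 mulr0.
Qed.

Lemma limn_einf_le (u : (\bar R)^nat) c : (forall n, (u n <= c)%E) -> (limn_einf u <= c)%E.
Proof.
move=> uc; rewrite limn_einf_lim; apply: lime_le; first exact: is_cvg_einfs.
apply: nearW => n; apply: le_trans (uc n).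
by apply: ereal_inf_lbound; exists n => //=.
Qed.

(** Lower semicontinuity of the norm under pointwise convergence: it turns distances between two
    terms of a sequence into distances to its pointwise limit. *)
Lemma Lnorm_fatou (g : nat -> G -> R) (h0 : G -> R) (c : R) : 0 <= c ->
  (forall n, measurable_fun setT (g n)) -> (forall n x, 0 <= g n x) ->
  (forall x, g ^~ x @ \oo --> h0 x) -> (forall n, (Np (g n) <= c%:E)%E) ->
  (Np h0 <= c%:E)%E.
Proof.
move=> c0 mg g0 gh gc.
have h00 x : 0 <= h0 x by apply: (cvgr_to_ge (gh x)); exact: nearW.
have inI (e : \bar R) : (0 <= e)%E -> e \in `[0%E, +oo%E].
  by move=> e0; rewrite in_itv/= e0 leey.
have cE : ((c `^ p)%:E `^ p^-1 = c%:E)%E.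
  by rewrite poweR_EFin -powRrM mulfV ?gt_eqF// powRr1.
have pow0 (f : G -> R) : (0 <= \int[haar]_y (f y `^ p)%:E)%E.
  by apply: integral_ge0 => y _; rewrite lee_fin powR_ge0.
have gp n : (\int[haar]_y (g n y `^ p)%:E <= (c `^ p)%:E)%E.
  rewrite -Lnorm_powR// -poweR_EFin; apply: gt0_ler_poweR; rewrite ?(ltW p0)//.
    exact/inI/Lnorm_ge0.
  by apply: inI; rewrite lee_fin.
rewrite Lnorm_ge0_fun// -cE; apply: gt0_ler_poweR; rewrite ?invr_ge0 ?(ltW p0)//.
- exact/inI.
- by apply: inI; rewrite lee_fin powR_ge0.
have mgp n : measurable_fun setT (fun y => (g n y `^ p)%:E).
  by apply/measurable_EFinP; exact: measurableT_comp (measurable_powR _) (mg n).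
have cv y : (fun n => g n y `^ p) @ \oo --> h0 y `^ p.
  (* At a zero of the limit, g^p is squeezed between 0 and g as soon as g < 1, because p > 1;
     elsewhere g^p = exp(p ln g) and continuity applies. *)
  have [hy|hy] := eqVneq (h0 y) 0.
    have gy : g ^~ y @ \oo --> 0 by rewrite -hy.
    rewrite hy powR0 ?gt_eqF//.
    have c00 : (fun=> 0 : R) @ \oo --> (0 : R) by exact: cvg_cst.
    apply: (squeeze_cvgr _ c00 gy).
    have : \forall n \near \oo, g n y < 1 by exact: (cvgr_lt _ gy _ ltr01).
    apply: filterS => n gn; rewrite powR_ge0/=.
    have [->|gn0] := eqVneq (g n y) 0; first by rewrite powR0 ?gt_eqF.
    rewrite -[leRHS](@powRr1 _ (g n y))//; apply: ger_powR; last exact: ltW.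
    by rewrite lt_neqAle eq_sym gn0 g0 ltW.
  have hy0 : 0 < h0 y by rewrite lt_neqAle eq_sym hy h00.
  have near_pos : \forall n \near \oo, 0 < g n y by exact: (cvgr_gt _ (gh y) _ hy0).
  rewrite /powR (negbTE hy).
  apply: (@cvg_trans _ ((fun n => expR (p * ln (g n y))) @ \oo)).
    apply: near_eq_cvg; apply: filterS near_pos => n gn.
    by rewrite gt_eqF.
  apply: (cvg_comp _ expR); last exact: continuous_expR.
  apply: cvgMr.
  by apply: (cvg_comp _ _ (gh y)); exact: continuous_ln.
have -> : (\int[haar]_y (h0 y `^ p)%:E = \int[haar]_y limn_einf (fun n => (g n y `^ p)%:E))%E.
  apply: eq_integral => y _; apply/esym.
  by apply: (cvg_limn_einf_sup _).1; apply: cvg_EFin; [exact: nearW|exact: cv].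
apply: (le_trans (fatou _ _ mgp _)) => //.
  by move=> n y _; rewrite lee_fin powR_ge0.
exact: limn_einf_le.
Qed.

Let h := (2^-1 : R).
Let h0 : 0 <= h. Proof. by rewrite invr_ge0. Qed.

Lemma cvg_half_geometric (a : R) : (fun n => a * h ^+ n) @ \oo --> 0.
Proof. by apply: cvg_geometric; rewrite ger0_norm// invf_lt1// ltr1n. Qed.

Lemma half_geometric_le0 (a c : R) : (forall n, a <= c * h ^+ n) -> a <= 0.
Proof. by move=> ac; apply: (cvgr_to_ge (cvg_half_geometric c)); exact: nearW. Qed.

Section completeness.
Variables (f : nat -> G -> C) (M : R).
Hypothesis rf : forall n, in_range p (f n).
Hypothesis fM : forall n, Lp_dist (f n.+1) (f n) <= M * h ^+ n.

Let Lf n : Lp p (f n). Proof. by case: (rf n). Qed.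

Let M0 : 0 <= M.
Proof. by apply: le_trans (Lp_dist_ge0 (f 1) (f 0)) _; rewrite (le_trans (fM 0%N))// expr0 mulr1. Qed.

Let dist_le n m : Lp_dist (f (n + m)%N) (f n) <= 2 * M * h ^+ n.
Proof.
(* The exact partial sum of the geometric series is what the induction on m reproduces; the stated
   bound drops h^m. *)
suff : Lp_dist (f (n + m)%N) (f n) <= 2 * M * h ^+ n * (1 - h ^+ m).
  move/le_trans; apply; rewrite ler_piMr ?mulr_ge0 ?exprn_ge0//.
  by rewrite gerBl exprn_ge0.
elim: m => [|m ih].
  rewrite addn0 expr0 subrr mulr0 /Lp_dist -[leLHS](_ : 0 = _)//.
  have -> : (fun x => f n x - f n x) = (fun x => 0 * f n x).
    by apply/funext => x; rewrite subrr mul0r.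
  by rewrite Lp_normZ// Normc.normc0 mul0e.
rewrite addnS; apply: (le_trans (Lp_dist_triangle (Lf _) (Lf (n + m)%N) (Lf _))).
apply: (le_trans (lerD (fM _) ih)).
rewrite exprD exprS le_eqVlt; apply/orP; left; apply/eqP.
have e2 : 2 * h = 1 by rewrite mulfV.
have -> : 2 * M * h ^+ n * (1 - h * h ^+ m) = 2 * M * h ^+ n - (2 * h) * M * h ^+ n * h ^+ m.
  by ring.
by rewrite e2; ring.
Qed.

Let dist_le' n m : (n <= m)%N -> Lp_dist (f m) (f n) <= 2 * M * h ^+ n.
Proof. by move=> nm; rewrite -(subnKC nm); exact: dist_le. Qed.

Let eval_cvg (r : C -> R) x : (forall z w, r (z - w) = r z - r w) ->
  (forall z, `|r z| <= cn z) -> cvgn (fun n => r (f n x)).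
Proof.
move=> rB rn; apply/cauchy_cvgP/cauchy_exP => e e0.
have ev : \forall n \near \oo, eval_cst * (2 * M) * h ^+ n < e.
  exact: (cvgr_lt _ (cvg_half_geometric _) _ e0).
have [n ne] := filter_ex ev.
exists (r (f n x)); exists n => // m /= nm; rewrite /ball /= distrC -rB.
apply: (le_lt_trans (rn _)); apply: le_lt_trans ne.
apply: (le_trans (in_range_eval x (rf m) (rf n))).
by rewrite -mulrA; apply: ler_wpM2l; [exact: eval_cst_ge0|exact: dist_le'].
Qed.

Let l x : C := (limn (fun n => complex.Re (f n x))) +i* (limn (fun n => complex.Im (f n x))).

Let Re_cvg x : (fun n => complex.Re (f n x)) @ \oo --> complex.Re (l x).
Proof. by apply: eval_cvg => z; [move=> w; rewrite ReD ReN|exact: le_Re_normc]. Qed.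

Let Im_cvg x : (fun n => complex.Im (f n x)) @ \oo --> complex.Im (l x).
Proof. by apply: eval_cvg => z; [move=> w; rewrite ImD ImN|exact: le_Im_normc]. Qed.

Let ml : cmeasurable l.
Proof.
split; [apply: (@measurable_fun_cvg _ _ _ setT (fun n x => complex.Re (f n x)))|
        apply: (@measurable_fun_cvg _ _ _ setT (fun n x => complex.Im (f n x)))] => //.
- by move=> n; case/LpP : (Lf n) => -[].
- by move=> n; case/LpP : (Lf n) => -[].
Qed.

Let normc_cvg n x : (fun m => cn (f (n + m)%N x - f n x)) @ \oo --> cn (l x - f n x).
Proof.
have E (z : C) : cn z = Num.sqrt (complex.Re z * complex.Re z + complex.Im z * complex.Im z).
  by case: z => a b /=; rewrite !expr2.
have dR : (fun m => complex.Re (f (n + m)%N x - f n x)) @ \oo --> complex.Re (l x - f n x).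
  rewrite ReD ReN; under eq_fun do rewrite ReD ReN addnC.
  by apply: cvgB; [have := @Re_cvg x; rewrite -(cvg_shiftn n)|exact: cvg_cst].
have dI : (fun m => complex.Im (f (n + m)%N x - f n x)) @ \oo --> complex.Im (l x - f n x).
  rewrite ImD ImN; under eq_fun do rewrite ImD ImN addnC.
  by apply: cvgB; [have := @Im_cvg x; rewrite -(cvg_shiftn n)|exact: cvg_cst].
under eq_fun do rewrite E; rewrite E.
exact: (cvg_comp _ _ (cvgD (cvgM dR dR) (cvgM dI dI)) (@sqrt_continuous _ _)).
Qed.

Let dist_l n : (Lp_norm p (fun x => (l x - f n x)%R) <= (2 * M * h ^+ n)%:E)%E.
Proof.
apply: (Lnorm_fatou (g := fun m x => cn (f (n + m)%N x - f n x))) => //.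
- by rewrite !mulr_ge0// exprn_ge0.
- by move=> m; apply: measurable_normc; case/LpP : (LpB (Lf (n + m)) (Lf n)).
- by move=> m x; exact: normc_ge0.
- by move=> m; rewrite -/(Lp_norm p _) Lp_distE// lee_fin; exact: dist_le.
Qed.

Let eval_l n x : cn (l x - f n x) <= eval_cst * (2 * M * h ^+ n).
Proof.
apply: (cvgr_to_le (@normc_cvg n x)); apply: nearW => m.
apply: (le_trans (in_range_eval x (rf _) (rf n))).
by apply: ler_wpM2l; [exact: eval_cst_ge0|exact: dist_le].
Qed.

(** The limit l is taken pointwise, which bounded evaluations permit, and Fatou gives its L^p
    distance to each f n. The defect l * F2 - k l equals the same expression for l - f n, which is
    O(2^-n) at every point, hence zero. *)
Lemma in_range_complete :
  exists2 g, in_range p g & forall n, Lp_dist g (f n) <= 2 * M * h ^+ n.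
Proof.
have Ll : Lp p l.
  have Ld : Lp p (fun x => l x - f 0%N x).
    apply/LpP; split; first by apply: cmeasurableB => //; case/LpP : (Lf 0).
    by apply: (le_lt_trans (dist_l 0)); rewrite ltry.
  case: (Lp_norm_triangle Ld (Lf 0) ml) => // x.
  by apply: le_trans (normcD _ _); rewrite subrK.
have dl n : Lp_dist l (f n) <= 2 * M * h ^+ n by rewrite -lee_fin -Lp_distE.
exists l => //; split => // x.
apply/eqP; rewrite -subr_eq0 -normc_eq0 eq_le normc_ge0 andbT.
apply: (@half_geometric_le0 _ ((2 * schur_cst p + k * eval_cst) * (2 * M))) => n.
have -> : convolution l F2 x - k%:C * l x =
    convolution (fun x => l x - f n x) F2 x - k%:C * (l x - f n x).
  rewrite /convolution; under [in RHS]eq_cintegral do rewrite mulrBl.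
  rewrite cintegralB; [|exact: (convolution_cintegrable p1)|exact: (convolution_cintegrable p1)].
  rewrite -/(convolution l F2 x) -/(convolution (f n) F2 x) (proj2 (rf n)); ring.
apply: (le_trans (normcB _ _)).
rewrite [leRHS](_ : _ = 2 * schur_cst p * (2 * M * h ^+ n) + k * (eval_cst * (2 * M * h ^+ n))); last by ring.
apply: lerD.
  have := convolution_le_Lp_norm x (LpB Ll (Lf n)).
  rewrite Lp_distE// -EFinM lee_fin => /le_trans; apply.
  by apply: ler_wpM2l => //; rewrite mulr_ge0// schur_cst_ge0.
rewrite Normc.normcM normcR ger0_norm ?(ltW k0)//.
by apply: ler_wpM2l; [exact: ltW|exact: eval_l].
Qed.

End completeness.

End contraction.

(** * Operators close to multiplication by pi/4 *)

Section perturbation.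
Context {R : realType}.
Local Notation G := (axb R).
Local Notation C := R[i].
Local Notation cn := (@Normc.normc R).
Variable p : R.
Hypothesis p1 : 1 < p.
Local Notation k := (pi / 4 : R).
Implicit Types f g : G -> C.
Variable A : (G -> C) -> G -> C.
Hypothesis rA : forall f, in_range p f -> in_range p (A f).
Hypothesis AB : forall f g z, in_range p f -> in_range p g ->
  A (fun w => f w - g w) z = A f z - A g z.
Hypothesis closeA : forall f, in_range p f ->
  (Lp_norm p (fun z => (A f z - k%:C * f z)%R) <= (k / 2)%:E * Lp_norm p f)%E.

Let k0 : 0 < k. Proof. by rewrite divr_gt0// pi_gt0. Qed.
Let kC : k%:C != 0 :> C.
Proof. by rewrite -normc_eq0 normcR normr_eq0 gt_eqF. Qed.

Let close_dist f g : in_range p f -> in_range p g ->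
  (Lp_norm p (fun z => ((A f z - A g z) - k%:C * (f z - g z))%R) <= (k / 2 * Lp_dist p f g)%:E)%E.
Proof.
move=> rf rg; have rfg := in_rangeB p1 rf rg.
under [X in Lp_norm _ X]eq_fun do rewrite -AB//.
apply: (le_trans (closeA rfg)).
by rewrite EFinM Lp_distE//; [case: rf|case: rg].
Qed.

(** From k |f - g| <= |A f - A g| + (k/2) |f - g| in norm. It yields injectivity of A and the
    Lipschitz bound 2/k for its inverse. *)
Lemma perturbation_expanding f g : in_range p f -> in_range p g ->
  Lp_dist p f g <= 2 / k * Lp_dist p (A f) (A g).
Proof.
move=> rf rg.
have [Lf _] := rf; have [Lg _] := rg.
have [LAf _] := rA rf; have [LAg _] := rA rg.
have Lk := LpZ p1 k%:C (LpB p1 Lf Lg).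
have /LpP[mk _] := Lk.
have tri x : cn (k%:C * (f x - g x)) <=
    cn (A f x - A g x) + cn ((A f x - A g x) - k%:C * (f x - g x)).
  by rewrite -{1}(subKr (A f x - A g x) (k%:C * _)); exact: normcB.
have [_ le] := Lp_norm_triangle p1 (LpB p1 LAf LAg) (LpB p1 (LpB p1 LAf LAg) Lk) mk tri.
have {le} := le_trans le (leeD2l _ (close_dist rf rg)).
rewrite (Lp_normZ p1 _ (LpB p1 Lf Lg)) normcR ger0_norm ?(ltW k0)// !Lp_distE// -EFinM -EFinD lee_fin => le.
rewrite [leRHS]mulrAC ler_pdivlMr//; lra.
Qed.

(* Solves A f = g as the fixed point of f - (A f - g) / k, a contraction. *)
Lemma perturbation_surjective g : in_range p g -> exists2 f, in_range p f & A f = g.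
Proof.
move=> rg; pose Phi f : G -> C := fun z => f z - k%:C^-1 * (A f z - g z).
have rPhi f : in_range p f -> in_range p (Phi f).
  by move=> rf; apply: in_rangeB => //; apply: in_rangeZ => //; apply: in_rangeB => //; exact: rA.
have contr f1 f2 : in_range p f1 -> in_range p f2 ->
    Lp_dist p (Phi f1) (Phi f2) <= 2^-1 * Lp_dist p f1 f2.
  move=> r1 r2; rewrite -lee_fin -Lp_distE//; [|by case: (rPhi _ r1)|by case: (rPhi _ r2)].
  have -> : (fun z => Phi f1 z - Phi f2 z) =
      (fun z => - k%:C^-1 * ((A f1 z - A f2 z) - k%:C * (f1 z - f2 z))).
    by apply/funext => z; rewrite /Phi; move: kC; move: (k%:C) => c c0; field.
  have Ld : Lp p (fun z => (A f1 z - A f2 z) - k%:C * (f1 z - f2 z)).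
    have [L1 _] := r1; have [L2 _] := r2.
    have [LA1 _] := rA r1; have [LA2 _] := rA r2.
    by apply: LpB => //; [exact: LpB|apply: LpZ => //; exact: LpB].
  rewrite Lp_normZ//.
  apply: (le_trans (lee_wpmul2l _ (close_dist r1 r2))); first by rewrite lee_fin normc_ge0.
  rewrite -EFinM lee_fin normc_opp -fmorphV normcR ger0_norm ?invr_ge0 ?(ltW k0)//.
  by rewrite -mulrA mulKf ?gt_eqF.
pose f n := iter n Phi g.
have rf n : in_range p (f n) by elim: n => //= n; exact: rPhi.
pose M := Lp_dist p (f 1%N) (f 0%N).
have fM n : Lp_dist p (f n.+1) (f n) <= M * 2^-1 ^+ n.
  elim: n => [|n ih]; first by rewrite expr0 mulr1.
  apply: (le_trans (contr _ _ (rf n.+1) (rf n))).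
  by rewrite exprS mulrCA ler_wpM2l.
have [l rl dl] := in_range_complete p1 rf fM.
exists l => //.
have Phil : Phi l = l.
  apply: (in_range_eq p1 (rPhi _ rl) rl).
  apply/eqP; rewrite eq_le Lp_dist_ge0 andbT.
  (* The distances from Phi l to [f n.+1], which is Phi (f n), and from [f n.+1] to l are each at
     most M 2^-n. *)
  apply: (@half_geometric_le0 _ _ (2 * (2 * M))) => n.
  have [Ll _] := rl; have [LPl _] := rPhi _ rl; have [Lf1 _] := rf n.+1.
  apply: (le_trans (Lp_dist_triangle p1 LPl Lf1 Ll)).
  have := contr _ _ rl (rf n); have := dl n; have := dl n.+1.
  rewrite exprS (Lp_distC _ l); set a := Lp_dist _ _ _; set b := Lp_dist _ _ _.
  set c := Lp_dist _ _ _; set t := 2^-1 ^+ n => h1 h2 h3.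
  have : 0 <= M * t by rewrite mulr_ge0 ?Lp_dist_ge0// exprn_ge0 ?invr_ge0.
  lra.
apply/funext => z; have /(congr1 (fun u => u z)) := Phil.
rewrite /Phi -[RHS]subr0 => /addrI/oppr_inj/eqP.
by rewrite mulf_eq0 invr_eq0 (negbTE kC)/= subr_eq0 => /eqP.
Qed.

Lemma perturbation_invertible : exists S : LpF2 p -> LpF2 p,
  (forall f : LpF2 p, val (S f) = A (val f)) /\ invertible_with_continuous_inverse S.
Proof.
have rv (f : LpF2 p) : in_range p (val f) by apply/LpF2_in_range => //; exact: set_valP.
have AS (f : LpF2 p) : A (val f) \in LpF2 p.
  by apply/mem_set/LpF2_in_range => //; exact: rA.
pose S (f : LpF2 p) : LpF2 p := exist _ (A (val f)) (AS f).
exists S; split => //.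
have surj (g : LpF2 p) : exists f : LpF2 p, S f = g.
  have [f rf fg] := perturbation_surjective (rv g).
  have fin : f \in LpF2 p by apply/mem_set/LpF2_in_range.
  by exists (exist _ f fin); apply: val_inj; rewrite /= fg.
have inj : injective S.
  move=> f g /(congr1 val)/= e; apply: val_inj; apply: (in_range_eq p1 (rv f) (rv g)).
  apply/eqP; rewrite eq_le Lp_dist_ge0 andbT.
  apply: (le_trans (perturbation_expanding (rv f) (rv g))); rewrite e.
  rewrite /Lp_dist; have -> : (fun z => A (val g) z - A (val g) z) = (fun z => 0 * A (val g) z).
    by apply/funext => z; rewrite subrr mul0r.
  by rewrite Lp_normZ ?Normc.normc0 ?mul0e ?mulr0//; case: (rA (rv g)).
have [B SB] := choice surj.
exists B; split => //; first by move=> f; apply: inj; rewrite SB.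
move=> f e e0; exists (k / 2 * e); first by rewrite mulr_gt0// divr_gt0.
move=> g; rewrite !Lp_distE//; [|by case: (rv (B g))|by case: (rv (B f))|by case: (rv g)|by case: (rv f)].
rewrite !lte_fin => gf.
apply: (le_lt_trans (perturbation_expanding (rv _) (rv _))).
have AE h : A (val (B h)) = val h by rewrite -[in RHS](SB h).
by rewrite !AE -(ltr_pdivlMl _ _ (divr_gt0 (ltr0Sn R 1) k0)) invf_div.
Qed.

End perturbation.

(** * Sampled operators *)

Lemma big_uniq_sub (V : nmodType) (I : eqType) (s1 s2 : seq I) (F : I -> V) :
  uniq s1 -> uniq s2 -> {subset s1 <= s2} -> (forall i, i \notin s1 -> F i = 0) ->
  \sum_(i <- s2) F i = \sum_(i <- s1) F i.
Proof.
move=> u1 u2 s12 F0; rewrite (bigID (mem s1)) /= [X in _ + X]big1 ?addr0//.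
rewrite -big_filter; apply: perm_big; apply: uniq_perm => //; first exact: filter_uniq.
move=> i; rewrite mem_filter; case: (boolP (i \in s1)) => //= /s12 ->//.
Qed.

Section sampling_operator.
Context {R : realType}.
Local Notation G := (axb R).
Local Notation C := R[i].
Local Notation cn := (@Normc.normc R).
Variable p : R.
Hypothesis p1 : 1 < p.
Local Notation Np g := (Lnorm haar p%:E (EFin \o g)).
Local Notation k := (pi / 4 : R).
Variables (I : countType) (x : I -> G) (psi : I -> G -> R) (sy : G -> seq I) (d : R).
Hypothesis mpsi : forall i, measurable_fun setT (psi i).
Hypothesis psi0 : forall i y, 0 <= psi i y.
Hypothesis sy_uniq : forall y, uniq (sy y).
Hypothesis sy_supp : forall i y, psi i y != 0 -> i \in sy y.
Hypothesis sy_sum : forall y, \sum_(i <- sy y) psi i y = 1.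
Hypothesis d01 : 0 <= d <= 2^-1.
Hypothesis gap : forall i y, psi i y != 0 -> axb_gap (y^-1 * x i)%g <= d.

Let p0 : 0 < p. Proof. exact: lt_trans p1. Qed.
Let k0 : 0 < k. Proof. by rewrite divr_gt0// pi_gt0. Qed.
Let d0 : 0 <= d. Proof. by case/andP : d01. Qed.

(* true samples at x i and false keeps the integration variable: (b1, b2) is
   (true, false) for S, (true, true) for T and (false, true) for R. *)
Definition samp (b : bool) (f : G -> C) (i : I) (y : G) : C := if b then f (x i) else f y.

Definition kern (b : bool) (i : I) (y z : G) : C :=
  if b then F2 ((x i)^-1 * z)%g else F2 (y^-1 * z)%g.

(* sy y lists the indices with psi i y != 0, so the sums over I are finite. *)
Definition sterm b1 b2 f i (yz : G * G) : C :=
  (psi i yz.1)%:C * samp b1 f i yz.1 * kern b2 i yz.1 yz.2.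

Definition skernel b1 b2 f (yz : G * G) : C := \sum_(i <- sy yz.1) sterm b1 b2 f i yz.

Definition sop b1 b2 f (z : G) : C := cintegral (fun y => skernel b1 b2 f (y, z)).

Lemma psi_notin i y : i \notin sy y -> psi i y = 0.
Proof. by move=> iy; apply/eqP/negPn/negP => /sy_supp; rewrite (negPf iy). Qed.

Lemma sterm_notin b1 b2 f i yz : i \notin sy yz.1 -> sterm b1 b2 f i yz = 0.
Proof. by move=> iy; rewrite /sterm psi_notin// !mul0r. Qed.

(** The indices whose code is below n: fixed finite lists that eventually contain any given finite
    list. *)
Definition exhaustion (n : nat) : seq I := pmap (@choice.pickle_inv I) (iota 0 n).

Lemma exhaustion_uniq n : uniq (exhaustion n).
Proof. by apply: (pmap_uniq (@choice.pickle_invK I)); exact: iota_uniq. Qed.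

Lemma exhaustion_sub (s : seq I) : \forall n \near \oo, {subset s <= exhaustion n}.
Proof.
exists (\max_(i <- s) choice.pickle i).+1 => // n /= sn i si.
rewrite mem_pmap; apply/mapP; exists (choice.pickle i); last by rewrite choice.pickleK_inv.
rewrite mem_iota /= add0n (leq_trans _ sn)// ltnS.
by rewrite (big_rem i)//= leq_maxl.
Qed.

Lemma samp_sub b f g i y : samp b (fun z => f z - g z) i y = samp b f i y - samp b g i y.
Proof. by case: b. Qed.

Lemma cmeasurable_kern b i : cmeasurable (fun yz : G * G => kern b i yz.1 yz.2).
Proof.
case: b; last exact: cmeasurable_F2_2.
apply: (cmeasurable_comp (cmeasurable_F2 (R := R))).
by apply: measurable_axbM => //; exact: measurable_cst.
Qed.

Lemma cmeasurable_samp b f i : cmeasurable f -> cmeasurable (samp b f i).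
Proof. by move=> mf; case: b => //; exact: cmeasurable_cst. Qed.

Lemma cmeasurable_sterm b1 b2 f i : cmeasurable f -> cmeasurable (sterm b1 b2 f i).
Proof.
move=> mf; apply: cmeasurableM; last exact: cmeasurable_kern.
apply: cmeasurableM; last exact: (cmeasurable_comp (cmeasurable_samp b1 i mf)).
by apply: cmeasurableR; exact: measurableT_comp.
Qed.

(** The list [sy y] varies with y, so the sum is written as the pointwise limit of sums over the
    fixed lists [exhaustion n], which become stationary at each point. *)
Lemma cmeasurable_skernel b1 b2 f : cmeasurable f -> cmeasurable (skernel b1 b2 f).
Proof.
move=> mf.
apply: (@cmeasurable_cvg _ _ _ (fun n yz => \sum_(i <- exhaustion n) sterm b1 b2 f i yz)).
  by move=> n; apply: cmeasurable_sum => i; exact: cmeasurable_sterm.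
move=> yz; apply: filterS (exhaustion_sub (sy yz.1)) => n sn.
apply: big_uniq_sub => //; first exact: exhaustion_uniq.
by move=> i; exact: sterm_notin.
Qed.

Lemma kern_close b i y z : psi i y != 0 ->
  cn (kern b i y z - F2 (y^-1 * z)%g) <= 14 * d * cn (F2 (y^-1 * z)%g).
Proof.
move=> /gap gd; rewrite /kern; case: b; last first.
  by rewrite subrr Normc.normc0 !mulr_ge0// normc_ge0.
(* Replacing y by x_i changes the left end of y^-1 z, whereas [F2_mulr_close] moves the right end.
   Conjugation exchanges the two, and z^-1 x_i = (z^-1 y) (y^-1 x_i). *)
have F2inv (a b : G) : F2 (a^-1 * b)%g = (F2 (b^-1 * a)%g)^* by rewrite -F2V invgM invgK.
rewrite !(F2inv _ z) -rmorphB !normc_conj.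
have -> : (z^-1 * x i = (z^-1 * y) * (y^-1 * x i))%g by rewrite mulgA mulgK.
apply: (le_trans (F2_mulr_close _ (le_trans gd _))); first by case/andP : d01.
by rewrite ler_wpM2r ?normc_ge0// ler_wpM2l.
Qed.

Lemma kern_rep b i y z : convolution (kern b i y) F2 z = k%:C * kern b i y z.
Proof. by case: b; rewrite /kern; exact: convolution_ltrans_F2. Qed.

Section fixed_function.
Variables (b1 b2 : bool) (f : G -> C).
Hypothesis rf : in_range p f.
Let Lf : Lp p f. Proof. by case: rf. Qed.
Let mf : cmeasurable f. Proof. by case/LpP : Lf. Qed.
Let nf : (Np (fun y => cn (f y)) < +oo)%E. Proof. by case/LpP : Lf. Qed.
Let fk z : convolution f F2 z = k%:C * f z. Proof. by case: rf. Qed.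
Let M := rabsconv (fun y => cn (f y)).
Let M0 y : 0 <= M y. Proof. by apply: rabsconv_ge0 => z; exact: normc_ge0. Qed.
Let mM : measurable_fun setT M.
Proof. by apply: measurable_rabsconv => [|z]; [exact: measurable_normc|exact: normc_ge0]. Qed.
(** For a sample s of f and a sample K of the kernel F, the error s K - f F is split as (s - f) K +
    f (K - F). Here c1 is the sampling error 28 d / k times the bound 1 + 14 d for |K| / |F|, and c2
    is the kernel error 14 d. So [H2] dominates the deviation from f F, and [H] the sampled kernel
    itself. *)
Let c1 := 28 * d / k * (1 + 14 * d).
Let c2 := 14 * d.
Let c10 : 0 <= c1. Proof.
apply: mulr_ge0; first by apply: divr_ge0; [exact: mulr_ge0|exact: ltW].
by apply: addr_ge0 => //; exact: mulr_ge0.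
Qed.
Let c20 : 0 <= c2. Proof. by rewrite mulr_ge0. Qed.
Let H2 y := c1 * M y + c2 * cn (f y).
Let H y := cn (f y) + H2 y.

Let H20 y : 0 <= H2 y. Proof. by rewrite addr_ge0// mulr_ge0// normc_ge0. Qed.
Let H0 y : 0 <= H y. Proof. by rewrite addr_ge0// normc_ge0. Qed.
Let mn : measurable_fun setT (fun y => cn (f y)). Proof. exact: measurable_normc. Qed.
Let mH2 : measurable_fun setT H2.
Proof. by apply: measurable_funD; apply: measurable_funM. Qed.
Let mH : measurable_fun setT H. Proof. exact: measurable_funD. Qed.

Let NM : (Np M <= (schur_cst p)%:E * Np (fun y => cn (f y)))%E.
Proof. by apply: Lnorm_rabsconv => // y; exact: normc_ge0. Qed.

Let NH2 : (Np H2 <= (c1 * schur_cst p + c2)%:E * Np (fun y => cn (f y)))%E.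
Proof.
apply: (le_trans (@Lnorm_triangle _ p p1 (fun y => c1 * M y) (fun y => c2 * cn (f y)) _ _)).
- exact: measurable_funM.
- exact: measurable_funM.
rewrite !Lnorm_scale//; last by move=> y; exact: normc_ge0.
have cs0 : 0 <= c1 * schur_cst p := mulr_ge0 c10 (schur_cst_ge0 p).
rewrite EFinD ge0_muleDl ?lee_fin//.
by apply: leeD => //; rewrite (EFinM c1) -muleA; apply: lee_wpmul2l; rewrite ?lee_fin.
Qed.

Let NH2y : (Np H2 < +oo)%E.
Proof.
apply: (le_lt_trans NH2); apply: lte_mul_pinfty => //.
by rewrite lee_fin; exact: addr_ge0 (mulr_ge0 c10 (schur_cst_ge0 p)) c20.
Qed.

Let NHy : (Np H < +oo)%E.
Proof.
apply: (le_lt_trans (@Lnorm_triangle _ p p1 (fun y => cn (f y)) H2 mn mH2)).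
exact: lte_add_pinfty.
Qed.

Let samp_close i y : psi i y != 0 -> cn (samp b1 f i y - f y) <= 28 * d / k * M y.
Proof.
move=> /gap gd; rewrite /samp; case: b1; last first.
  by rewrite subrr Normc.normc0 !mulr_ge0 ?invr_ge0// ltW.
have kC : k%:C != 0 :> C by rewrite eq_complex /= (gt_eqF k0).
have fE z : f z = k%:C^-1 * convolution f F2 z by rewrite fk mulKf.
rewrite !fE -mulrBr Normc.normcM Normc.normcV normcR (gtr0_norm k0).
rewrite [leRHS]mulrAC [leRHS]mulrC ler_wpM2l ?invr_ge0 ?(ltW k0)//.
have -> : x i = (y * (y^-1 * x i))%g by rewrite mulgA mulgV mul1g.
apply: (le_trans (convolution_mulr_close p1 y Lf (le_trans gd _))); first by case/andP : d01.
by rewrite -/M ler_wpM2r// ler_wpM2l.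
Qed.

Let prod_close i yz : psi i yz.1 != 0 ->
  cn (samp b1 f i yz.1 * kern b2 i yz.1 yz.2 - f yz.1 * F2 (yz.1^-1 * yz.2)%g) <=
  H2 yz.1 * cn (F2 (yz.1^-1 * yz.2)%g).
Proof.
case: yz => y z /= iy; set F := F2 _.
have hs := samp_close iy; have hk := kern_close b2 z iy; rewrite -/F in hk.
have -> : samp b1 f i y * kern b2 i y z - f y * F =
   (samp b1 f i y - f y) * kern b2 i y z + f y * (kern b2 i y z - F) by ring.
apply: (le_trans (normcD _ _)); rewrite !Normc.normcM.
have hk' : cn (kern b2 i y z) <= (1 + 14 * d) * cn F.
  have -> : kern b2 i y z = F + (kern b2 i y z - F) by rewrite addrC subrK.
  by apply: (le_trans (normcD _ _)); rewrite mulrDl mul1r lerD2l.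
apply: (@le_trans _ _ (28 * d / k * M y * ((1 + 14 * d) * cn F) + cn (f y) * (14 * d * cn F))).
  by apply: lerD; apply: ler_pM; rewrite ?normc_ge0.
by rewrite le_eqVlt; apply/orP; left; apply/eqP; rewrite /H2 /c1 /c2; ring.
Qed.

Let F_sum yz : f yz.1 * F2 (yz.1^-1 * yz.2)%g =
  \sum_(i <- sy yz.1) (psi i yz.1)%:C * (f yz.1 * F2 (yz.1^-1 * yz.2)%g).
Proof. by rewrite -mulr_suml -rmorph_sum sy_sum mul1r. Qed.

Lemma skernel_close yz : cn (skernel b1 b2 f yz - f yz.1 * F2 (yz.1^-1 * yz.2)%g) <=
  H2 yz.1 * cn (F2 (yz.1^-1 * yz.2)%g).
Proof.
rewrite F_sum -sumrB; apply: (le_trans (ler_normc_sum _ _ _)).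
rewrite -[leRHS]mul1r -(sy_sum yz.1) mulr_suml; apply: ler_sum => i _.
rewrite /sterm -mulrA -mulrBr Normc.normcM normcR ger0_norm//.
have [->|iy] := eqVneq (psi i yz.1) 0; first by rewrite !mul0r.
by rewrite ler_wpM2l// prod_close.
Qed.

Lemma sterm_le i yz : cn (sterm b1 b2 f i yz) <=
  psi i yz.1 * (H yz.1 * cn (F2 (yz.1^-1 * yz.2)%g)).
Proof.
rewrite /sterm -mulrA Normc.normcM normcR ger0_norm//.
have [->|iy] := eqVneq (psi i yz.1) 0; first by rewrite !mul0r.
rewrite ler_wpM2l//.
set fF := f yz.1 * F2 (yz.1^-1 * yz.2)%g.
rewrite -[X in cn X](subrK fF); apply: (le_trans (normcD _ _)).
rewrite addrC /H mulrDl; apply: lerD; last exact: prod_close.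
by rewrite Normc.normcM.
Qed.

Lemma skernel_le yz : cn (skernel b1 b2 f yz) <= H yz.1 * cn (F2 (yz.1^-1 * yz.2)%g).
Proof.
apply: (le_trans (ler_normc_sum _ _ _)).
rewrite -[leRHS]mul1r -(sy_sum yz.1) mulr_suml; apply: ler_sum => i _.
exact: sterm_le.
Qed.

Lemma skernel_rep y z : convolution (fun w => skernel b1 b2 f (y, w)) F2 z =
  k%:C * skernel b1 b2 f (y, z).
Proof.
have e i : cintegrable (fun w => sterm b1 b2 f i (y, w) * F2 (w^-1 * z)%g) /\
    cintegral (fun w => sterm b1 b2 f i (y, w) * F2 (w^-1 * z)%g) =
    k%:C * sterm b1 b2 f i (y, z).
  have ik : cintegrable (fun w => kern b2 i y w * F2 (w^-1 * z)%g).
    by rewrite /kern; case: b2; exact: cintegrable_ltrans_F2_F2.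
  rewrite /sterm /=; under eq_fun do rewrite -mulrA.
  split; first exact: cintegrableZ.
  by rewrite cintegralZ// -/(convolution (kern b2 i y) F2 z) kern_rep mulrCA.
rewrite /convolution /skernel /=; under eq_cintegral do rewrite mulr_suml.
have [_ ->] := cintegral_sum (sy y) (fun i => proj1 (e i)).
by rewrite mulr_sumr; apply: eq_bigr => i _; rewrite (proj2 (e i)).
Qed.

Lemma sop_in_range : in_range p (sop b1 b2 f).
Proof.
apply: (in_range_kernel p1 mH H0 NHy (cmeasurable_skernel b1 b2 mf)).
- by move=> y z; exact: (skernel_le (y, z)).
- by move=> y z; exact: skernel_rep.
Qed.

Lemma skernel_cintegrable z : cintegrable (fun y => skernel b1 b2 f (y, z)).
Proof.
apply: (kernel_cintegrable p1 mH H0 NHy (cmeasurable_skernel b1 b2 mf)) => y w.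
exact: (skernel_le (y, w)).
Qed.

Lemma sop_close : (Lp_norm p (fun z => (sop b1 b2 f z - k%:C * f z)%R) <=
  (2 * schur_cst p * (c1 * schur_cst p + c2))%:E * Lp_norm p f)%E.
Proof.
pose K yz := skernel b1 b2 f yz - f yz.1 * F2 (yz.1^-1 * yz.2)%g.
have mK : cmeasurable K.
  by apply: cmeasurableB; [exact: cmeasurable_skernel|exact: cmeasurable_conv_kernel].
have -> : (fun z => sop b1 b2 f z - k%:C * f z) = (fun z => cintegral (fun y => K (y, z))).
  apply/funext => z; rewrite -fk /sop /convolution -cintegralB//.
    exact: skernel_cintegrable.
  exact: (convolution_cintegrable p1 _ Lf).
apply: (le_trans (Lp_norm_kernel p1 mH2 H20 NH2y mK (fun y z => skernel_close (y, z)))).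
by rewrite [X in (_ <= X * _)%E]EFinM -muleA lee_wpmul2l// lee_fin mulr_ge0// schur_cst_ge0.
Qed.

(** The share of the partition of unity at y that the finite list s misses; the tail of the series
    outside s is dominated by [rho s] times H. *)
Let rho (s : seq I) y := 1 - \sum_(i <- s) psi i y.

Let mrho s : measurable_fun setT (rho s).
Proof.
apply: measurable_funB => //; elim: s => [|i s ih].
  by under eq_fun do rewrite big_nil; exact: measurable_cst.
by under eq_fun do rewrite big_cons; exact: measurable_funD.
Qed.

Let sum_le (V : I -> R) (s1 s2 : seq I) : (forall i, 0 <= V i) -> uniq s1 -> uniq s2 ->
  {subset s1 <= s2} -> \sum_(i <- s1) V i <= \sum_(i <- s2) V i.
Proof.
move=> V0 u1 u2 s12.
have -> : \sum_(i <- s1) V i = \sum_(i <- s2 | i \in s1) V i.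
  rewrite -[RHS]big_filter; apply: perm_big; apply: uniq_perm => //; first exact: filter_uniq.
  by move=> i; rewrite mem_filter; case: (boolP (i \in s1)) => //= /s12 ->.
by rewrite [leRHS](bigID (mem s1)) /= lerDl sumr_ge0.
Qed.

Let rhoE s y : uniq s -> rho s y = \sum_(i <- sy y | i \notin s) psi i y.
Proof.
move=> us; rewrite /rho -(sy_sum y) (bigID (mem s)) /=.
have -> : \sum_(i <- s) psi i y = \sum_(i <- sy y | i \in s) psi i y.
  rewrite (bigID (mem (sy y))) /= [X in _ + X]big1 ?addr0; last first.
    by move=> i; exact: psi_notin.
  rewrite -[LHS]big_filter -[RHS]big_filter; apply: perm_big; apply: uniq_perm; rewrite ?filter_uniq//.
  by move=> i; rewrite !mem_filter andbC.
by rewrite addrC addrK.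
Qed.

Let rho0 s y : uniq s -> 0 <= rho s y.
Proof. by move=> us; rewrite rhoE//; apply: sumr_ge0. Qed.

Let rho1 s y : rho s y <= 1.
Proof. by rewrite lerBlDr lerDl sumr_ge0. Qed.

Let rho_anti (s1 s2 : seq I) y : uniq s1 -> uniq s2 -> {subset s1 <= s2} ->
  rho s2 y <= rho s1 y.
Proof. by move=> u1 u2 s12; rewrite lerB// sum_le. Qed.

Let rho_eventually0 y : \forall n \near \oo, rho (exhaustion n) y = 0.
Proof.
apply: filterS (exhaustion_sub (sy y)) => n sn.
rewrite rhoE ?exhaustion_uniq// big_seq_cond big1// => i /andP[isy].
by rewrite sn.
Qed.

Let partial_close s z : uniq s ->
  cn (\sum_(i <- s) sterm b1 b2 f i z - skernel b1 b2 f z) <=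
  rho s z.1 * H z.1 * cn (F2 (z.1^-1 * z.2)%g).
Proof.
move=> us; rewrite -normc_opp opprB /skernel (bigID (mem s)) /=.
have -> : \sum_(i <- s) sterm b1 b2 f i z = \sum_(i <- sy z.1 | i \in s) sterm b1 b2 f i z.
  rewrite (bigID (mem (sy z.1))) /= [X in _ + X]big1 ?addr0; last first.
    by move=> i; exact: sterm_notin.
  rewrite -[LHS]big_filter -[RHS]big_filter; apply: perm_big; apply: uniq_perm; rewrite ?filter_uniq//.
  by move=> i; rewrite !mem_filter andbC.
rewrite addrC addrK; apply: (le_trans (ler_normc_sum _ _ _)).
rewrite rhoE// -mulrA mulr_suml; apply: ler_sum => i _; exact: sterm_le.
Qed.

Lemma sterm_cintegrable i z : cintegrable (fun y => sterm b1 b2 f i (y, z)).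
Proof.
have psi1 y : psi i y <= 1.
  have [->//|iy] := eqVneq (psi i y) 0.
  rewrite -(sy_sum y) (big_rem i) /=; last exact: sy_supp.
  by rewrite lerDl sumr_ge0.
apply: (kernel_cintegrable p1 mH H0 NHy (cmeasurable_sterm b1 b2 i mf)) => y w.
apply: (le_trans (sterm_le i (y, w))).
by rewrite ler_piMl ?mulr_ge0 ?normc_ge0.
Qed.

Let partial_norm s : uniq s ->
  (Lp_norm p (fun z => (\sum_(i <- s) cintegral (fun y => sterm b1 b2 f i (y, z)) -
     sop b1 b2 f z)%R) <= (2 * schur_cst p)%:E * Np (fun y => rho s y * H y)%R)%E.
Proof.
move=> us.
pose K yz := \sum_(i <- s) sterm b1 b2 f i yz - skernel b1 b2 f yz.
have mK : cmeasurable K.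
  apply: cmeasurableB; last exact: cmeasurable_skernel.
  by apply: cmeasurable_sum => i; exact: cmeasurable_sterm.
have -> : (fun z => \sum_(i <- s) cintegral (fun y => sterm b1 b2 f i (y, z)) -
     sop b1 b2 f z) = (fun z => cintegral (fun y => K (y, z))).
  apply/funext => z; have [is1 <-] := cintegral_sum s (fun i => sterm_cintegrable i z).
  rewrite /sop -cintegralB//; exact: skernel_cintegrable.
have mr : measurable_fun setT (fun y => rho s y * H y) by exact: measurable_funM.
apply: (Lp_norm_kernel p1 mr _ _ mK) => //.
- by move=> y; rewrite mulr_ge0// rho0.
- apply: le_lt_trans NHy; apply: Lnorm_ler => //.
    by move=> y; rewrite mulr_ge0// rho0.
  by move=> y; rewrite ler_piMl.
- by move=> y z; exact: (partial_close (y, z)).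
Qed.

(** Dominated convergence with majorant H^p: at each y the remainder is eventually 0, once
    [exhaustion n] contains [sy y]. *)
Let cvg_rho : (fun n => Np (fun y => rho (exhaustion n) y * H y)%R `^ p)%E @ \oo --> 0%E.
Proof.
have mHp : measurable_fun setT (fun y => H y `^ p).
  exact: measurableT_comp (measurable_powR _) mH.
have ru n y : 0 <= rho (exhaustion n) y by rewrite rho0// exhaustion_uniq.
have E n : (Np (fun y => rho (exhaustion n) y * H y)%R `^ p =
    \int[haar]_y ((rho (exhaustion n) y * H y) `^ p)%:E)%E.
  by rewrite Lnorm_powR// => y; rewrite mulr_ge0.
under eq_fun do rewrite E.
have mrn n : measurable_fun setT (fun y => ((rho (exhaustion n) y * H y) `^ p)%:E).
  apply/measurable_EFinP; apply: (measurableT_comp (measurable_powR p)).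
  exact: measurable_funM.
have m0 : measurable_fun setT (fun _ : G => 0%E : \bar R) by exact: measurable_cst.
have h1 : {ae haar, forall y, [set: G] y ->
    (fun n => ((rho (exhaustion n) y * H y) `^ p)%:E) @ \oo --> (0%E : \bar R)}.
  apply/aeW => y _; apply: cvg_near_cst; apply: filterS (rho_eventually0 y) => n ->.
  by rewrite mul0r powR0// gt_eqF.
have h2 : haar.-integrable setT (fun y => (H y `^ p)%:E).
  apply/integrableP; split; first exact/measurable_EFinP.
  under eq_integral do rewrite gee0_abs ?lee_fin ?powR_ge0//.
  by rewrite -Lnorm_powR//; exact: poweR_lty.
have h3 : {ae haar, forall y n, [set: G] y ->
    (`|((rho (exhaustion n) y * H y) `^ p)%:E| <= (H y `^ p)%:E)%E}.
  apply/aeW => y n _; rewrite gee0_abs ?lee_fin ?powR_ge0//.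
  by rewrite ge0_ler_powR ?(ltW p0) ?nnegrE ?mulr_ge0// ler_piMl.
have [_ _] := dominated_convergence measurableT mrn m0 h1 h2 h3.
by rewrite integral0.
Qed.

(** The convergence is unconditional because [rho] decreases as the index set grows: any B
    containing a suitable [exhaustion n] has a remainder at most that of [exhaustion n]. *)
Lemma sop_has_sum :
  Lp_has_sum p (fun i z => cintegral (fun y => sterm b1 b2 f i (y, z))) (sop b1 b2 f).
Proof.
(* The added 1 makes c positive, so that e / c can serve as the tolerance, and strictly larger than
   the factor in [partial_norm]. *)
pose c := 2 * schur_cst p + 1.
have c_gt0 : 0 < c by rewrite ltr_wpDl// mulr_ge0// schur_cst_ge0.
suff small (e : R) : 0 < e -> exists A : {fset I}, forall B : {fset I}, (A `<=` B)%fset ->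
    (Lp_norm p (fun z => (\sum_(i <- B) cintegral (fun y => sterm b1 b2 f i (y, z)) -
     sop b1 b2 f z)%R) < e%:E)%E.
  have tF : ProperFilter (@summability.totally I) by exact: summability.totally_filter.
  apply/fine_cvgP; split.
    have [A hA] := small 1 ltr01.
    exists A => // B AB.
    rewrite /= ge0_fin_numE ?Lnorm_ge0//.
    by apply: (lt_trans (hA B AB)); rewrite ltry.
  apply/cvgrPdist_lt => e e0.
  have [A hA] := small e e0.
  exists A => // B AB /=.
  have N0 := Lnorm_ge0 haar p%:E.
  rewrite sub0r normrN ger0_norm ?fine_ge0 ?Lnorm_ge0//.
  rewrite -lte_fin fineK; first exact: hA.
  rewrite ge0_fin_numE ?Lnorm_ge0//.
  by apply: (lt_trans (hA B AB)); rewrite ltry.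
move=> e0.
have ec0 : 0 < (e / c) `^ p by rewrite powR_gt0// divr_gt0.
have /fine_cvgP[fin /cvgrPdist_lt /(_ _ ec0) cv] := cvg_rho.
have [n [fn cn']] := filter_ex (filterI fin cv).
exists [fset i | i in exhaustion n]%fset => B AB.
apply: (le_lt_trans (partial_norm (fset_uniq B))).
have eN : (Np (fun y => rho (exhaustion n) y * H y)%R < (e / c)%:E)%E.
  rewrite ltNge; apply/negP => hle.
  have inI (t : \bar R) : (0 <= t)%E -> t \in `[0%E, +oo%E].
    by move=> t0; rewrite in_itv/= t0 leey.
  have := gt0_ler_poweR (ltW p0) (inI _ _) (inI _ _) hle.
  rewrite lee_fin Lnorm_ge0 divr_ge0 ?(ltW e0) ?(ltW c_gt0)// => /(_ isT isT).
  rewrite poweR_EFin leNgt => /negP; apply.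
  move: cn'; rewrite sub0r normrN ger0_norm ?fine_ge0 ?poweR_ge0// -lte_fin fineK//.
have sub : {subset exhaustion n <= B}.
  by move=> i iin; apply: (fsubsetP AB); rewrite in_fset /= iin.
apply: (@le_lt_trans _ _ ((2 * schur_cst p)%:E * (e / c)%:E)%E).
  apply: lee_wpmul2l; first by rewrite lee_fin mulr_ge0// schur_cst_ge0.
  apply: le_trans (ltW eN); apply: Lnorm_ler => //.
  - exact: measurable_funM.
  - exact: measurable_funM.
  - by move=> y; rewrite mulr_ge0 // rho0 ?fset_uniq.
  - by move=> y; rewrite ler_wpM2r// rho_anti// ?exhaustion_uniq ?fset_uniq.
rewrite -EFinM lte_fin mulrCA gtr_pMr// ltr_pdivrMr// mul1r.
by rewrite /c ltrDl.
Qed.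

End fixed_function.

Lemma sop_sub b1 b2 f g z : in_range p f -> in_range p g ->
  sop b1 b2 (fun w => f w - g w) z = sop b1 b2 f z - sop b1 b2 g z.
Proof.
move=> rf rg; rewrite /sop -cintegralB; [|exact: (skernel_cintegrable b1 b2 rf)|exact: (skernel_cintegrable b1 b2 rg)].
apply: eq_cintegral => y; rewrite /skernel -sumrB; apply: eq_bigr => i _ /=.
by rewrite /sterm samp_sub; ring.
Qed.

(** The left side is the constant of [sop_close] with c1 and c2 written out; k / 2 is the distance
    from k that the perturbation argument tolerates. *)
Hypothesis small : 2 * schur_cst p * (28 * d / k * (1 + 14 * d) * schur_cst p + 14 * d) <= k / 2.

Lemma sop_invertible b1 b2 : exists S : LpF2 p -> LpF2 p,
  (forall f : LpF2 p,
    Lp_has_sum p (fun i z => cintegral (fun y => sterm b1 b2 (val f) i (y, z))) (val (S f))) /\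
  invertible_with_continuous_inverse S.
Proof.
have [||f rf|S [SE Sinv]] := @perturbation_invertible _ p p1 (sop b1 b2).
- by move=> f; exact: sop_in_range.
- by move=> f g z; exact: sop_sub.
- apply: (le_trans (sop_close b1 b2 rf)); apply: lee_wpmul2r; first exact: Lnorm_ge0.
  by rewrite lee_fin.
exists S; split => // f; rewrite SE; apply: sop_has_sum.
by apply/LpF2_in_range => //; exact: set_valP.
Qed.

Lemma cintegral_psi i : cintegral (fun y => (psi i y)%:C) = (\int[haar]_y psi i y)%:C.
Proof. by rewrite /cintegral /Rintegral /= integral0. Qed.

(** In each series the factors that do not depend on y are pulled out of the integral of the general
    term. Only the whole product is known to be integrable, hence [cintegralZ_weak]. *)
Lemma sampling_operators :
  [/\ exists S : LpF2 p -> LpF2 p,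
        (forall f : LpF2 p,
           Lp_has_sum p
             (fun i z => val f (x i) * convolution (fun y => (psi i y)%:C) F2 z)
             (val (S f))) /\
        invertible_with_continuous_inverse S,
      exists T : LpF2 p -> LpF2 p,
        (forall f : LpF2 p,
           Lp_has_sum p
             (fun i z => (\int[haar]_y psi i y)%:C * val f (x i)
                         * ltrans (x i) F2 z)
             (val (T f))) /\
        invertible_with_continuous_inverse T &
      exists Q : LpF2 p -> LpF2 p,
        (forall f : LpF2 p,
           Lp_has_sum p
             (fun i z => cintegral (fun y => val f y * (psi i y)%:C)
                         * ltrans (x i) F2 z)
             (val (Q f))) /\
        invertible_with_continuous_inverse Q].
Proof.
have rv (f : LpF2 p) : in_range p (val f) by apply/LpF2_in_range => //; exact: set_valP.
split.
- have [S [SE Sinv]] := sop_invertible true false; exists S; split => // f.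
  have := SE f; congr (Lp_has_sum p _ _); apply/funext => i; apply/funext => z.
  have E y : sterm true false (val f) i (y, z) =
      val f (x i) * ((psi i y)%:C * F2 (y^-1 * z)%g) by rewrite /sterm /samp /kern /=; ring.
  under eq_cintegral do rewrite E.
  rewrite cintegralZ_weak//; have := sterm_cintegrable true false (rv f) i z.
  by under eq_fun do rewrite E.
- have [S [SE Sinv]] := sop_invertible true true; exists S; split => // f.
  have := SE f; congr (Lp_has_sum p _ _); apply/funext => i; apply/funext => z.
  have E y : sterm true true (val f) i (y, z) =
      (val f (x i) * ltrans (x i) F2 z) * (psi i y)%:C.
    by rewrite /sterm /samp /kern /ltrans /=; ring.
  under eq_cintegral do rewrite E.
  rewrite cintegralZ_weak ?cintegral_psi; first by ring.
  have := sterm_cintegrable true true (rv f) i z.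
  by under eq_fun do rewrite E.
- have [S [SE Sinv]] := sop_invertible false true; exists S; split => // f.
  have := SE f; congr (Lp_has_sum p _ _); apply/funext => i; apply/funext => z.
  have E y : sterm false true (val f) i (y, z) =
      ltrans (x i) F2 z * (val f y * (psi i y)%:C).
    by rewrite /sterm /samp /kern /ltrans /=; ring.
  under eq_cintegral do rewrite E.
  rewrite cintegralZ_weak; first by rewrite mulrC.
  have := sterm_cintegrable false true (rv f) i z.
  by under eq_fun do rewrite E.
Qed.

End sampling_operator.

(** * The partition of unity *)

Section tent.
Context {R : realType}.
Implicit Types t : R.

Definition tent t : R := Num.max 0 (1 - `|t|).

Lemma tent_ge0 t : 0 <= tent t.
Proof. by rewrite le_max lexx. Qed.

Lemma tent_le1 t : tent t <= 1.
Proof. by rewrite ge_max ler01 lerBlDr lerDl normr_ge0. Qed.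

Lemma tent_neq0 t : tent t != 0 -> `|t| < 1.
Proof. by apply: contraNT; rewrite -leNgt => h; rewrite /tent max_l ?subr_le0. Qed.

Lemma continuous_tent : continuous tent.
Proof.
move=> t; apply: (@continuous_max _ _ (cst 0) (fun t => 1 - `|t|)); first exact: cvg_cst.
by apply: cvgB; [exact: cvg_cst|exact: norm_continuous].
Qed.

(** The integers n at which [tent (t - n)] can be nonzero; for an integer t the second one
    contributes 0. *)
Definition tent_nodes t : seq int := [:: Num.floor t; Num.floor t + 1].

Lemma tent_nodes_uniq t : uniq (tent_nodes t).
Proof. by rewrite /= inE andbT -subr_eq0 opprD addrA subrr sub0r oppr_eq0. Qed.

Lemma tent_nodesP t (n : int) : tent (t - n%:~R) != 0 -> n \in tent_nodes t.
Proof.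
move=> /tent_neq0; rewrite ltr_norml => /andP[h1 h2]; rewrite !inE.
have [nt|tn] := lerP n%:~R t.
  by rewrite (@floor_def _ t n) ?eqxx// nt intrD /=; lra.
rewrite orbC (@floor_def _ t (n - 1)) ?subrK ?eqxx// intrB tn andbT /=; lra.
Qed.

Lemma tent_nodes_sum t : \sum_(n <- tent_nodes t) tent (t - n%:~R) = 1.
Proof.
rewrite !big_cons big_nil addr0.
have := floor_itv t; rewrite !intrD; set f : R := (Num.floor t)%:~R => /andP[h1 h2].
rewrite /tent ger0_norm ?subr_ge0// ler0_norm ?subr_le0 ?(ltW h2)//.
by rewrite !max_r; lra.
Qed.

End tent.

(** * The grid of nodes and its bump functions *)

Section partition.
Context {R : realType}.
Local Notation G := (axb R).
Local Notation fst_ x := (axb_val x).1.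
Local Notation snd_ x := (axb_val x).2.
Variable r : R.
Hypothesis r0 : 0 < r.

(* With s = log_coord y and t = lin_coord m y one has y = node (m, n) * (c, d)
   where c = e^(r (s - m)) and d = r (t - n) / c. *)
Definition node_scale (m : int) : R := expR (r * m%:~R).

Definition node (i : int * int) : G := axb_of (node_scale i.1, node_scale i.1 * r * i.2%:~R).

Definition log_coord (y : G) : R := ln (fst_ y) / r.

(** The product a b is used instead of b because right multiplication of [node (m, n)] by (c, d)
    then acts as a pure shift, from n to n + c d / r. *)
Definition lin_coord (m : int) (y : G) : R := fst_ y * snd_ y / (node_scale m ^+ 2 * r).

Definition bump (i : int * int) (y : G) : R :=
  tent (log_coord y - i.1%:~R) * tent (lin_coord i.1 y - i.2%:~R).

Definition active (y : G) : seq (int * int) :=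
  [seq (m, n) | m <- tent_nodes (log_coord y), n <- tent_nodes (lin_coord m y)].

(** The first coordinate is e^v with |v| <= r; the second, r (t - n) e^-v with |t - n| <= 1, is at
    most r e^r in absolute value. *)
Definition box : set G :=
  [set axb_of (expR z.1, z.2) | z in `[- r, r] `*` `[- (r * expR r), r * expR r]].

Lemma bump_ge0 i y : 0 <= bump i y.
Proof. by rewrite mulr_ge0 ?tent_ge0. Qed.

Lemma bump_le1 i y : bump i y <= 1.
Proof. by rewrite mulr_ile1 ?tent_ge0 ?tent_le1. Qed.

Lemma bump_neq0 i y : bump i y != 0 ->
  `|log_coord y - i.1%:~R| < 1 /\ `|lin_coord i.1 y - i.2%:~R| < 1.
Proof. by rewrite mulf_eq0 negb_or => /andP[/tent_neq0 ? /tent_neq0]. Qed.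

Lemma active_uniq y : uniq (active y).
Proof.
apply: allpairs_uniq_dep => [|m _|[m n] [m' n'] _ _ /= [-> ->]//]; exact: tent_nodes_uniq.
Qed.

Lemma bump_active i y : bump i y != 0 -> i \in active y.
Proof.
case: i => m n; rewrite mulf_eq0 negb_or => /andP[/tent_nodesP ms /tent_nodesP ns].
by apply/allpairsPdep; exists m, n.
Qed.

(** Within a row m the tents in n add up to 1, although [lin_coord m] depends on m; the tents in m
    remain and add up to 1 as well. *)
Lemma bump_sum y : \sum_(i <- active y) bump i y = 1.
Proof.
rewrite big_allpairs_dep /=.
under eq_bigr do rewrite /bump /= -mulr_sumr tent_nodes_sum mulr1.
exact: tent_nodes_sum.
Qed.

Lemma continuous_axb_fst : continuous (fun y : G => fst_ y).
Proof.
move=> y; apply: (@continuous_comp _ _ _ (@axb_val R) fst); first exact: continuous_axb_val.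
exact: cvg_fst.
Qed.

Lemma continuous_axb_snd : continuous (fun y : G => snd_ y).
Proof.
move=> y; apply: (@continuous_comp _ _ _ (@axb_val R) snd); first exact: continuous_axb_val.
exact: cvg_snd.
Qed.

Lemma continuous_log_coord : continuous log_coord.
Proof.
move=> y; have h : (ln (fst_ z) @[z --> y] --> ln (fst_ y)).
  apply: (@continuous_comp _ _ _ (fun y : G => fst_ y) (@ln R)).
    exact: continuous_axb_fst.
  exact: continuous_ln (fst_gt0 y).
exact: (cvgM h (cvg_cst _)).
Qed.

Lemma continuous_lin_coord m : continuous (lin_coord m).
Proof.
move=> y.
exact: (cvgM (cvgM (@continuous_axb_fst y) (@continuous_axb_snd y)) (cvg_cst _)).
Qed.

Lemma continuous_bump i : continuous (bump i).
Proof.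
move=> y.
have h1 : tent (log_coord z - i.1%:~R) @[z --> y] --> tent (log_coord y - i.1%:~R).
  apply: (@continuous_comp _ _ _ (fun y => log_coord y - i.1%:~R) tent).
    exact: (cvgB (@continuous_log_coord y) (cvg_cst _)).
  exact: continuous_tent.
have h2 : tent (lin_coord i.1 z - i.2%:~R) @[z --> y] --> tent (lin_coord i.1 y - i.2%:~R).
  apply: (@continuous_comp _ _ _ (fun y => lin_coord i.1 y - i.2%:~R) tent).
    exact: (cvgB (@continuous_lin_coord i.1 y) (cvg_cst _)).
  exact: continuous_tent.
exact: (cvgM h1 h2).
Qed.

Lemma measurable_bump i : measurable_fun setT (bump i).
Proof.
have mt := continuous_measurable_fun (@continuous_tent R).
apply: measurable_funM; apply: (measurableT_comp mt); apply: measurable_funB => //.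
  apply: measurable_funM => //.
  exact: (measurableT_comp (@measurable_ln R)) measurable_axb_fst.
apply: measurable_funM => //; apply: measurable_funM.
  exact: measurable_axb_fst.
exact: measurable_axb_snd.
Qed.

Lemma partition_of_unity_bump : partition_of_unity bump.
Proof.
split; [exact: continuous_bump|by move=> i z; rewrite bump_ge0 bump_le1|].
move=> z; transitivity (\esum_(i in [set` active z]) (bump i z)%:E)%E.
  rewrite [RHS]esum_mkcond; apply: eq_esum => i _.
  case: ifPn => //; rewrite notin_setE => /= ai; congr EFin; apply/eqP.
  by apply: contra_notT ai => /bump_active.
rewrite esum_fset; [|exact: finite_seq|by move=> i _; rewrite lee_fin bump_ge0].
by rewrite -fsbig_seq ?active_uniq// sumEFin bump_sum.
Qed.

Let r_neq0 : r != 0. Proof. by rewrite gt_eqF. Qed.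

Let scale_gt0 m : 0 < node_scale m. Proof. exact: expR_gt0. Qed.

Let scale_neq0 m : node_scale m != 0. Proof. by rewrite gt_eqF. Qed.

Lemma fst_log_coord m y : fst_ y = node_scale m * expR (r * (log_coord y - m%:~R)).
Proof.
rewrite /node_scale -expRD mulrBr addrC subrK /log_coord mulrCA mulfV// mulr1.
by rewrite lnK// posrE fst_gt0.
Qed.

Lemma node_valE i : axb_val (node i) = (node_scale i.1, node_scale i.1 * r * i.2%:~R).
Proof. by apply: axb_ofK; exact: scale_gt0. Qed.

(** The inequalities are not strict, so that the closed support of a bump, and not only the set
    where it is nonzero, lands in the translate of the box. *)
Lemma node_box i y : `|log_coord y - i.1%:~R| <= 1 -> `|lin_coord i.1 y - i.2%:~R| <= 1 ->
  lcoset_set (node i) box y.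
Proof.
move=> si ti; set v := r * (log_coord y - i.1%:~R).
have vr : - r <= v <= r by rewrite -ler_norml normrM gtr0_norm// ger_pMr.
exists (axb_of (expR v, r * (lin_coord i.1 y - i.2%:~R) * expR (- v))).
  exists (v, r * (lin_coord i.1 y - i.2%:~R) * expR (- v)) => //; split; rewrite /= in_itv//=.
  rewrite -ler_norml !normrM (gtr0_norm r0) (ger0_norm (expR_ge0 _)) -mulrA ler_pM2l//.
  apply: le_trans (_ : expR (- v) <= _); first by rewrite ler_piMl// expR_ge0.
  by rewrite ler_expR; lra.
apply: val_inj; rewrite /= axb_valM node_valE axb_ofK ?expR_gt0//=.
rewrite /lin_coord [RHS]surjective_pairing (fst_log_coord i.1 y) -/v expRN.
have := expR_gt0 v; have := scale_gt0 i.1; move: (expR v) (node_scale i.1) => c s s0 c0.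
by congr pair; field; rewrite !gt_eqF.
Qed.

Lemma node_gap i y : bump i y != 0 ->
  axb_gap (y^-1 * node i)%g <= expR (2 * r) - 1 + expR (2 * r) * r.
Proof.
move=> /bump_neq0[/ltW si /ltW ti]; set v := r * (log_coord y - i.1%:~R).
have vr : - r <= v <= r by rewrite -ler_norml normrM gtr0_norm// ger_pMr.
rewrite /axb_gap axb_valM axb_valV node_valE /=.
have -> : (fst_ y)^-1 * node_scale i.1 = expR (- v).
  by rewrite (fst_log_coord i.1 y) -/v expRN invfM mulrAC mulVf// mul1r.
have -> : expR (- v) * ((fst_ y)^-1 * (node_scale i.1 * r * i.2%:~R) +
    - snd_ y * (node_scale i.1)^-1) = expR (- v) ^+ 2 * (r * (i.2%:~R - lin_coord i.1 y)).
  rewrite /lin_coord (fst_log_coord i.1 y) -/v expRN.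
  have := expR_gt0 v; have := scale_gt0 i.1; move: (expR v) (node_scale i.1) => c s s0 c0.
  by field; rewrite !gt_eqF.
have -> : expR (- v) ^+ 2 = expR (- (2 * v)) by rewrite expr2 -expRD; congr expR; ring.
have u1 : expR (- (2 * v)) <= expR (2 * r) by rewrite ler_expR; lra.
have u2 : expR (- (2 * r)) <= expR (- (2 * v)) by rewrite ler_expR; lra.
(* By AM-GM, 1 - e^(-2r) <= e^(2r) - 1, so a single bound covers both signs of e^(-2v) - 1. *)
have u3 : 2 <= expR (2 * r) + expR (- (2 * r)).
  have := expR_gt0 (2 * r); rewrite expRN; move: (expR _) => E E0.
  rewrite -subr_ge0 (_ : _ - _ = (E - 1) ^+ 2 / E); first by rewrite divr_ge0 ?sqr_ge0 ?ltW.
  by field; rewrite gt_eqF.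
apply: lerD; first by rewrite ler_norml; apply/andP; split; lra.
rewrite !normrM (ger0_norm (expR_ge0 _)) (gtr0_norm r0) distrC.
by apply: ler_pM => //; rewrite ?expR_ge0 ?ger_pMr// mulr_ge0// ltW.
Qed.

Lemma node_dense : U_dense box node.
Proof.
apply/seteqP; split => // y _.
have [i bi] : exists i, bump i y != 0.
  apply: contrapT => nb; have := bump_sum y; rewrite big1; first by move/eqP; rewrite eq_sym oner_eq0.
  by move=> i _; apply/eqP/negPn/negP => bi; apply: nb; exists i.
by exists i => //; have [/ltW ? /ltW ?] := bump_neq0 bi; exact: node_box.
Qed.

Lemma fsupp_bump i : fsupp (bump i) `<=` lcoset_set (node i) box.
Proof.
pose A : set G := (fun y => `|log_coord y - i.1%:~R|) @^-1` [set x | x <= 1] `&`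
  (fun y => `|lin_coord i.1 y - i.2%:~R|) @^-1` [set x | x <= 1].
have c1 : continuous (fun y => `|log_coord y - i.1%:~R|).
  move=> y; apply: (@continuous_comp _ _ _ (fun y => log_coord y - i.1%:~R) Num.norm).
    exact: (cvgB (@continuous_log_coord y) (cvg_cst _)).
  exact: norm_continuous.
have c2 : continuous (fun y => `|lin_coord i.1 y - i.2%:~R|).
  move=> y; apply: (@continuous_comp _ _ _ (fun y => lin_coord i.1 y - i.2%:~R) Num.norm).
    exact: (cvgB (@continuous_lin_coord i.1 y) (cvg_cst _)).
  exact: norm_continuous.
have cA : closed A.
  by apply: closedI; apply: closed_comp; try exact: closed_le; move=> y _; [exact: c1|exact: c2].
apply: (@subset_trans _ A); last by move=> y [/= ? ?]; exact: node_box.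
rewrite (closure_id A).1//; apply: closureS => y /= /bump_neq0[/ltW ? /ltW ?]; split => //.
Qed.

Lemma box_nbhs_one : compact_nbhs_one box.
Proof.
split.
  apply: continuous_compact; last by apply: compact_setX; exact: segment_compact.
  apply: continuous_subspaceT; apply: continuous_comp_initial.
  have -> : @axb_val R \o (fun z : R * R => axb_of (expR z.1, z.2)) = (fun z => (expR z.1, z.2)).
    by apply/funext => z /=; rewrite axb_ofK ?expR_gt0.
  move=> z.
  have e1 : expR w.1 @[w --> z] --> expR z.1.
    by apply: (@continuous_comp _ _ _ fst (@expR R)); [exact: cvg_fst|exact: continuous_expR].
  have e2 : w.2 @[w --> z] --> z.2 by exact: cvg_snd.
  exact: (cvg_pair e1 e2).
have c1 := @continuous_log_coord 1%g; have c2 := @continuous_axb_snd 1%g.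
have l1 : log_coord 1%g = 0 by rewrite /log_coord axb_val1 ln1 mul0r.
have s1 : snd_ (1%g : G) = 0 by rewrite axb_val1.
move: c1 => /cvgrPdist_lt /(_ _ ltr01); rewrite l1 => h1.
have rr : 0 < r * expR r by rewrite mulr_gt0// expR_gt0.
move: c2 => /cvgrPdist_lt /(_ _ rr); rewrite s1 => h2.
apply: filterS2 h1 h2 => y; rewrite !sub0r !normrN => h1 h2.
exists (r * log_coord y, snd_ y).
  split; rewrite /= in_itv /= -ler_norml ?(ltW h2)//.
  by rewrite normrM gtr0_norm// ger_pMr// ltW.
apply: val_inj; rewrite /= axb_ofK ?expR_gt0//= [RHS]surjective_pairing.
by rewrite /log_coord mulrCA mulfV// mulr1 lnK// posrE fst_gt0.
Qed.

End partition.

(** With r = d / 6 <= 1/12, inverting e^(-2r) >= 1 - 2 r gives e^(2r) <= 1 + 4 r, so the left side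
    is at most 5 r + 4 r^2 <= 6 r = d. *)
Lemma small_gap {R : realType} (d : R) : 0 < d <= 2^-1 ->
  expR (2 * (d / 6)) - 1 + expR (2 * (d / 6)) * (d / 6) <= d.
Proof.
move=> /andP[d0 d2]; set r := d / 6; have rd : d = 6 * r by rewrite /r; field.
have r0 : 0 < r by lra.
suff : expR (2 * r) <= 1 + 4 * r by nra.
have h : 1 - 2 * r <= expR (- (2 * r)) by rewrite -mulNr; exact: expR_ge1Dx.
have E := expR_gt0 (2 * r); move: h; rewrite expRN => h.
have : (1 - 2 * r) * expR (2 * r) <= 1 by rewrite -ler_pdivlMr// div1r.
nra.
Qed.

Lemma small_constant {R : realType} (s k : R) : 0 <= s -> 0 < k -> exists d : R, 0 < d <= 2^-1 /\
  2 * s * (28 * d / k * (1 + 14 * d) * s + 14 * d) <= k / 2.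
Proof.
(* 224 = 28 * 8 comes from 1 + 14 d <= 8 for d <= 1/2, which makes the left side at most c d.
   Dividing by c + 1 below also covers s = 0, where c = 0. *)
move=> s0 k0; pose c := 2 * s * (224 / k * s + 14).
have k'0 : 0 < k^-1 by rewrite invr_gt0.
have c0 : 0 <= c by rewrite /c !mulr_ge0// addr_ge0// mulr_ge0// divr_ge0// ltW.
pose d := Num.min 2^-1 (k / 2 / (c + 1)).
have d0 : 0 < d by rewrite lt_min invr_gt0 ltr0n /= !divr_gt0// ltr_wpDl.
have d2 : d <= 2^-1 by rewrite ge_min lexx.
exists d; split; first by rewrite d0.
apply: (@le_trans _ _ (c * d)).
  rewrite [leRHS](_ : _ = 2 * s * (224 * (d * s / k) + 14 * d)); last by rewrite /c; ring.
  apply: ler_wpM2l; first by rewrite mulr_ge0.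
  rewrite lerD2r (_ : _ * s = 28 * (1 + 14 * d) * (d * s / k)); last by ring.
  apply: ler_wpM2r; last by lra.
  by rewrite divr_ge0 ?mulr_ge0// ltW.
have c1 : 0 < c + 1 by rewrite ltr_wpDl.
have : d * (c + 1) <= k / 2 by rewrite -ler_pdivlMr// ge_min lexx orbT.
nra.
Qed.

Theorem proposition4p7 (R : realType) (p : R) (hp : 1 < p) :
  exists (U : set (axb R)) (I : choiceType) (x : I -> axb R)
         (psi : I -> axb R -> R),
  [/\ compact_nbhs_one U,
      U_dense U x,
      partition_of_unity psi &
      forall i, fsupp (psi i) `<=` lcoset_set (x i) U] /\
  [/\ (* (a) *) exists S : LpF2 p -> LpF2 p,
        (forall f : LpF2 p,
           Lp_has_sum p
             (fun i z => val f (x i) * convolution (fun y => (psi i y)%:C) F2 z)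
             (val (S f))) /\
        invertible_with_continuous_inverse S,
      (* (b) *) exists T : LpF2 p -> LpF2 p,
        (forall f : LpF2 p,
           Lp_has_sum p
             (fun i z => (\int[haar]_y psi i y)%:C * val f (x i)
                         * ltrans (x i) F2 z)
             (val (T f))) /\
        invertible_with_continuous_inverse T &
      (* (c) *) exists Q : LpF2 p -> LpF2 p,
        (forall f : LpF2 p,
           Lp_has_sum p
             (fun i z => cintegral (fun y => val f y * (psi i y)%:C)
                         * ltrans (x i) F2 z)
             (val (Q f))) /\
        invertible_with_continuous_inverse Q].
Proof.
(* The tolerance d is fixed first, from [schur_cst p] and k = pi / 4, and the mesh r = d / 6 then
   brings all gaps below d. *)
have [d [/andP[d0 d2] small]] := small_constant (schur_cst_ge0 p) (divr_gt0 (@pi_gt0 R) (ltr0Sn R 3)).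
pose r := d / 6; have r0 : 0 < r by rewrite divr_gt0.
exists (box r), (int * int)%type, (node r), (bump r); split.
  split; [exact: box_nbhs_one|exact: node_dense|exact: partition_of_unity_bump|].
  exact: fsupp_bump.
apply: (@sampling_operators _ p hp _ (node r) (bump r) (active r) d) => //.
- exact: measurable_bump.
- exact: bump_ge0.
- exact: active_uniq.
- exact: bump_active.
- exact: bump_sum.
- by rewrite (ltW d0).
- move=> i y /(node_gap r0) /le_trans; apply.
  by apply: small_gap; rewrite d0.
Qed.
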